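(* Let $G$ be a finite subcubic graph (every vertex has degree at most $3$) which has no connected component isomorphic to $K_{3,3}$ or to the $5$-cycle $C_5$. Then $G$ is superlinearly $4$-choosable: for every family $L=\{L(v): v\in V(G)\}$ of lists with $|L(v)|=4$ for all $v$, there is a superlinear $L$-coloring of $G$.
   Context: A proper $L$-coloring of $G$ is a map $f$ on $V(G)$ with $f(v)\in L(v)$ for every $v$ and $f(u)\neq f(v)$ for every edge $uv$. It is linear if for any two colors the subgraph of $G$ induced by the vertices receiving one of these two colors is a linear forest (a disjoint union of paths). A linear $L$-coloring is superlinear if, in addition, for every vertex of degree exactly two, its two neighbors receive different colors. $G$ is superlinearly $4$-choosable if for every family of lists of size $4$ it has a superlinear $L$-coloring. *)

(* Defs.v *)
From HB Require Import structures.
From mathcomp Require Import all_boot finmap.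
Set Implicit Arguments. Unset Strict Implicit. Unset Printing Implicit Defensive.

Record sgraph := SGraph {
  vertex :> finType;
  edge : rel vertex;
  edge_sym : symmetric edge;
  edge_irrefl : irreflexive edge }.

Definition isomorphic (G H : sgraph) : Prop :=
  exists phi : G -> H,
    bijective phi /\ forall u v : G, edge (phi u) (phi v) = edge u v.

Definition neighbors (G : sgraph) (v : G) : {set G} := [set u | edge v u].

Definition degree (G : sgraph) (v : G) : nat := #|neighbors v|.

Definition subcubic (G : sgraph) : Prop := forall v : G, degree v <= 3.

Section Induced.
Variables (G : sgraph) (S : {set G}).

Definition induced_edge : rel {x : G | x \in S} :=
  fun u v => edge (val u) (val v).

Lemma induced_edge_sym : symmetric induced_edge.
Proof. by move=> u v; apply: edge_sym. Qed.

Lemma induced_edge_irrefl : irreflexive induced_edge.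
Proof. by move=> u; apply: edge_irrefl. Qed.

Definition induced : sgraph := SGraph induced_edge_sym induced_edge_irrefl.
End Induced.

Definition component (G : sgraph) (x : G) : sgraph :=
  induced [set y : G | connect (@edge G) x y].

Definition has_component (G H : sgraph) : Prop :=
  exists x : G, isomorphic (component x) H.

Definition path_edge (n : nat) : rel 'I_n :=
  fun i j => (i.+1 == j) || (j.+1 == i).

Lemma path_edge_sym n : symmetric (@path_edge n).
Proof. by move=> i j; apply: orbC. Qed.

Lemma path_edge_irrefl n : irreflexive (@path_edge n).
Proof. by move=> i; rewrite /path_edge orbb eqn_leq ltnn. Qed.

Definition path_graph (n : nat) : sgraph :=
  SGraph (@path_edge_sym n) (@path_edge_irrefl n).

Definition C5_edge : rel 'I_5 :=
  fun i j => (i.+1 == j %[mod 5]) || (j.+1 == i %[mod 5]).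

Lemma C5_edge_sym : symmetric C5_edge.
Proof. by move=> i j; apply: orbC. Qed.

Lemma C5_edge_irrefl : irreflexive C5_edge.
Proof. by case; do 5?[case=> //]. Qed.

Definition C5 : sgraph := SGraph C5_edge_sym C5_edge_irrefl.

Definition bip_edge (m n : nat) : rel ('I_m + 'I_n)%type :=
  fun u v => match u, v with
             | inl _, inr _ | inr _, inl _ => true
             | _, _ => false
             end.

Lemma bip_edge_sym m n : symmetric (@bip_edge m n).
Proof. by case=> i []. Qed.

Lemma bip_edge_irrefl m n : irreflexive (@bip_edge m n).
Proof. by case. Qed.

Definition complete_bipartite (m n : nat) : sgraph :=
  SGraph (@bip_edge_sym m n) (@bip_edge_irrefl m n).

Definition K33 : sgraph := complete_bipartite 3 3.

Definition linear_forest (G : sgraph) : Prop :=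
  forall x : G, exists n : nat, isomorphic (component x) (path_graph n).

Section Coloring.
Variables (G : sgraph) (C : choiceType) (L : G -> {fset C}) (f : G -> C).

Definition proper_coloring : Prop :=
  (forall v : G, f v \in L v) /\ (forall u v : G, edge u v -> f u <> f v).

Definition linear_coloring : Prop :=
  proper_coloring /\
  forall a b : C, a <> b ->
    linear_forest (induced [set v : G | (f v == a) || (f v == b)]).

Definition superlinear_coloring : Prop :=
  linear_coloring /\
  forall v : G, degree v = 2 ->
    forall u w : G, edge v u -> edge v w -> u <> w -> f u <> f w.
End Coloring.

Definition superlinearly_choosable (k : nat) (G : sgraph) : Prop :=
  forall (C : choiceType) (L : G -> {fset C}),
    (forall v : G, #|` L v| = k) ->
    exists f : G -> C, superlinear_coloring L f.

(* Main.v *)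
Require Import Defs.
From mathcomp Require Import all_boot finmap zify.
From Stdlib Require Import Classical.
Set Implicit Arguments. Unset Strict Implicit. Unset Printing Implicit Defensive.

(** Induction on the number of vertices of an induced subgraph [A], for a statement in which a
    set [Z] of vertices is exempted from having two neighbours of different colours: [A] can be
    coloured as soon as every component of [A] that is a 5-cycle with equal lists meets [Z].
    The exemption is what makes the induction work, since deleting vertices may create such
    5-cycles; an exempted vertex gets its second colour when the deleted part is put back.
    Vertices of degree at most one and adjacent vertices of degree two are deleted directly.
    Otherwise one deletes a shortest path joining two vertices of degree two, or a shortest
    cycle if it is not longer. The vertices of the deleted part are coloured around it so that each
    avoids its predecessor, its outer neighbour and the next outer neighbour, which keeps
    two-coloured cycles from passing through the part. The exceptional configurations are
    K_{2,3}, even cycles with alternating outer colours (a Kempe-type recolouring), and the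
    Petersen graph. *)

(** On a 5-cycle component, vertices at distance two must differ, so five distinct colours are
    needed: fatal exactly when all five lists are equal. Exempting one vertex is enough, since the
    pattern a, m, b, e, m repeats a colour only around that vertex. Demanding two colours around
    every vertex with at least two neighbours is superlinearity at degree two; at degree three it
    forbids three neighbours in a two-coloured subgraph. What remains of linearity is the absence of
    two-coloured cycles. Lists of size 4 allow three constraints per deleted vertex: its
    predecessor, its outer neighbour and the next outer neighbour. The last vertex of a path has no
    next outer neighbour, so its third constraint can repair one exempted vertex. The obstacle is to
    force every bad 5-cycle of the remainder through that vertex. Shortness of the deleted part does
    this: degree-two vertices are far apart, so a remaining 5-cycle must contain three or four of
    the few outer neighbours. K_{3,3} matters only as a K_{2,3} whose three leaves have a common
    further neighbour. *)

Lemma fset_fresh (C : choiceType) (M : {fset C}) (s : seq C) :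
  size s < #|` M| -> exists2 x, x \in M & x \notin s.
Proof.
move=> lt_sM; case: (boolP (has (fun x => x \notin s) M)) => [/hasP[x xM xs]|].
  by exists x.
rewrite -all_predC => /allP subMs; move: lt_sM; rewrite ltnNge => /negP[].
by apply: uniq_leq_size => // x /subMs /=; rewrite negbK.
Qed.

Lemma min_nat (P : nat -> Prop) : (exists n, P n) ->
  exists n, P n /\ forall m, P m -> n <= m.
Proof.
case=> n; elim/ltn_ind: n => n IH Pn.
case: (classic (exists2 m, m < n & P m)) => [[m lt_mn Pm]|nP]; first exact: IH Pm.
exists n; split=> // m Pm; rewrite leqNgt; apply/negP => lt_mn.
by apply: nP; exists m.
Qed.

(** * Good colourings and their extension to a deleted set *)

Definition nb (G : sgraph) (A : {set G}) (v : G) : {set G} :=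
  [set u in A | edge v u].

(** At a vertex of degree two this is superlinearity; at degree three it keeps the degree in every
    two-coloured subgraph at most two. *)
Definition nonconst (G : sgraph) (C : choiceType) (f : G -> C) (A : {set G}) (v : G) :=
  exists u w, [/\ u \in A, w \in A, edge v u, edge v w & f u <> f w].

(** A finite graph of minimum degree two contains a cycle, so having no nonempty core means having
    no two-coloured cycle. Working with vertex sets avoids choosing a cycle. *)
Definition core (G : sgraph) (C : choiceType) (f : G -> C) (X : {set G}) :=
  (exists a b, forall x, x \in X -> f x = a \/ f x = b) /\
  forall x, x \in X ->
    exists u w, [/\ u \in X, w \in X, u <> w, edge x u & edge x w].

(* Superlinearity of [f] on the subgraph induced by [A], except that the
   vertices of [Z] may have all their neighbours of one colour. *)
Definition good (G : sgraph) (C : choiceType) (L : G -> {fset C})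
    (Z A : {set G}) (f : G -> C) : Prop :=
  [/\ forall v, v \in A -> f v \in L v,
      forall u v, u \in A -> v \in A -> edge u v -> f u <> f v,
      forall v, v \in A -> v \notin Z -> 1 < #|nb A v| -> nonconst f A v &
      forall X : {set G}, X \subset A -> core f X -> X = set0].

Section Basics.
Variables (G : sgraph) (C : choiceType) (L : G -> {fset C}).
Implicit Types (A B E S X Z : {set G}) (f g : G -> C) (u v w : G).

Lemma edgeC u v : edge u v = edge v u.
Proof. exact: edge_sym. Qed.

Lemma edge_neq u v : edge u v -> u <> v.
Proof. by move=> + uv; rewrite uv edge_irrefl. Qed.

Lemma in_nb A v u : (u \in nb A v) = (u \in A) && edge v u.
Proof. by rewrite inE. Qed.

Lemma nbS A B v : B \subset A -> nb B v \subset nb A v.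
Proof.
by move=> /subsetP sBA; apply/subsetP=> u; rewrite !in_nb => /andP[/sBA -> ->].
Qed.

Lemma two_nb A v u w : u \in A -> w \in A -> edge v u -> edge v w -> u <> w ->
  1 < #|nb A v|.
Proof.
move=> uA wA vu vw neq; apply/card_gt1P; exists u, w.
by rewrite !in_nb uA wA vu vw; split=> //; apply/eqP.
Qed.

Lemma nb_gt1P A v : 1 < #|nb A v| ->
  exists u w, [/\ u \in A, w \in A, edge v u, edge v w & u <> w].
Proof.
case/card_gt1P=> u [w []]; rewrite !in_nb => /andP[uA vu] /andP[wA vw] /eqP neq.
by exists u, w.
Qed.

Lemma nb_other A v u : 1 < #|nb A v| ->
  exists w, [/\ w \in A, edge v w & w <> u].
Proof.
case/nb_gt1P=> x [y [xA yA vx vy xy]]; case: (eqVneq x u) => [xu|/eqP]; last by exists x.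
by exists y; split=> //; rewrite -xu => /esym.
Qed.

Lemma nb_le1 A v u w : #|nb A v| <= 1 -> u \in A -> w \in A -> edge v u -> edge v w ->
  u = w.
Proof.
move=> le1 uA wA vu vw; apply: NNPP => /(two_nb uA wA vu vw).
by rewrite ltnNge le1.
Qed.

Lemma nb_le2 A v u w x : #|nb A v| <= 2 -> u \in A -> w \in A -> x \in A ->
  edge v u -> edge v w -> edge v x -> u <> w -> x = u \/ x = w.
Proof.
move=> le2 uA wA xA vu vw vx /eqP neq.
case: (eqVneq x u) => [->|xu]; first by left.
case: (eqVneq x w) => [->|xw]; first by right.
have: [:: u; w; x] \subset nb A v.
  apply/subsetP=> y; rewrite !inE => /or3P[]/eqP->; apply/andP; split=> //.
move/subset_leq_card; rewrite (card_uniqP _) /=; last by rewrite !inE negb_or neq eq_sym xu eq_sym xw.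
by move/leq_trans=> /(_ _ le2).
Qed.

Lemma nb_le3 A v u w x y : #|nb A v| <= 3 ->
  u \in A -> w \in A -> x \in A -> y \in A ->
  edge v u -> edge v w -> edge v x -> edge v y ->
  u <> w -> u <> x -> w <> x -> [\/ y = u, y = w | y = x].
Proof.
move=> le3 uA wA xA yA vu vw vx vy /eqP uw /eqP ux /eqP wx.
case: (eqVneq y u) => [->|yu]; first by constructor 1.
case: (eqVneq y w) => [->|yw]; first by constructor 2.
case: (eqVneq y x) => [->|yx]; first by constructor 3.
have: [:: u; w; x; y] \subset nb A v.
  by apply/subsetP=> z; rewrite !inE => /or4P[]/eqP->; apply/andP; split.
move/subset_leq_card; rewrite (card_uniqP _) /=; last first.
  by rewrite !inE !negb_or uw ux wx eq_sym yu eq_sym yw eq_sym yx.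
by move/leq_trans=> /(_ _ le3).
Qed.

Lemma nb_card2 A v u w : u \in A -> w \in A -> edge v u -> edge v w -> u <> w ->
  (forall x, x \in A -> edge v x -> x = u \/ x = w) -> #|nb A v| = 2.
Proof.
move=> uA wA vu vw neq H; apply/eqP; rewrite eqn_leq (two_nb uA wA vu vw neq) andbT.
apply: leq_trans (_ : #|[set u; w]| <= 2); last by rewrite cards2; case: eqP.
by apply/subset_leq_card/subsetP=> x; rewrite in_nb !inE => /andP[xA /(H _ xA)[]->]; rewrite eqxx ?orbT.
Qed.

Lemma nb_rem A B v c : (forall u, u \in A -> edge v u -> u = c \/ u \in B) ->
  #|nb A v| <= #|nb B v|.+1.
Proof.
move=> H; apply: leq_trans (_ : #|c |: nb B v| <= _).
  apply/subset_leq_card/subsetP=> u; rewrite in_nb in_setU1 in_nb => /andP[uA vu].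
  by case: (H u uA vu) => [->|->]; rewrite ?eqxx ?vu ?orbT.
by rewrite cardsU1; case: (_ \in _).
Qed.

Lemma card_nbT A v : #|nb A v| <= #|neighbors v|.
Proof. by apply/subset_leq_card/subsetP=> u; rewrite in_nb inE => /andP[]. Qed.

Lemma nonconstS f A B v : B \subset A -> nonconst f B v -> nonconst f A v.
Proof.
by move=> /subsetP sBA [u [w [uB wB ? ? ?]]]; exists u, w; split=> //; apply: sBA.
Qed.

Lemma eq_nonconst f g A v : {in A, f =1 g} -> nonconst f A v -> nonconst g A v.
Proof.
by move=> fg [u [w [uB wB ? ? ?]]]; exists u, w; split=> //; rewrite -!fg.
Qed.

Lemma eq_core f g X : {in X, f =1 g} -> core f X -> core g X.
Proof.
move=> fg [[a [b H]] H2]; split=> //; exists a, b => x xX.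
by rewrite -fg //; apply: H.
Qed.

Lemma eq_good f g Z A : {in A, f =1 g} -> good L Z A f -> good L Z A g.
Proof.
move=> fg [H1 H2 H3 H4]; split.
- by move=> v vA; rewrite -fg //; apply: H1.
- by move=> u v uA vA; rewrite -!fg //; apply: H2.
- by move=> v vA vZ /(H3 v vA vZ); apply: eq_nonconst.
- move=> X XA /(eq_core (g := f)) H; apply: H4 => //; apply: H => x xX.
  by rewrite fg // (subsetP XA).
Qed.

Lemma good_weaken Z Z' A f : Z \subset Z' -> good L Z A f -> good L Z' A f.
Proof.
move=> /subsetP sZ [H1 H2 H3 H4]; split=> // v vA vZ; apply: H3 => //.
by apply: contra vZ; apply: sZ.
Qed.

Definition proper_on A f :=
  forall u v, u \in A -> v \in A -> edge u v -> f u <> f v.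

(** Both neighbours take the one of the two colours that [x] does not have. *)
Lemma core_same f A X x u w : proper_on A f -> X \subset A -> core f X ->
  x \in X -> u \in X -> w \in X -> edge x u -> edge x w -> f u = f w.
Proof.
move=> pf /subsetP XA [[a [b H]] _] xX uX wX xu xw.
have := pf _ _ (XA _ xX) (XA _ uX) xu; have := pf _ _ (XA _ xX) (XA _ wX) xw.
by case: (H _ xX) => ->; case: (H _ uX) => ->; case: (H _ wX) => ->.
Qed.

Lemma core_pair f A X x : proper_on A f -> X \subset A -> core f X -> x \in X ->
  exists u w, [/\ u \in X, w \in X, u <> w, edge x u & edge x w /\ f u = f w].
Proof.
move=> pf XA cX xX; case: (cX) => _ /(_ x xX) [u [w [uX wX uw xu xw]]].
exists u, w; split=> //; split=> //; exact: (core_same pf XA cX xX).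
Qed.

(** The gluing principle behind the reductions. No core of [A] may meet [S], so every core lies in
    [B], where it is empty. A boundary vertex either saw two colours in [B] already, having two
    neighbours there and no exemption, or must be shown to see them now. *)
Lemma extend f Z Z' A B S : B = A :\: S -> S \subset A ->
  good L Z B f ->
  (forall v, v \in S -> f v \in L v) ->
  (forall v u, v \in S -> u \in A -> edge v u -> f v <> f u) ->
  (forall v, v \in S -> v \notin Z' -> 1 < #|nb A v| -> nonconst f A v) ->
  (forall o, o \in B -> o \notin Z' -> 1 < #|nb A o| ->
     (1 < #|nb B o| /\ o \notin Z) \/ nonconst f A o) ->
  (forall X v, proper_on A f -> X \subset A -> core f X -> v \in S -> v \notin X) ->
  good L Z' A f.
Proof.
move=> defB SA [G1 G2 G3 G4] H1 H2 H3 H4 H5.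
have BA : B \subset A by rewrite defB subsetDl.
have AP v : v \in A -> v \in S \/ v \in B.
  by rewrite defB inE => ->; case: (v \in S); auto.
have pf : proper_on A f.
  move=> u v uA vA uv; case: (AP u uA) => [uS|uB]; first exact: H2.
  case: (AP v vA) => [vS|vB]; last exact: G2.
  by move/esym; apply: H2 => //; rewrite edgeC.
split=> //.
- by move=> v /AP[/H1|/G1].
- move=> v /AP[vS|vB] vZ gt1; first exact: H3.
  case: (H4 v vB vZ gt1) => [[g1 vz]|//].
  by apply: nonconstS BA _; apply: G3.
- move=> X XA cX; apply: G4 => //; apply/subsetP=> x xX.
  case: (AP x (subsetP XA _ xX)) => // xS.
  by move: (H5 X x pf XA cX xS); rewrite xX.
Qed.

Lemma rainbow_notin f A X v : proper_on A f -> X \subset A -> core f X ->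
  (forall u w, u \in X -> w \in X -> edge v u -> edge v w -> u <> w -> f u <> f w) ->
  v \notin X.
Proof.
move=> pf XA cX H; apply/negP => vX.
case: (core_pair pf XA cX vX) => u [w [uX wX uw vu [vw fuw]]].
exact: H fuw.
Qed.

(** The vertices [a] and [b] need not be neighbours of [v]: when only one candidate neighbour is
    left, any vertex of another colour serves as a dummy. *)
Lemma deg2_notin f A X v a b : proper_on A f -> X \subset A -> core f X ->
  (forall u, u \in X -> edge v u -> u = a \/ u = b) -> f a <> f b ->
  v \notin X.
Proof.
move=> pf XA cX H ab; apply: (rainbow_notin pf XA cX) => u w uX wX vu vw.
by case: (H u uX vu) => ->; case: (H w wX vw) => -> //; move=> _ /esym.
Qed.
End Basics.

(** * Greedy colouring with three constraints per vertex *)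

Section Greedy.
Variables (G : sgraph) (C : choiceType) (L : G -> {fset C}).
Hypothesis L4 : forall v, #|` L v| = 4.
Implicit Types (g f : G -> C).

Lemma list_fresh v (s : seq C) : size s <= 3 -> exists2 x, x \in L v & x \notin s.
Proof. by move=> le3; apply: fset_fresh; rewrite L4 ltnS. Qed.

(** Constraints only look backwards: no [t j] with [i <= j] occurs in [K i], so later choices cannot
    spoil earlier ones. Three is what lists of size four allow. *)
Lemma greedy n (t : nat -> G) (K : nat -> seq G) g :
  (forall i j, i < j -> j < n -> t i <> t j) ->
  (forall i, i < n -> size (K i) <= 3) ->
  (forall i j, i <= j -> j < n -> t j \notin K i) ->
  exists f, (forall u, (forall i, i < n -> u <> t i) -> f u = g u) /\
    forall i, i < n -> f (t i) \in L (t i) /\ forall u, u \in K i -> f (t i) <> f u.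
Proof.
elim: n => [|n IH] inj K3 ord; first by exists g.
have [||| f [fg fK]] := IH; first by move=> i j ij jn; apply: inj => //; apply: ltnW.
- by move=> i lt; apply: K3; apply: ltnW.
- by move=> i j ij jn; apply: ord => //; apply: ltnW.
have [|x xL xK] := @list_fresh (t n) (map f (K n)); first by rewrite size_map K3.
pose f' u := if u == t n then x else f u.
have ft i : i < n -> f' (t i) = f (t i).
  by move=> lt; rewrite /f'; case: eqP => // /(inj i n lt (ltnSn n)).
have fK' i u : i <= n -> u \in K i -> f' u = f u.
  by move=> le uK; rewrite /f'; case: eqP => // E; move: (ord i n le (ltnSn n)); rewrite -E uK.
exists f'; split.
  move=> u H; rewrite /f'; case: eqP => [E|_]; first by case: (H n (ltnSn n)).
  by apply: fg => i lt; apply: H; apply: ltnW.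
move=> i; rewrite ltnS leq_eqVlt => /predU1P[->|lt].
  split=> [|u uK]; first by rewrite /f' eqxx.
  rewrite (fK' n u) // /f' eqxx => E; move: xK; rewrite E.
  by move/negP; apply; apply: map_f.
rewrite ft //; split=> [|u uK]; first by case: (fK i lt).
by rewrite (fK' i u) //; [case: (fK i lt) => _; apply | apply: ltnW].
Qed.

(** A variant for explicit lists: the side condition is a boolean that simplifies to inequalities
    between vertices, and [greedy_spec] unfolds to the wanted conjunction. *)
Fixpoint greedy_ok (s : seq (G * seq G)) : bool :=
  if s is (v, K) :: s' then
    [&& size K <= 3, v \notin map fst s', all (fun u => u \notin v :: map fst s') K
      & greedy_ok s']
  else true.

Fixpoint greedy_spec (f : G -> C) (s : seq (G * seq G)) : Prop :=
  if s is (v, K) :: s' then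
    (f v \in L v /\ foldr (fun u P => f v <> f u /\ P) True K) /\ greedy_spec f s'
  else True.

Lemma greedy_seq g s : greedy_ok s ->
  exists f, (forall u, u \notin map fst s -> f u = g u) /\ greedy_spec f s.
Proof.
elim: s g => [|[v K] s IH] g /=; first by exists g.
case/and4P=> K3 vs /allP Kok /IH {}IH.
have [|x xL xK] := @list_fresh v (map g K); first by rewrite size_map.
have [f [fg fs]] := IH (fun u => if u == v then x else g u).
exists f; split.
  by move=> u; rewrite inE negb_or => /andP[uv us]; rewrite fg // (negbTE uv).
have fv : f v = x by rewrite fg // eqxx.
split=> //; rewrite fv; split=> // {fs}; elim: K {K3} Kok xK => [//|u K IHK] Kok /=.
rewrite inE negb_or => /andP[xu xK]; split; last first.
  by apply: IHK xK => w wK; apply: Kok; rewrite inE wK orbT.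
have := Kok u (mem_head _ _); rewrite inE negb_or => /andP[uv us].
by rewrite fg // (negbTE uv); apply/eqP.
Qed.
End Greedy.

(** * Recognising components and linear forests *)

Lemma isomorphic_component (G H : sgraph) (psi : H -> G) (i0 : H) :
  injective psi -> (forall i j, edge (psi i) (psi j) = edge i j) ->
  (forall i u, edge (psi i) u -> exists j, u = psi j) ->
  (forall j, connect (@edge G) (psi i0) (psi j)) ->
  isomorphic (component (psi i0)) H.
Proof.
move=> inj_psi psiE psi_closed psi_conn.
have mem_psi (y : component (psi i0)) : val y \in codom psi.
  case: y => y /=; rewrite inE => /connectP[p]; move: {psi_conn}(i0).
  elim: p => [|z p IH] i /=; first by move=> _ ->; apply: codom_f.
  by case/andP=> /psi_closed[j ->]; apply: IH.
pose phi y := iinv (mem_psi y).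
have phiK y : psi (phi y) = val y by apply: f_iinv.
have in_comp j : psi j \in [set y : G | connect (@edge G) (psi i0) y].
  by rewrite inE psi_conn.
exists phi; split; last by move=> u v; rewrite -psiE !phiK.
exists (fun j => Sub (psi j) (in_comp j) : component (psi i0)) => [y|j].
  by apply: val_inj; rewrite SubK phiK.
by apply: inj_psi; rewrite phiK SubK.
Qed.

Section LinearForest.
Variable H : sgraph.
Hypothesis deg_le2 : forall v : H, #|neighbors v| <= 2.
Hypothesis acyclic : forall X : {set H}, (forall x, x \in X ->
  exists u w, [/\ u \in X, w \in X, u <> w, edge x u & edge x w]) -> X = set0.

Let ispath (x : H) (n : nat) := exists s : seq H,
  [/\ size s = n, x \in s, uniq s & forall i, i.+1 < n -> edge (nth x s i) (nth x s i.+1)].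

Lemma longest_path (x : H) : exists n, ispath x n /\ ~ ispath x n.+1.
Proof.
(* A maximal length is found by minimising its defect [m] from [#|H|]. *)
have [|m [[le_m Pm] max_m]] := @min_nat (fun m => m <= #|H| /\ ispath x (#|H| - m)).
  exists (#|H| - 1); split; first exact: leq_subr.
  rewrite subKn; last by apply/card_gt0P; exists x.
  by exists [:: x]; split=> //; rewrite mem_head.
exists (#|H| - m); split=> // Pm1.
have m_gt0 : 0 < m.
  case: m le_m Pm max_m Pm1 => // _ _ _ [s [ss _ us _]].
  by have := max_card [in s]; rewrite (card_uniqP us) ss subn0 ltnn.
have: m <= m.-1.
  apply: max_m; split; first by lia.
  by have -> : #|H| - m.-1 = (#|H| - m).+1 by lia.
by case: m m_gt0 {le_m Pm max_m Pm1} => //= m _; rewrite ltnn.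
Qed.

(** The component of [x] is a longest path through [x]: a neighbour outside would lengthen it at an
    end or give an inner vertex degree three, and a chord would close a cycle. *)
Lemma linear_forest_of_acyclic : linear_forest H.
Proof.
move=> x; have [n [[s [sz xs us edges]] long]] := longest_path x.
pose q i := nth x s i.
have q_inj i j : i < n -> j < n -> q i = q j -> i = j.
  by move=> lti ltj /eqP; rewrite (nth_uniq x _ _ us) ?sz // => /eqP.
have q_closed i u : i < n -> edge (q i) u -> u \in s.
  move=> lti qu; apply/negPn/negP => us'.
  case: i lti qu => [|i] lti qu.
    apply: long; exists (u :: s); split; rewrite /= ?sz ?us' ?inE ?xs ?orbT //.
    move=> [|i] /= lt; last exact: edges.
    by rewrite edgeC.
  case: (ltnP i.+2 n) => lt2.
    have qe1 := edges i lti; have qe2 := edges i.+1 lt2.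
    case: (@nb_le2 _ [set: H] (q i.+1) (q i) (q i.+2) u); rewrite ?inE //.
    - by apply: leq_trans (card_nbT _ _) (deg_le2 _).
    - by rewrite edgeC.
    - by move/q_inj; lia.
    - by move=> E; move: us'; rewrite E mem_nth // sz ltnW.
    - by move=> E; move: us'; rewrite E mem_nth // sz.
  apply: long; exists (rcons s u); split; rewrite ?size_rcons ?sz ?rcons_uniq ?us' ?mem_rcons ?inE ?xs ?orbT //.
  move=> j ltj; rewrite !nth_rcons sz.
  have -> : j < n by lia.
  case: ltnP => [|lej]; first exact: edges.
  have -> : j.+1 == n by apply/eqP; lia.
  by have -> : j = i.+1 by lia.
have qE i j : i < n -> j < n -> edge (q i) (q j) = (i.+1 == j) || (j.+1 == i).
  wlog lt_ij : i j / i < j => [hw lti ltj|lti ltj].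
    case: (ltngtP i j) => [lt|lt|->]; first exact: hw.
    - by rewrite edgeC orbC; apply: hw.
    - by rewrite edge_irrefl; apply/esym/negP; lia.
  case: (eqVneq i.+1 j) => [E|ne].
    by rewrite -E /=; apply: edges; rewrite E.
  have -> : j.+1 == i = false by apply/negP; lia.
  apply/negP => qij /=.
  (* The stretch from [q i] to [q j] together with the chord has minimum degree two. *)
  suff: [set y | has (fun m => y == q m) (iota i (j - i).+1)] = set0.
    by move/setP/(_ (q i)); rewrite !inE /= eqxx.
  apply: acyclic => y; rewrite inE => /hasP[m]; rewrite mem_iota => m_in /eqP->.
  have inX m' : i <= m' <= j -> q m' \in [set y | has (fun m => y == q m) (iota i (j - i).+1)].
    by move=> H'; rewrite inE; apply/hasP; exists m' => //; rewrite mem_iota; lia.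
  case: (eqVneq m i) => [->|mi].
    exists (q i.+1), (q j); split=> //; [by apply: inX; lia|by apply: inX; lia| |by apply: edges; lia].
    by move/q_inj; lia.
  case: (eqVneq m j) => [->|mj].
    exists (q i), (q j.-1); split; [by apply: inX; lia|by apply: inX; lia| | |].
    - by move/q_inj; lia.
    - by rewrite edgeC.
    - by rewrite edgeC; case: j lt_ij ltj {ne qij m_in inX} => // j _ ltj; apply: edges.
  exists (q m.-1), (q m.+1); split; [by apply: inX; lia|by apply: inX; lia| | |].
  - by move/q_inj; lia.
  - by rewrite edgeC; case: m m_in mi mj => [|m] m_in mi mj; [lia | apply: edges; lia].
  - by apply: edges; lia.
have idx_x : index x s < n by rewrite -sz index_mem.
exists n; pose psi (i : path_graph n) := q (nat_of_ord (i : 'I_n)).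
have <- : psi (Ordinal idx_x) = x by rewrite /psi /q nth_index.
apply: isomorphic_component.
- by move=> i j /q_inj E; apply: val_inj; apply: E.
- by move=> i j; rewrite /psi qE.
- move=> i u /q_closed us'; have {}us' := us' (ltn_ord i).
  have idx : index u s < n by rewrite -sz index_mem.
  by exists (Ordinal idx); rewrite /psi /q nth_index.
- suff conn i j : i < n -> j < n -> connect (@edge H) (q i) (q j) by move=> j; apply: conn.
  have up i' m : i' + m < n -> connect (@edge H) (q i') (q (i' + m)).
    elim: m => [|m IH] lt; first by rewrite addn0.
    rewrite addnS in lt *; apply: connect_trans (IH _) _; first exact: ltnW.
    by apply: connect1; apply: edges.
  have dn i' m : i' + m < n -> connect (@edge H) (q (i' + m)) (q i').
    elim: m => [|m IH] lt; first by rewrite addn0.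
    rewrite addnS in lt *; apply: connect_trans (IH _); last exact: ltnW.
    by apply: connect1; rewrite edgeC; apply: edges.
  move=> lti ltj; case: (leqP i j) => [le|lt].
    by rewrite -(subnKC le); apply: up; rewrite subnKC.
  by rewrite -(subnKC (ltnW lt)); apply: dn; rewrite subnKC // ltnW.
Qed.
End LinearForest.

(* Cycles are [k]-periodic sequences of vertices, injective on every window of length [k]. *)
Definition periodic (T : Type) (k : nat) (c : nat -> T) : Prop :=
  (forall i, c (i + k) = c i) /\ (forall i j, i < j -> j < i + k -> c i <> c j).

Definition iscyc (G : sgraph) (A : {set G}) (k : nat) (c : nat -> G) : Prop :=
  [/\ 3 <= k, forall i, c i \in A, periodic k c & forall i, edge (c i) (c i.+1)].

(** A component of the subgraph induced by [A] that is a 5-cycle. Centring the clause at [i.+1]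
    names both neighbours without a predecessor index. *)
Definition C5in (G : sgraph) (A : {set G}) (d : nat -> G) : Prop :=
  [/\ forall i, d i \in A, periodic 5 d &
      forall i u, u \in A -> edge (d i.+1) u = (u == d i) || (u == d i.+2)].

Definition bad (G : sgraph) (C : choiceType) (L : G -> {fset C}) (A : {set G})
    (d : nat -> G) : Prop :=
  C5in A d /\ forall i, L (d i) = L (d 0).

Definition K33_free (G : sgraph) : Prop :=
  forall a b : 'I_3 -> G, injective a -> injective b ->
    (forall i j, edge (a i) (b j)) -> False.

(** * Arithmetic of periodic sequences and cycles *)

Section Periodic.
Variables (T : Type) (k : nat) (c : nat -> T).
Hypothesis per : periodic k c.

Lemma periodM i m : c (i + m * k) = c i.
Proof.
elim: m => [|m IH]; first by rewrite mul0n addn0.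
by rewrite mulSnr addnA per.1.
Qed.

Lemma period_mod i : c (i %% k) = c i.
Proof. by rewrite {2}(divn_eq i k) addnC periodM. Qed.

Lemma periodic_inj i j : 0 < k -> c i = c j -> i = j %[mod k].
Proof.
move=> k_gt0; rewrite -(period_mod i) -(period_mod j) => E.
have := ltn_pmod i k_gt0; have := ltn_pmod j k_gt0; move: E.
move: (i %% k) (j %% k) => a b E ltb lta.
case: (ltngtP a b) => // lt; first by case: (per.2 a b lt); [lia|].
by case: (per.2 b a lt); [lia|].
Qed.

Lemma periodic_shift m : periodic k (fun i => c (m + i)).
Proof.
split=> [i|i j lt1 lt2]; first by rewrite addnA per.1.
by apply: per.2; lia.
Qed.

(** Modulo [k], multiplication by [k.-1] is negation; this expresses reversal with natural
    indices. *)
Lemma periodic_rev : 0 < k -> periodic k (fun i => c (k.-1 * i)).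
Proof.
move=> k_gt0; split=> [i|i j lt1 lt2].
  by rewrite mulnDr periodM.
have [m Ej] : exists m, j = i + m by exists (j - i); lia.
by rewrite Ej in lt1 lt2 *; rewrite -(periodM (k.-1 * i) m) => /esym; apply: per.2; nia.
Qed.
End Periodic.

Section Cycles.
Variable G : sgraph.
Implicit Types (A B : {set G}) (c d q : nat -> G).

Lemma iscyc_shift A k c m : iscyc A k c -> iscyc A k (fun i => c (m + i)).
Proof.
case=> k3 cA per ce; split=> //; first exact: periodic_shift.
by move=> i; rewrite addnS.
Qed.

Lemma iscyc_rev A k c : iscyc A k c -> iscyc A k (fun i => c (k.-1 * i)).
Proof.
case=> k3 cA per ce; split=> //; first by apply: periodic_rev => //; lia.
move=> i; rewrite edgeC -[c (k.-1 * i)]per.1.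
by have -> : k.-1 * i + k = (k.-1 * i.+1).+1 by nia.
Qed.

Lemma iscyc_prev A k c i : iscyc A k c -> c (i.+1 + k.-1) = c i.
Proof. by case=> k3 _ [per _] _; have -> : i.+1 + k.-1 = i + k by lia. Qed.

Lemma mkcyc A n q : 3 <= n -> (forall i, i < n -> q i \in A) ->
  (forall i j, i < j -> j < n -> q i <> q j) ->
  (forall i, i.+1 < n -> edge (q i) (q i.+1)) -> edge (q n.-1) (q 0) ->
  iscyc A n (fun i => q (i %% n)).
Proof.
move=> n3 qA qinj qe qe0; split=> //.
- by move=> i; apply: qA; rewrite ltn_pmod //; lia.
- split=> [i|i j lt1 lt2]; first by rewrite modnDr.
  have : i %% n <> j %% n.
    move=> E; have := divn_eq i n; have := divn_eq j n.
    have [le|lt] := leqP (j %/ n) (i %/ n); first by have := leq_mul2r n (j %/ n) (i %/ n); rewrite le orbT; lia.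
    have := leq_mul2r n (i %/ n).+1 (j %/ n); rewrite lt orbT mulSn; lia.
  have n_gt0 : 0 < n by lia.
  have := ltn_pmod i n_gt0; have := ltn_pmod j n_gt0.
  case: (ltngtP (i %% n) (j %% n)) => // lt; first by move=> *; apply: qinj; lia.
  by move=> ? ? _ /esym; apply: qinj; lia.
- move=> i; have lti : i %% n < n by rewrite ltn_pmod //; lia.
  have -> : i.+1 %% n = (i %% n).+1 %% n by rewrite -addn1 -modnDml addn1.
  case: (ltnP (i %% n).+1 n) => [lt|ge]; first by rewrite [_.+1 %% n]modn_small //; apply: qe.
  have -> : (i %% n) = n.-1 by lia.
  by rewrite prednK ?modnn //; lia.
Qed.

Lemma C5in_cyc A d : C5in A d -> iscyc A 5 d.
Proof.
case=> dA per dE; split=> // -[|i]; last by rewrite dE // eqxx orbT.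
by rewrite -[d 0]per.1 -[d 1]per.1 dE // eqxx orbT.
Qed.

Lemma C5in_shift A d m : C5in A d -> C5in A (fun i => d (m + i)).
Proof.
case=> dA per dE; split=> //; first exact: periodic_shift.
by move=> i u uA; rewrite !addnS dE.
Qed.
End Cycles.

(** * Between the graph hypotheses and the induction statement *)

Section Translation.
Variables (G : sgraph) (hG : subcubic G).

Lemma C5_component (d : nat -> G) : C5in setT d -> has_component G C5.
Proof.
move=> dC; case: (dC) => _ per dE.
pose psi (i : C5) := d (nat_of_ord (i : 'I_5)).
have nE i u : edge (d i.+1) u = (u == d i) || (u == d i.+2) by apply: dE; rewrite inE.
have dM i j : (d i == d j) = (i == j %[mod 5]).
  apply/eqP/eqP => [|E]; first exact: periodic_inj.
  by rewrite -(period_mod per i) -(period_mod per j) E.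
exists (psi ord0); apply: isomorphic_component.
- move=> i j /eqP; rewrite dM !modn_small ?ltn_ord // => /eqP E; exact: val_inj.
- case=> i Hi [j Hj]; rewrite /psi /= /C5_edge /= -[d i]per.1 addnS nE !dM.
  by apply/idP/idP; lia.
- case=> i Hi u; rewrite /psi /= -[d i]per.1 addnS nE.
  have lt5 m : m %% 5 < 5 by rewrite ltn_pmod.
  by case/orP=> /eqP->; rewrite -(period_mod per); [exists (Ordinal (lt5 (i + 4)))
    | exists (Ordinal (lt5 (i + 4).+2))].
- case=> j Hj; rewrite /psi /= => {Hj}; elim: j => [|j IH]; first exact: connect0.
  by apply: connect_trans IH _; apply: connect1; case: (C5in_cyc dC).
Qed.

(** At degree at most three, the edges to the other side exhaust each vertex, so a copy of K_{3,3}
    as a subgraph is induced and closed, hence a component. *)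
Lemma K33_component : ~ has_component G K33 -> K33_free G.
Proof.
move=> noK a b a_inj b_inj ab; apply: noK.
pose psi (x : K33) : G := match (x : 'I_3 + 'I_3) with inl i => a i | inr j => b j end.
have closed (x y : 'I_3 -> G) : injective y -> (forall i j, edge (x i) (y j)) ->
  forall i u, edge (x i) u -> exists j, u = y j.
  move=> y_inj xy i u xu.
  pose i0 : 'I_3 := inord 0; pose i1 : 'I_3 := inord 1; pose i2 : 'I_3 := inord 2.
  case: (@nb_le3 _ setT (x i) (y i0) (y i1) (y i2) u); rewrite ?inE //.
  - by apply: leq_trans (card_nbT _ _) (hG _).
  - by move/y_inj/(congr1 (@nat_of_ord 3)); rewrite !inordK.
  - by move/y_inj/(congr1 (@nat_of_ord 3)); rewrite !inordK.
  - by move/y_inj/(congr1 (@nat_of_ord 3)); rewrite !inordK.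
  - by exists i0.
  - by exists i1.
  - by exists i2.
have ba i j : edge (b i) (a j) by rewrite edgeC.
have ab_neq i j : a i <> b j by apply: edge_neq.
have noaa i j : edge (a i) (a j) = false.
  by apply/negP => /(closed a b b_inj ab)[m /ab_neq].
have nobb i j : edge (b i) (b j) = false.
  by apply/negP => /(closed b a a_inj ba)[m /esym /ab_neq].
exists (psi (inl ord0)); apply: isomorphic_component.
- case=> i [] j; rewrite /psi /=; [by move/a_inj-> | by move/ab_neq | by move/esym/ab_neq | by move/b_inj->].
- by case=> i [] j; rewrite /psi /= ?noaa ?nobb ?ab ?ba.
- case=> i u; rewrite /psi /= => /closed H; first by case: (H _ b_inj ab) => j ->; exists (inr j).
  by case: (H _ a_inj ba) => j ->; exists (inl j).
- case=> j; rewrite /psi /=; last exact: connect1.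
  by apply: (@connect_trans _ _ (b ord0)); apply: connect1.
Qed.

(** Three neighbours in a two-coloured subgraph would share a colour and be all the neighbours,
    against [nonconst]; a cycle in such a subgraph is a core. *)
Lemma superlinear_of_good (C : choiceType) (L : G -> {fset C}) f :
  good L set0 setT f -> superlinear_coloring L f.
Proof.
case=> fL fP fN fX.
have mT (v : G) : v \in [set: G] by rewrite inE.
have nbT v : nb setT v = neighbors v by apply/setP=> u; rewrite in_nb !inE.
split; last first.
  move=> v dv u w vu vw uw E.
  have n0 x : x \notin (set0 : {set G}) by rewrite inE.
  have gt1 : 1 < #|nb setT v| by rewrite nbT [#|_|]dv.
  have [x [y [_ _ vx vy]]] := fN v (mT v) (n0 v) gt1.
  have two z : edge v z -> z = u \/ z = w.
    by move=> vz; apply: (@nb_le2 _ setT v); rewrite ?inE // nbT [#|_|]dv.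
  by case: (two x vx) => ->; case: (two y vy) => ->; rewrite ?E.
split; first by split=> [v|u v]; [apply: fL | apply: fP].
move=> a b ab; set S := [set v | _].
have inS v : v \in S -> f v = a \/ f v = b by rewrite inE => /orP[]/eqP; auto.
have same v u w : v \in S -> u \in S -> w \in S -> edge v u -> edge v w -> f u = f w.
  move=> /inS vS /inS uS /inS wS vu vw; have := fP _ _ (mT v) (mT u) vu; have := fP _ _ (mT v) (mT w) vw.
  by case: vS => ->; case: uS => ->; case: wS => ->.
apply: linear_forest_of_acyclic.
- move=> v; rewrite leqNgt; apply/negP => /card_gt2P[x [y [z [[xv yv zv] [xy yz zx]]]]].
  move: xv yv zv; rewrite !inE /= /induced_edge => xv yv zv.
  have dv := hG (val v).
  have n0 : val v \notin (set0 : {set G}) by rewrite inE.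
  have [|u [w [_ _ vu vw]]] := fN (val v) (mT _) n0.
    by apply: (@two_nb _ _ _ (val x) (val y)); rewrite ?inE // => /val_inj E; rewrite E eqxx in xy.
  have three t : edge (val v) t -> f t = f (val x).
    move=> vt; case: (@nb_le3 _ setT (val v) (val x) (val y) (val z) t); rewrite ?inE ?nbT //.
    - by move/val_inj => E; rewrite E eqxx in xy.
    - by move/val_inj => E; rewrite E eqxx in zx.
    - by move/val_inj => E; rewrite E eqxx in yz.
    - by move->.
    - by move->; apply: (same (val v)) => //; apply: valP.
    - by move->; apply: (same (val v)) => //; apply: valP.
  by rewrite (three u vu) (three w vw).
- move=> X HX; apply/eqP; rewrite -(imset_eq0 val); apply/eqP; apply: fX; first exact: subsetT.
  split.
    by exists a, b => x /imsetP[y _ ->]; apply: inS; apply: valP.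
  move=> x /imsetP[y /HX[u [w [uX wX uw yu yw]]] ->].
  by exists (val u), (val w); split=> //; [apply: imset_f|apply: imset_f|move/val_inj].
Qed.
End Translation.

(** * 5-cycle components *)

Definition cset (G : sgraph) (k : nat) (c : nat -> G) : {set G} :=
  [set v | [exists i : 'I_k, v == c i]].

(** Quantifying over [Z] inside the induction statement lets each reduction choose which vertex pays
    for a bad cycle. *)
Definition colorable (G : sgraph) (C : choiceType) (L : G -> {fset C}) (A : {set G}) :=
  forall Z : {set G}, (forall d, bad L A d -> exists i, d i \in Z) ->
    exists f, good L Z A f.

Lemma csetP (G : sgraph) (k : nat) (c : nat -> G) v :
  reflect (exists2 i, i < k & v = c i) (v \in cset k c).
Proof.
rewrite inE; apply: (iffP existsP) => [[i /eqP->]|[i lt ->]]; first by exists i.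
by exists (Ordinal lt).
Qed.

Lemma mem_cset (G : sgraph) (k : nat) (c : nat -> G) i :
  0 < k -> periodic k c -> c i \in cset k c.
Proof.
by move=> k0 per; apply/csetP; exists (i %% k); rewrite ?ltn_pmod // period_mod.
Qed.

Section C5.
Variables (G : sgraph) (A : {set G}) (d : nat -> G).
Hypothesis dC : C5in A d.

Lemma C5in_nb i u : u \in A -> edge (d i.+1) u -> u = d i \/ u = d i.+2.
Proof. by case: dC => _ _ dE uA; rewrite dE // => /orP[]/eqP; auto. Qed.

Lemma C5in_nb' i u : u \in A -> edge (d i) u -> u = d (i + 4) \/ u = d i.+1.
Proof.
case: (dC) => _ [per _] _ uA; rewrite -[d i]per (addnS i 4) => /(C5in_nb uA).
have -> : (i + 4).+2 = i.+1 + 5 by lia.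
by rewrite per.
Qed.

Lemma C5in_neq i j : i < j -> j < i + 5 -> d i <> d j.
Proof. by case: dC => _ [_ H] _; apply: H. Qed.

Lemma C5in_edge i : edge (d i) (d i.+1).
Proof. by case: (C5in_cyc dC). Qed.

Lemma C5in_card i : #|nb A (d i)| = 2.
Proof.
case: (dC) => dA [per _] _.
apply: (@nb_card2 _ _ _ (d (i + 4)) (d i.+1)) => //.
- by rewrite edgeC -[d i]per (addnS i 4) C5in_edge.
- exact: C5in_edge.
- by move/esym; apply: C5in_neq; lia.
- by move=> x xA /(C5in_nb' xA).
Qed.

Lemma C5in_closed i u : u \in A -> edge (d i) u -> exists j, u = d j.
Proof. by move=> uA /(C5in_nb' uA)[]->; eexists. Qed.

Lemma cset5P v : v \in cset 5 d -> v = d 0 \/ v = d 1 \/ v = d 2 \/ v = d 3 \/ v = d 4.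
Proof.
case/csetP=> i; do 5?[case: i => [|i]] => //= _ ->; tauto.
Qed.
End C5.

(** Without an edge to [S], a bad component of the remainder would be a bad component of [A]. So a
    deletion creates bad cycles only next to the deleted set. *)
Lemma C5_attached (G : sgraph) (C : choiceType) (L : G -> {fset C}) (A S : {set G}) d :
  (forall d, ~ bad L A d) -> bad L (A :\: S) d ->
  exists i s, [/\ s \in S, s \in A & edge (d i) s].
Proof.
move=> noB [dC dL]; apply: NNPP => H; apply: (noB d); split=> //.
case: (dC) => dB per dE; split=> // [i|i u uA].
  by move: (dB i); rewrite inE => /andP[].
case: (boolP (u \in S)) => uS; last by apply: dE; rewrite inE uS.
have -> : edge (d i.+1) u = false by apply/negP => du; apply: H; exists i.+1, u.
apply/esym/negP => /orP[]/eqP E; move: uS; rewrite E.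
  by move: (dB i); rewrite inE => /andP[/negbTE->].
by move: (dB i.+2); rewrite inE => /andP[/negbTE->].
Qed.

Lemma nb_off (G : sgraph) (A S : {set G}) o :
  (forall s, s \in S -> s \in A -> ~ edge o s) -> nb A o = nb (A :\: S) o.
Proof.
move=> H; apply/setP=> u; rewrite !in_nb inE; case: (boolP (u \in S)) => //= uS.
by case: (boolP (u \in A)) => //= uA; apply/negP/H.
Qed.

Section C5Special.
Variables (G : sgraph) (C : choiceType) (L : G -> {fset C}).

(** Around the cycle the colours are a, m, b, e, m; only [d 0] sees one colour twice, and it is
    exempted. The exact pattern stays in the conclusion because the Petersen graph needs it. *)
Lemma C5_special (Z A : {set G}) d f a m b e : bad L A d ->
  good L Z (A :\: cset 5 d) f -> uniq [:: a; m; b; e] ->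
  {subset [:: a; m; b; e] <= L (d 0)} ->
  exists f', [/\ forall u, u \notin cset 5 d -> f' u = f u,
    (f' (d 0) = a /\ f' (d 1) = m), (f' (d 2) = b /\ f' (d 3) = e), f' (d 4) = m
    & good L (d 0 |: Z) A f'].
Proof.
move=> [dC dL] gf; rewrite /= !inE !negb_or andbT.
case/and3P=> /and3P[am ab ae] /andP[mb me] be sL.
case: (dC) => dA per dE.
pose f' u := if u == d 0 then a else if (u == d 1) || (u == d 4) then m
  else if u == d 2 then b else if u == d 3 then e else f u.
have neq i j : i < j -> j < i + 5 -> (d j == d i) = false.
  by move=> lt1 lt2; apply/eqP => /esym; apply: (C5in_neq dC).
have f0 : f' (d 0) = a by rewrite /f' eqxx.
have f1 : f' (d 1) = m by rewrite /f' (neq 0 1) // eqxx.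
have f2 : f' (d 2) = b by rewrite /f' (neq 0 2) // (neq 1 2) // eq_sym (neq 2 4) // eqxx.
have f3 : f' (d 3) = e.
  by rewrite /f' (neq 0 3) // (neq 1 3) // (neq 2 3) // eq_sym (neq 3 4) // eqxx.
have f4 : f' (d 4) = m by rewrite /f' (neq 0 4) // eqxx orbT.
have fo u : u \notin cset 5 d -> f' u = f u.
  move=> uS; have un i : (u == d i) = false.
    by apply/negP => /eqP E; move: uS; rewrite E mem_cset.
  by rewrite /f' !un.
exists f'; split=> //.
have per5 : d 5 = d 0 by rewrite (per.1 0).
have n0 u : u \in A -> edge (d 0) u -> u = d 4 \/ u = d 1 by apply: (C5in_nb' dC (i := 0)).
have n1 u : u \in A -> edge (d 1) u -> u = d 0 \/ u = d 2 by apply: (C5in_nb dC (i := 0)).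
have n2 u : u \in A -> edge (d 2) u -> u = d 1 \/ u = d 3 by apply: (C5in_nb dC (i := 1)).
have n3 u : u \in A -> edge (d 3) u -> u = d 2 \/ u = d 4 by apply: (C5in_nb dC (i := 2)).
have n4 u : u \in A -> edge (d 4) u -> u = d 3 \/ u = d 0.
  by move=> uA /(C5in_nb dC uA (i := 3)); rewrite per5.
have ne i := C5in_edge dC i.
have L0 x : x \in [:: a; m; b; e] -> forall i, x \in L (d i) by move=> xi i; rewrite dL; apply: sL.
have e40 : edge (d 4) (d 0) by rewrite -per5.
apply: (@extend _ _ _ _ Z _ A (A :\: cset 5 d) (cset 5 d)) => //.
- by apply/subsetP=> v /csetP[i _ ->].
- by apply: eq_good gf => u; rewrite inE => /andP[uS _]; rewrite fo.
- by move=> v /cset5P [->|[->|[->|[->|->]]]]; rewrite ?f0 ?f1 ?f2 ?f3 ?f4; apply: L0; rewrite !inE eqxx ?orbT.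
- move=> v u /cset5P [->|[->|[->|[->|->]]]] uA; [move/(n0 u uA)|move/(n1 u uA)|move/(n2 u uA)|move/(n3 u uA)|move/(n4 u uA)];
  by case=> ->; rewrite ?f0 ?f1 ?f2 ?f3 ?f4; apply/eqP; rewrite // eq_sym.
- have nc i x y : x \in A -> y \in A -> edge (d i) x -> edge (d i) y -> f' x != f' y -> nonconst f' A (d i).
    by move=> xA yA dx dy /eqP ?; exists x, y.
  move=> v vS; rewrite in_setU1 negb_or => /andP[v0 _] _; case/cset5P: vS v0 => [->|[->|[->|[->|->]]]] v0; first by rewrite eqxx in v0.
  + by apply: (nc 1 (d 0) (d 2)); rewrite ?f0 ?f2 // edgeC.
  + by apply: (nc 2 (d 1) (d 3)); rewrite ?f1 ?f3 // edgeC.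
  + by apply: (nc 3 (d 2) (d 4)); rewrite ?f2 ?f4 // ?(eq_sym b) // edgeC.
  + by apply: (nc 4 (d 3) (d 0)); rewrite ?f3 ?f0 // ?(eq_sym e) // edgeC.
- move=> o; rewrite in_setU1 negb_or => oB /andP[_ oZ].
  rewrite (@nb_off _ _ (cset 5 d)) //; first by left.
  move=> s /csetP[i _ ->] _ odi; move: (oB); rewrite inE => /andP[/negP oS oA]; apply: oS.
  have [j ->] : exists j, o = d j by apply: (C5in_closed dC (i := i)) => //; rewrite edgeC.
  exact: mem_cset.
- move=> X v pf XA cX vS.
  have inA u : u \in X -> u \in A := subsetP XA u.
  have x1 : d 1 \notin X.
    by apply: (deg2_notin (a := d 0) (b := d 2) pf XA cX) => [u /inA|]; [apply: n1|rewrite f0 f2; apply/eqP].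
  have x2 : d 2 \notin X.
    by apply: (deg2_notin (a := d 1) (b := d 3) pf XA cX) => [u /inA|]; [apply: n2|rewrite f1 f3; apply/eqP].
  have x3 : d 3 \notin X.
    by apply: (deg2_notin (a := d 4) (b := d 2) pf XA cX) => [u /inA uA /n3 H|]; [case: H; auto|rewrite f4 f2; apply/eqP].
  have x4 : d 4 \notin X.
    by apply: (deg2_notin (a := d 0) (b := d 3) pf XA cX) => [u /inA uA /n4 H|]; [case: H; auto|rewrite f0 f3; apply/eqP].
  case/cset5P: vS => [->|[->|[->|[->|->]]]] //; apply/negP => x0.
  case: (core_pair pf XA cX x0) => u [w [uX _ _ /(n0 _ (inA u uX)) uE _]].
  by case: uE uX => ->; rewrite ?(negbTE x4) ?(negbTE x1).
Qed.
End C5Special.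

(** * Deleting a vertex of degree at most one, or two adjacent vertices of degree two *)

Section LowDegree.
Variables (G : sgraph) (C : choiceType) (L : G -> {fset C}) (A : {set G}).
Hypothesis hG : subcubic G.
Hypothesis L4 : forall v, #|` L v| = 4.
Hypothesis IH : forall B : {set G}, B \proper A -> colorable L B.
Hypothesis noB : forall d, ~ bad L A d.

Lemma setD_proper v (S : {set G}) : v \in A -> v \in S -> A :\: S \proper A.
Proof.
move=> vA vS; rewrite properE subsetDl /=; apply/subsetPn; exists v => //.
by rewrite inE vS.
Qed.

Lemma notinD v (S : {set G}) : v \in A -> v \notin A :\: S -> v \in S.
Proof. by move=> vA; rewrite inE vA andbT negbK. Qed.

Lemma deg_le3 (B : {set G}) v : #|nb B v| <= 3.
Proof. exact: leq_trans (card_nbT _ _) (hG v). Qed.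

(** The default [o] is harmless: a new neighbour of [o] has to avoid the colour of [o] anyway. *)
Definition some_nb (B : {set G}) (o : G) : G := odflt o [pick u in nb B o].

Lemma some_nbP (B : {set G}) o u : u \in B -> edge o u -> some_nb B o \in B /\ edge o (some_nb B o).
Proof.
move=> uB ou; rewrite /some_nb; case: pickP => [x|/(_ u)]; last by rewrite in_nb uB ou.
by rewrite in_nb => /andP[].
Qed.

Lemma some_nb_in (B : {set G}) o : o \in B -> some_nb B o \in B.
Proof. by move=> oB; rewrite /some_nb; case: pickP => [x|//]; rewrite in_nb => /andP[]. Qed.

(** New bad cycles must pass through the only neighbour [x] of [v], so [x] is exempted. The colour
    of [v] avoids a further neighbour [y] of [x], which gives [x] its second colour. *)
Lemma color_deg1 v : v \in A -> #|nb A v| <= 1 -> exists f, good L set0 A f.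
Proof.
move=> vA le1; set B := A :\: [set v].
have BA : B \proper A by apply: (setD_proper vA); rewrite inE.
have vB : v \notin B by rewrite !inE eqxx.
pose x := some_nb A v; pose y := some_nb B x.
have [|f gf] := IH BA (Z := [set x]).
  move=> d bd; have [i [s []]] := C5_attached noB bd.
  rewrite inE => /eqP-> _ dv; exists i; rewrite inE; apply/eqP.
  have dA : d i \in A by move: bd => [[/(_ i) + _ _] _]; rewrite inE => /andP[].
  rewrite edgeC in dv; have [xA vx] := some_nbP dA dv.
  exact: (nb_le1 le1 dA xA dv vx).
have [x0|xv] := eqVneq x v.
  have iso u : u \in A -> edge v u -> False.
    by move=> uA vu; have [_] := some_nbP uA vu; rewrite -/x x0 edge_irrefl.
  have [f' [ff' [[fL _] _]]] := greedy_seq L4 f (s := [:: (v, [::])]) isT.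
  exists f'; apply: (@extend _ _ _ _ [set x] _ A B [set v]) => //.
  - by rewrite sub1set.
  - by apply: eq_good gf => u uB; rewrite ff' //= inE; apply: contraNneq vB => <-.
  - by move=> u; rewrite inE => /eqP->.
  - by move=> u w; rewrite inE => /eqP-> wA /(iso w wA).
  - by move=> u; rewrite inE => /eqP-> _; rewrite ltnNge le1.
  - move=> o oB _; rewrite (@nb_off _ _ [set v]); last first.
      move=> s; rewrite inE => /eqP-> _; rewrite edgeC; apply: iso.
      by move: oB; rewrite inE => /andP[].
    by left; split=> //; rewrite x0 inE; apply: contraNneq vB => <-.
  - move=> X u pf XA cX; rewrite inE => /eqP->; apply/negP => vX.
    case: cX => _ /(_ v vX) [w [_ [wX _ _ vw _]]]; apply: (iso w) => //; exact: (subsetP XA).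
have xA : x \in A by apply: some_nb_in.
have vx : edge v x by move: xv; rewrite /x /some_nb; case: pickP => [z|]; rewrite ?eqxx // in_nb => /andP[].
have xB : x \in B by rewrite !inE xv.
have yB : y \in B by apply: some_nb_in.
have only u : u \in A -> edge v u -> u = x by move=> uA vu; apply: (nb_le1 le1).
have [|f' [ff' [[fL [fx [fy _]]] _]]] := greedy_seq L4 f (s := [:: (v, [:: x; y])]).
  by rewrite /= !inE !andbT xv; apply: contraNneq vB => <-.
have ffB : {in B, f =1 f'} by move=> u uB; rewrite ff' //= inE; apply: contraNneq vB => <-.
exists f'; apply: (@extend _ _ _ _ [set x] _ A B [set v]) => //.
- by rewrite sub1set.
- exact: eq_good gf.
- by move=> u; rewrite inE => /eqP->.
- by move=> u w; rewrite inE => /eqP-> wA /(only w wA) ->.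
- by move=> u; rewrite inE => /eqP-> _; rewrite ltnNge le1.
- move=> o oB _ gt1; have oA : o \in A by move: oB; rewrite inE => /andP[].
  have [ox|ox] := eqVneq o x; last first.
    left; rewrite inE ox; split=> //; rewrite -(@nb_off _ A [set v]) // => s.
    by rewrite inE => /eqP-> _; rewrite edgeC => /(only o oA)/eqP; rewrite (negbTE ox).
  right; rewrite ox in gt1 *; have [u [uA xu uv]] := nb_other v gt1.
  have uB : u \in B by rewrite !inE uA andbT; apply/eqP.
  have [_ xy] := some_nbP uB xu.
  exists v, y; split=> //; first by move: yB; rewrite inE => /andP[].
  by rewrite edgeC.
- move=> X u pf XA cX; rewrite inE => /eqP->; apply: (deg2_notin (a := x) (b := v) pf XA cX) => [w wX vw|/esym //].
  by left; apply: only => //; apply: (subsetP XA).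
Qed.

(** Both new vertices avoid [o1] and [o2], so each has neighbours of different colours. The exempted
    [o2] is repaired by making [p2] avoid [w2]; [o1] keeps two neighbours in the remainder or equals
    [o2]. *)
Lemma color_adj2 p1 p2 o1 o2 : [/\ p1 \in A, p2 \in A, o1 \in A & o2 \in A] ->
  edge p1 p2 -> edge p1 o1 -> edge p2 o2 -> o1 <> p2 -> o2 <> p1 ->
  (forall u, u \in A -> edge p1 u -> u = p2 \/ u = o1) ->
  (forall u, u \in A -> edge p2 u -> u = p1 \/ u = o2) ->
  o1 = o2 \/ 2 < #|nb A o1| ->
  (forall d, bad L (A :\: [set p1; p2]) d -> exists i, d i = o2) ->
  exists f, good L set0 A f.
Proof.
move=> [p1A p2A o1A o2A] e12 e1 e2 /eqP o1p2 /eqP o2p1 N1 N2 H1 HD.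
set S := [set p1; p2] in HD; set B := A :\: S in HD.
have BA : B \proper A by apply: (setD_proper p1A); rewrite !inE eqxx.
have sBA u : u \in B -> u \in A by rewrite inE => /andP[].
have p12 : p1 != p2 by apply/eqP/edge_neq.
have o1p1 : o1 != p1 by rewrite eq_sym; apply/eqP/edge_neq.
have o2p2 : o2 != p2 by rewrite eq_sym; apply/eqP/edge_neq.
have o1B : o1 \in B by rewrite !inE negb_or o1p1 o1p2.
have o2B : o2 \in B by rewrite !inE negb_or o2p1 o2p2.
have nB u : u \in B -> (u != p1) && (u != p2) by rewrite !inE negb_or => /andP[].
pose w2 := some_nb B o2.
have w2B : w2 \in B by apply: some_nb_in.
have [|f gf] := IH BA (Z := [set o2]).
  by move=> d /HD[i <-]; exists i; rewrite inE.
have [|f' [ff' /= [[f2L [f21 [f22 [f2w _]]]] [[f1L [f11 [f12 [f1p _]]]] _]]]] :=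
  greedy_seq L4 f (s := [:: (p2, [:: o1; o2; w2]); (p1, [:: o1; o2; p2])]).
  by case/andP: (nB _ w2B) => a1 a2; rewrite /= !inE !negb_or !andbT o1p2 o2p2 o1p1 o2p1 a1 a2 eq_sym p12.
have ffB : {in B, f =1 f'} by move=> u /nB/andP[a1 a2]; rewrite ff' //= !inE negb_or a1 a2.
exists f'; apply: (@extend _ _ _ _ [set o2] _ A B S) => //.
- by apply/subsetP=> u; rewrite !inE => /orP[]/eqP->.
- exact: eq_good gf.
- by move=> v; rewrite !inE => /orP[]/eqP->.
- move=> v u; rewrite !inE => /orP[]/eqP-> uA; first by case/(N1 u uA)=> ->.
  by case/(N2 u uA)=> -> //; move/esym.
- move=> v; rewrite !inE => /orP[]/eqP-> _ _.
  + by exists p2, o1.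
  + by exists p1, o2; split=> //; rewrite edgeC.
- move=> o oB _ gt1; have oA := sBA o oB.
  have [E|oo2] := eqVneq o o2.
    right; rewrite E in gt1 *; case: (classic (exists2 u, u \in B & edge o2 u)) => [[u uB ou]|no].
      have [_ ow] := some_nbP uB ou; exists p2, w2; split=> //; first exact: sBA.
      by rewrite edgeC.
    have [u [uA ou up]] := nb_other p2 gt1.
    have uS : u \in S by apply: notinD uA _; apply/negP => uB; apply: no; exists u.
    have {uS} E1 : u = p1 by move: uS; rewrite !inE => /orP[]/eqP.
    by exists p1, p2; split=> //; rewrite -?E1 // edgeC.
  left; rewrite inE oo2; split=> //.
  have N2' s : s \in S -> edge o s -> s = p1 /\ o = o1.
    rewrite !inE => /orP[]/eqP->; rewrite edgeC => H; last by case: (N2 o oA H) => E; case/andP: (nB _ oB); rewrite ?E ?eqxx //; move: oo2; rewrite E eqxx.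
    by case: (N1 o oA H) => // E; case/andP: (nB _ oB); rewrite E eqxx.
  case: (classic (exists2 s, s \in S & edge o s)) => [[s sS os]|no]; last first.
    by rewrite -(@nb_off _ A S) // => s sS _ os; apply: no; exists s.
  have [_ oo1] := N2' s sS os; case: H1 => [E|]; first by move: oo2; rewrite oo1 E eqxx.
  rewrite -oo1 => gt2; rewrite -ltnS; apply: leq_trans gt2 _; apply: (@nb_rem _ _ _ _ p1) => u uA ou.
  case: (boolP (u \in S)) => uS; last by right; rewrite inE uS.
  by left; case: (N2' u uS ou).
- move=> X v pf XA cX; rewrite !inE => /orP[]/eqP->.
    by apply: (deg2_notin (a := p2) (b := o1) pf XA cX) => // u /(subsetP XA); apply: N1.
  by apply: (deg2_notin (a := p1) (b := o2) pf XA cX) => // u /(subsetP XA); apply: N2.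
Qed.
End LowDegree.

(** * Adjacent vertices of degree two *)

Section AdjacentDegreeTwo.
Variables (G : sgraph) (C : choiceType) (L : G -> {fset C}) (A : {set G}).
Hypothesis hG : subcubic G.
Hypothesis L4 : forall v, #|` L v| = 4.
Hypothesis IH : forall B : {set G}, B \proper A -> colorable L B.
Hypothesis noB : forall d, ~ bad L A d.
Hypothesis mindeg : forall v, v \in A -> 1 < #|nb A v|.

Lemma deg2_other (B : {set G}) v u : #|nb B v| = 2 -> u \in B -> edge v u ->
  exists w, [/\ w \in B, edge v w, w <> u & forall x, x \in B -> edge v x -> x = u \/ x = w].
Proof.
move=> d2 uB vu; have [|w [wB vw wu]] := @nb_other _ B v u; first by rewrite d2.
exists w; split=> // x xB vx; apply: (nb_le2 (A := B)) vw vx _ => //; first by rewrite d2.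
by move/esym.
Qed.

(** A bad cycle missing [o2] is attached through [o1] alone, so its other four vertices have degree
    two in [A]. The pair to delete is then moved onto that cycle, next to [o1]. *)
Lemma color_adj2_step p1 p2 o1 o2 : [/\ p1 \in A, p2 \in A, o1 \in A & o2 \in A] ->
  edge p1 p2 -> edge p1 o1 -> edge p2 o2 -> o1 <> p2 -> o2 <> p1 ->
  (forall u, u \in A -> edge p1 u -> u = p2 \/ u = o1) ->
  (forall u, u \in A -> edge p2 u -> u = p1 \/ u = o2) ->
  o1 = o2 \/ 2 < #|nb A o1| ->
  exists f, good L set0 A f.
Proof.
move=> inA e12 e1 e2 o1p2 o2p1 N1 N2 H1.
case: (classic (forall d, bad L (A :\: [set p1; p2]) d -> exists i, d i = o2)) => [H|nH].
  exact: (color_adj2 L4 IH (p1 := p1) (p2 := p2) (o1 := o1) (o2 := o2)).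
have [d nd] := not_all_ex_not _ _ nH; have [bd no2] := imply_to_and _ _ nd; case: inA => p1A p2A o1A o2A.
set B := A :\: _ in bd.
have dB i : d i \in B by case: bd => [[]].
have dS i : (d i != p1) && (d i != p2) by move: (dB i); rewrite !inE negb_or => /andP[].
have dA i : d i \in A by move: (dB i); rewrite inE => /andP[].
have nS i s : s \in [set p1; p2] -> edge (d i) s -> d i = o1.
  rewrite !inE => /orP[]/eqP->; rewrite edgeC.
    by case/(N1 _ (dA i)) => // E; case/andP: (dS i); rewrite E eqxx.
  case/(N2 _ (dA i)) => E; last by case: no2; exists i.
  by case/andP: (dS i); rewrite E eqxx.
have [i [s [sS _ /(nS i s sS) di]]] := C5_attached noB bd.
case: H1 => [o12|gt2]; first by case: no2; exists i; rewrite di.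
pose c j := d (i + j).
have cC : C5in B c by case: bd => dC _; apply: (C5in_shift i dC).
have c0 : c 0 = o1 by rewrite /c addn0.
have cne j : 0 < j < 5 -> c j <> o1.
  by rewrite -c0 => lt /esym; apply: (C5in_neq cC); lia.
have cN j u : 0 < j < 5 -> u \in A -> edge (c j) u -> u \in B.
  move=> lt uA cu; rewrite inE uA andbT; apply/negP => uS.
  exact: (cne j lt (nS _ _ uS cu)).
have cA j : c j \in A by apply: dA.
have c5 : c 5 = c 0 by case: cC => _ [/(_ 0)].
have e40 : edge (c 4) (c 0) by rewrite -c5; apply: (C5in_edge cC).
have ne i' j' : i' < j' -> j' < i' + 5 -> c i' <> c j' by apply: (C5in_neq cC).
have N3 u : u \in A -> edge (c 3) u -> u = c 2 \/ u = c 4.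
  by move=> uA cu; apply: (C5in_nb cC (i := 2)) => //; apply: (cN 3).
have N1' u : u \in A -> edge (c 1) u -> u = c 2 \/ u = c 0.
  move=> uA cu; apply/or_comm; apply: (C5in_nb cC (i := 0)) => //; exact: (cN 1).
have N2' u : u \in A -> edge (c 2) u -> u = c 1 \/ u = c 3.
  move=> uA cu; apply: (C5in_nb cC (i := 1)) => //; exact: (cN 2).
apply: (color_adj2 L4 IH (p1 := c 1) (p2 := c 2) (o1 := c 0) (o2 := c 3)) => //.
- exact: (C5in_edge cC).
- by rewrite edgeC; apply: (C5in_edge cC).
- exact: (C5in_edge cC).
- by apply: ne.
- by move/esym; apply: ne.
- by right; rewrite c0.
(* A bad cycle after this second deletion cannot use [c 3], which has one neighbour left, nor [c 0],
   which leads to [c 3] through [c 4]. So it would not be attached to the deleted pair. *)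
move=> e be; exfalso; set B' := A :\: _ in be; case: (be) => eC _.
have eB j : e j \in B' by case: eC.
have eA j : e j \in A by move: (eB j); rewrite inE => /andP[].
have inB' j : c j <> c 1 -> c j <> c 2 -> c j \in B'.
  by move=> /eqP a1 /eqP a2; rewrite !inE negb_or a1 a2 cA.
have no3 j : e j <> c 3.
  move=> E; have := C5in_card eC j; rewrite E => /eqP; apply/negP; rewrite neq_ltn; apply/orP; left.
  rewrite ltnS leqNgt; apply/negP => /nb_gt1P[x [y [xB yB cx cy]]].
  have xE z : z \in B' -> edge (c 3) z -> z = c 4.
    move=> zB /N3[]// => [|E2]; first by move: zB; rewrite inE => /andP[].
    by move: zB; rewrite !inE E2 eqxx orbT.
  by rewrite (xE x) // (xE y).
have no0 j : e j <> c 0.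
  move=> E; have [|| j1 E1] := @C5in_closed _ _ _ eC j (c 4).
  - by apply: inB' => /esym; apply: ne.
  - by rewrite E edgeC.
  have [|| j2 E2] := @C5in_closed _ _ _ eC j1 (c 3).
  - by apply: inB' => /esym; apply: ne.
  - by rewrite -E1 edgeC; apply: (C5in_edge cC).
  by case: (no3 j2).
have [j [s' [sS' _ es]]] := C5_attached noB be.
have := eB j; rewrite !inE negb_or => /andP[/andP[/eqP n1 /eqP n2] _].
move: sS' es; rewrite !inE => /orP[]/eqP->; rewrite edgeC.
  by case/(N1' _ (eA j))=> E; [apply: n2 | apply: (no0 j)].
by case/(N2' _ (eA j))=> E; [apply: n1 | apply: (no3 j)].
Qed.

Lemma color_rainbow_closed (Z S : {set G}) (f : G -> C) : S \subset A -> good L Z (A :\: S) f ->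
  Z \subset S -> (forall u v, u \in S -> v \in A -> edge u v -> v \in S) ->
  (forall u, u \in S -> f u \in L u) ->
  (forall u v, u \in S -> v \in S -> u <> v -> f u <> f v) -> good L set0 A f.
Proof.
move=> SA gf ZS cl fL inj.
apply: (extend (B := A :\: S) (S := S) (Z := Z)) => //.
- move=> v u vS uA vu; apply: inj => //; first exact: (cl v).
  exact: edge_neq vu.
- move=> v vS _ /nb_gt1P[x [y [xA yA vx vy xy]]].
  by exists x, y; split=> //; apply: inj => //; apply: (cl v).
- move=> o oB _ gt1; left; split; last first.
    by move: oB; rewrite inE => /andP[oS _]; apply: contra oS; apply: (subsetP ZS).
  rewrite -(@nb_off _ A S) // => s sS _; rewrite edgeC => so.
  by move: oB; rewrite inE => /andP[/negP oS oA]; apply: oS; apply: (cl s).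
- move=> X v pf XA cX vS; apply: (rainbow_notin pf XA cX) => u w uX wX vu vw.
  have inA := subsetP XA.
  by apply: inj; [exact: (cl v u vS (inA u uX) vu) | exact: (cl v w vS (inA w wX) vw)].
Qed.

Lemma no_bad_closed (S : {set G}) d : (forall u v, u \in S -> v \in A -> edge u v -> v \in S) ->
  ~ bad L (A :\: S) d.
Proof.
move=> cl bd; have [i [s [sS _ ds]]] := C5_attached noB bd.
case: bd => [[/(_ i)]]; rewrite inE => /andP[/negP dS dA] _ _ _; apply: dS.
by apply: (cl s) => //; rewrite edgeC.
Qed.

(** A colour [x] that one list has and another lacks saves one constraint: it is used at the first
    vertex, and the vertex whose list lacks it comes last, with three colours to avoid. All five
    colours are then distinct. *)
Lemma color_C5 d : C5in A d -> exists f, good L set0 A f.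
Proof.
move=> dC; have nid : ~ (forall i, L (d i) = L (d 0)) by move=> H; apply: (noB (d := d)).
pose S := cset 5 d; case: (dC) => dA per dE.
have SA : S \subset A by apply/subsetP=> v /csetP[i _ ->].
have cl u v : u \in S -> v \in A -> edge u v -> v \in S.
  by case/csetP=> i _ -> vA /(C5in_closed dC vA)[j ->]; apply: mem_cset.
have prB : A :\: S \proper A by apply: (setD_proper (v := d 0)) => //; apply: mem_cset.
have [|f gf] := IH prB (Z := set0); first by move=> e be; case: (no_bad_closed cl be).
have [i0 [j0 [x xi xj]]] : exists i j, exists2 x, x \in L (d i) & x \notin L (d j).
  have [i ni] := not_all_ex_not _ _ nid; exists i, 0; case: (boolP (has (fun x => x \notin L (d 0)) (L (d i)))).
    by case/hasP=> x xi x0; exists x.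
  rewrite -all_predC => /allP H; case: ni; apply/eqP; rewrite eqEfcard !L4 leqnn andbT.
  by apply/fsubsetP => x /H /=; rewrite negbK.
have dj : d j0 \in S by apply: mem_cset.
pose c i := d (i0 + i).
have cC : C5in A c by apply: C5in_shift.
have c0 : c 0 = d i0 by rewrite /c addn0.
have SE v : v \in S -> exists2 i, i < 5 & v = c i.
  case/csetP=> m _ ->; exists ((m + 4 * i0) %% 5); first by rewrite ltn_pmod.
  rewrite /c -[RHS](period_mod per) modnDmr -(period_mod per m).
  by congr d; lia.
have ne i j : i < 5 -> j < 5 -> i <> j -> c i != c j.
  move=> l1 l2 nij; apply/eqP; case: (ltngtP i j) => // lt; first by apply: (C5in_neq cC); lia.
  by move/esym; apply: (C5in_neq cC); lia.
have cS i : c i \in S by apply: mem_cset.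
have key x1 x2 x3 y : uniq [:: c 0; x1; x2; x3; y] -> S =i [:: c 0; x1; x2; x3; y] ->
  x \notin L y -> exists f, good L set0 A f.
  move=> un SEq xy; pose g u := if u == c 0 then x else f u.
  have mS u : u \in [:: c 0; x1; x2; x3; y] -> u \in S by rewrite SEq.
  move: un; rewrite /= !inE !negb_or !andbT => /and4P[/and4P[u01 u02 u03 u04] /and3P[u12 u13 u14] /andP[u23 u24] u34].
  have [|f' [ff' /= [[f1L [f10 _]] [[f2L [f20 [f21 _]]] [[f3L [f30 [f31 [f32 _]]]] [[fyL [fy1 [fy2 [fy3 _]]]] _]]]]]] :=
    greedy_seq L4 g (s := [:: (x1, [:: c 0]); (x2, [:: c 0; x1]); (x3, [:: c 0; x1; x2]); (y, [:: x1; x2; x3])]).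
    by rewrite /= !inE !negb_or u01 u02 u03 u04 u12 u13 u14 u23 u24 u34.
  have f0 : f' (c 0) = x by rewrite ff' ?/g ?eqxx //= !inE !negb_or u01 u02 u03 u04.
  have fy0 : f' y <> f' (c 0) by rewrite f0 => E; move: xy; rewrite -E fyL.
  exists f'; apply: (color_rainbow_closed (S := S) (Z := set0)) => //.
  - apply: eq_good gf => u; rewrite inE SEq !inE !negb_or => /andP[/and5P[a0 a1 a2 a3 a4] _].
    by rewrite ff' /g ?(negbTE a0) //= !inE !negb_or a1 a2 a3 a4.
  - exact: sub0set.
  - by move=> u; rewrite SEq !inE => /or4P[/eqP->|/eqP->|/eqP->|/orP[]/eqP->]; rewrite ?f0 ?c0.
  - move=> u v; rewrite !SEq !inE => /or4P[/eqP->|/eqP->|/eqP->|/orP[]/eqP->];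
    move=> /or4P[/eqP->|/eqP->|/eqP->|/orP[]/eqP->] //; by [move=> _ /esym | move=> _].
have [j ltj Ej] := SE _ dj.
have SEq s : all (fun i => i < 5) s -> (forall i, i < 5 -> i \in s) -> S =i map c s.
  move=> /allP s5 all5 v; apply/idP/mapP => [/SE[i lt ->]|[i _ ->] //]; by exists i => //; apply: all5.
have xcj : x \notin L (c j) by rewrite -Ej.
have uq s : uniq s -> all (fun i => i < 5) s -> uniq (map c s).
  move=> us /allP s5; rewrite map_inj_in_uniq // => a b /s5 la /s5 lb E.
  by case: (eqVneq a b) => // /eqP nab; move: (ne a b la lb nab); rewrite E eqxx.
case: j ltj {Ej} xcj => [|[|[|[|[|//]]]]] _ xcj.
- by move: xcj; rewrite c0 xi.
- by apply: (key (c 2) (c 3) (c 4) (c 1)) => //; [apply: (uq [:: 0; 2; 3; 4; 1]) | apply: (SEq [:: 0; 2; 3; 4; 1]) => // -[|[|[|[|[|]]]]]].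
- by apply: (key (c 1) (c 3) (c 4) (c 2)) => //; [apply: (uq [:: 0; 1; 3; 4; 2]) | apply: (SEq [:: 0; 1; 3; 4; 2]) => // -[|[|[|[|[|]]]]]].
- by apply: (key (c 1) (c 2) (c 4) (c 3)) => //; [apply: (uq [:: 0; 1; 2; 4; 3]) | apply: (SEq [:: 0; 1; 2; 4; 3]) => // -[|[|[|[|[|]]]]]].
- by apply: (key (c 1) (c 2) (c 3) (c 4)) => //; [apply: (uq [:: 0; 1; 2; 3; 4]) | apply: (SEq [:: 0; 1; 2; 3; 4]) => // -[|[|[|[|[|]]]]]].
Qed.
End AdjacentDegreeTwo.

Section AdjacentDegreeTwo.
Variables (G : sgraph) (C : choiceType) (L : G -> {fset C}) (A : {set G}).
Hypothesis L4 : forall v, #|` L v| = 4.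
Hypothesis IH : forall B : {set G}, B \proper A -> colorable L B.
Hypothesis noB : forall d, ~ bad L A d.
Hypothesis mindeg : forall v, v \in A -> 1 < #|nb A v|.

(** Since [w0] has degree two, [p0] must also avoid [x0], which makes four constraints; likewise at
    [p3]. So two candidates are held at either end until the middle colours are known. *)
Lemma color_chain4 p0 p1 p2 p3 w0 w3 x0 x3 :
  uniq [:: p0; p1; p2; p3; w0; w3] -> {subset [:: p0; p1; p2; p3; w0; w3; x0; x3] <= A} ->
  x0 <> p0 -> x3 <> p3 ->
  [/\ edge p0 w0, edge p0 p1, edge p1 p2, edge p2 p3 & edge p3 w3] ->
  edge w0 x0 -> edge w3 x3 ->
  (forall u, u \in A -> edge p0 u -> u = p1 \/ u = w0) ->
  (forall u, u \in A -> edge p1 u -> u = p0 \/ u = p2) ->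
  (forall u, u \in A -> edge p2 u -> u = p1 \/ u = p3) ->
  (forall u, u \in A -> edge p3 u -> u = p2 \/ u = w3) ->
  (forall u, u \in A -> edge w0 u -> u = p0 \/ u = x0) ->
  (forall u, u \in A -> edge w3 u -> u = p3 \/ u = x3) ->
  exists f, good L set0 A f.
Proof.
move=> un sA x0p x3p [e0w e01 e12 e23 e3w] ew0 ew3 N0 N1 N2 N3 M0 M3.
move: un; rewrite /= !inE !negb_or !andbT.
case/and5P=> /and5P[u01 u02 u03 u0w u0w3] /and4P[u12 u13 u1w u1w3] /and3P[u23 u2w u2w3] /andP[u3w u3w3] uww.
have [p0A p1A p2A p3A] : [/\ p0 \in A, p1 \in A, p2 \in A & p3 \in A].
  by split; apply: sA; rewrite !inE eqxx ?orbT.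
have [w0A w3A x0A x3A] : [/\ w0 \in A, w3 \in A, x0 \in A & x3 \in A].
  by split; apply: sA; rewrite !inE eqxx ?orbT.
pose S := [set p0; p1; p2; p3]; pose B := A :\: S.
have SP v : v \in S -> [\/ v = p0, v = p1, v = p2 | v = p3].
  by rewrite !inE -!orbA => /or4P[]/eqP; [constructor 1|constructor 2|constructor 3|constructor 4].
have inB v : v \in A -> v != p0 -> v != p1 -> v != p2 -> v != p3 -> v \in B.
  by move=> vA a b c d; rewrite !inE !negb_or a b c d.
have nS v : v \in B -> [/\ v != p0, v != p1, v != p2 & v != p3].
  by rewrite !inE !negb_or -!andbA => /and5P[].
have w0B : w0 \in B by apply: inB; rewrite // eq_sym.
have w3B : w3 \in B by apply: inB; rewrite // eq_sym.
have x0B : x0 \in B.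
  apply: inB => //; apply/eqP => // E; rewrite E in ew0; rewrite edgeC in ew0.
  - by case: (N1 _ w0A ew0) => /eqP; rewrite eq_sym ?(negbTE u0w) ?(negbTE u2w).
  - by case: (N2 _ w0A ew0) => /eqP; rewrite eq_sym ?(negbTE u1w) ?(negbTE u3w).
  - by case: (N3 _ w0A ew0) => /eqP; rewrite ?(negbTE uww) // eq_sym (negbTE u2w).
have x3B : x3 \in B.
  apply: inB => //; apply/eqP => // E; rewrite E in ew3; rewrite edgeC in ew3.
  - by case: (N0 _ w3A ew3) => /eqP; rewrite eq_sym ?(negbTE u1w3) ?(negbTE uww).
  - by case: (N1 _ w3A ew3) => /eqP; rewrite eq_sym ?(negbTE u0w3) ?(negbTE u2w3).
  - by case: (N2 _ w3A ew3) => /eqP; rewrite eq_sym ?(negbTE u1w3) ?(negbTE u3w3).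
have sBA u : u \in B -> u \in A by rewrite inE => /andP[].
(* only [w0] and [w3] see the chain *)
have att o s : o \in B -> s \in S -> edge o s -> (o = w0 /\ s = p0) \/ (o = w3 /\ s = p3).
  move=> oB /SP sS os; have oA := sBA _ oB; have [a0 a1 a2 a3] := nS _ oB.
  rewrite edgeC in os; case: sS os => ->.
  - by case/(N0 _ oA) => E; [move: a1; rewrite E eqxx | left].
  - by case/(N1 _ oA) => E; [move: a0 | move: a2]; rewrite E eqxx.
  - by case/(N2 _ oA) => E; [move: a1 | move: a3]; rewrite E eqxx.
  - by case/(N3 _ oA) => E; [move: a2; rewrite E eqxx | right].
have BA : B \proper A by apply: (setD_proper p0A); rewrite !inE eqxx.
have [|f gf] := IH BA (Z := set0).
  move=> d bd; have [i [s [sS _ ds]]] := C5_attached noB bd.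
  case: (bd) => dC _; have dB : d i \in B by case: dC.
  have le1 w x p : p \in S -> (forall u, u \in A -> edge w u -> u = p \/ u = x) -> #|nb B w| <= 1.
    move=> pS M; rewrite leqNgt; apply/negP => /nb_gt1P[a [b [aB bB wa wb]]].
    have E y : y \in B -> edge w y -> y = x.
      by move=> yB /(M y (sBA _ yB))[yp|//]; move: yB; rewrite inE yp pS.
    by rewrite (E a) // (E b).
  have p0S : p0 \in S by rewrite !inE eqxx.
  have p3S : p3 \in S by rewrite !inE eqxx ?orbT.
  have c2 := C5in_card dC i; case: (att _ _ dB sS ds) => [[E _]|[E _]]; rewrite E in c2.
    by have := le1 _ _ p0 p0S M0; rewrite c2.
  by have := le1 _ _ p3 p3S M3; rewrite c2.
have [s sL] := @list_fresh _ _ L L4 p0 [:: f w0; f x0] isT; rewrite !inE !negb_or => /andP[sw sx].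
have [t tL] := @list_fresh _ _ L L4 p0 [:: f w0; f x0; s] isT; rewrite !inE !negb_or => /and3P[tw tx ts].
have [u uL] := @list_fresh _ _ L L4 p3 [:: f w3; f x3] isT; rewrite !inE !negb_or => /andP[uw ux].
have [v vL] := @list_fresh _ _ L L4 p3 [:: f w3; f x3; u] isT; rewrite !inE !negb_or => /and3P[vw vx vu].
(* Avoiding both candidates for [p0] here means that [p0] later only has to dodge [a2]. *)
have [a1 a1L] := @list_fresh _ _ L L4 p1 [:: f w0; s; t] isT; rewrite !inE !negb_or => /and3P[a1w a1s a1t].
pose a3 := if a1 == u then v else u.
have a3L : a3 \in L p3 by rewrite /a3; case: ifP.
have a3w : a3 != f w3 by rewrite /a3; case: ifP.
have a3x : a3 != f x3 by rewrite /a3; case: ifP.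
have a13 : a1 != a3 by rewrite /a3; case: ifP => [/eqP->|/negbT//]; rewrite eq_sym.
have [a2 a2L] := @list_fresh _ _ L L4 p2 [:: f w3; a1; a3] isT; rewrite !inE !negb_or => /and3P[a2w a21 a23].
pose a0 := if a2 == s then t else s.
have a0L : a0 \in L p0 by rewrite /a0; case: ifP.
have a0w : a0 != f w0 by rewrite /a0; case: ifP.
have a0x : a0 != f x0 by rewrite /a0; case: ifP.
have a01 : a0 != a1 by rewrite /a0 eq_sym; case: ifP.
have a02 : a0 != a2 by rewrite /a0 eq_sym; case: ifP => [/eqP->|/negbT//]; rewrite eq_sym.
pose f' y := if y == p0 then a0 else if y == p1 then a1 else if y == p2 then a2 else
  if y == p3 then a3 else f y.
have f0 : f' p0 = a0 by rewrite /f' eqxx.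
have f1 : f' p1 = a1 by rewrite /f' eq_sym (negbTE u01) eqxx.
have f2 : f' p2 = a2 by rewrite /f' eq_sym (negbTE u02) eq_sym (negbTE u12) eqxx.
have f3 : f' p3 = a3 by rewrite /f' eq_sym (negbTE u03) eq_sym (negbTE u13) eq_sym (negbTE u23) eqxx.
have fo y : y \in B -> f' y = f y.
  by case/nS=> b0 b1 b2 b3; rewrite /f' (negbTE b0) (negbTE b1) (negbTE b2) (negbTE b3).
have fe := (f0, f1, f2, f3).
exists f'; apply: (extend (B := B) (S := S) (Z := set0)) => //.
- by apply/subsetP=> y /SP[]->.
- by apply: eq_good gf => y yB; rewrite fo.
- by move=> y /SP[]->; rewrite fe.
- move=> y z /SP[]-> zA.
  + by case/(N0 _ zA)=> ->; rewrite ?fe ?fo //; apply/eqP.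
  + by case/(N1 _ zA)=> ->; rewrite ?fe ?fo //; apply/eqP; rewrite // eq_sym.
  + by case/(N2 _ zA)=> ->; rewrite ?fe ?fo //; apply/eqP; rewrite // eq_sym.
  + by case/(N3 _ zA)=> ->; rewrite ?fe ?fo //; apply/eqP; rewrite // eq_sym.
- move=> y /SP[]-> _ _.
  + by exists p1, w0; split=> //; rewrite fe fo //; apply/eqP.
  + by exists p0, p2; split=> //; rewrite ?fe; [rewrite edgeC|apply/eqP].
  + by exists p1, p3; split=> //; rewrite ?fe; [rewrite edgeC|apply/eqP].
  + by exists p2, w3; split=> //; rewrite ?fe ?fo //; [rewrite edgeC|apply/eqP].
- move=> o oB _ gt1; have [[y yS oy]|no] := classic (exists2 y, y \in S & edge o y); last first.
    left; rewrite inE; split=> //; rewrite -(@nb_off _ A S) // => y yS _ oy.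
    by apply: no; exists y.
  right; case: (att _ _ oB yS oy) => [[-> _]|[-> _]].
  + by exists p0, x0; split=> //; [rewrite edgeC|rewrite fe fo //; apply/eqP].
  + by exists p3, x3; split=> //; [rewrite edgeC|rewrite fe fo //; apply/eqP].
- move=> X y pf /subsetP XA cX /SP[]->.
  + apply: (deg2_notin (a := p1) (b := w0) pf _ cX); [exact/subsetP|by move=> z /XA; apply: N0|by rewrite fe fo //; apply/eqP].
  + apply: (deg2_notin (a := p0) (b := p2) pf _ cX); [exact/subsetP|by move=> z /XA; apply: N1|by rewrite !fe; apply/eqP].
  + apply: (deg2_notin (a := p1) (b := p3) pf _ cX); [exact/subsetP|by move=> z /XA; apply: N2|by rewrite !fe; apply/eqP].
  + apply: (deg2_notin (a := p2) (b := w3) pf _ cX); [exact/subsetP|by move=> z /XA; apply: N3|by rewrite fe fo //; apply/eqP].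
Qed.

Lemma color_C4 p0 p1 p2 p3 : uniq [:: p0; p1; p2; p3] -> {subset [:: p0; p1; p2; p3] <= A} ->
  (forall u v, u \in [:: p0; p1; p2; p3] -> v \in A -> edge u v -> v \in [:: p0; p1; p2; p3]) ->
  exists f, good L set0 A f.
Proof.
move=> un sA cl; pose S := [set x in [:: p0; p1; p2; p3]].
have clS u v : u \in S -> v \in A -> edge u v -> v \in S by rewrite !(@in_set G); apply: cl.
have prB : A :\: S \proper A.
  by apply: (setD_proper (v := p0)); [apply: sA|rewrite in_set]; rewrite mem_head.
have [|f gf] := IH prB (Z := set0); first by move=> e be; case: (no_bad_closed noB clS be).
move: un; rewrite /= !inE !negb_or !andbT => /and3P[/and3P[u01 u02 u03] /andP[u12 u13] u23].
have [|f' [ff' /= [[f0L _] [[f1L [f10 _]] [[f2L [f20 [f21 _]]] [[f3L [f30 [f31 [f32 _]]]] _]]]]]] :=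
  greedy_seq L4 f (s := [:: (p0, [::]); (p1, [:: p0]); (p2, [:: p0; p1]); (p3, [:: p0; p1; p2])]).
  by rewrite /= !inE !negb_or u01 u02 u03 u12 u13 u23.
exists f'; apply: (color_rainbow_closed (S := S) (Z := set0)) => //.
- by apply/subsetP=> u; rewrite in_set; apply: sA.
- apply: eq_good gf => u; rewrite inE in_set => /andP[uS _].
  by rewrite ff'.
- exact: sub0set.
- by move=> u; rewrite in_set !inE => /or4P[]/eqP->.
- move=> u v; rewrite !in_set !inE => /or4P[]/eqP-> /or4P[]/eqP-> //; by [move=> _ /esym|move=> _].
Qed.

(** If there were no colouring, [step] would propagate degree two outwards, giving six such vertices
    [w0], [p0], [p1], [p2], [p3], [w3]. They close up to a 4-cycle or a 5-cycle, or form the chain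
    of [color_chain4]. *)
Lemma color_adjacent_deg2 p1 p2 : p1 \in A -> p2 \in A -> edge p1 p2 ->
  #|nb A p1| = 2 -> #|nb A p2| = 2 -> exists f, good L set0 A f.
Proof.
move=> p1A p2A e12 d1 d2; apply: NNPP => nogood.
have step q1 q2 r1 : q1 \in A -> q2 \in A -> edge q1 q2 -> #|nb A q1| = 2 -> #|nb A q2| = 2 ->
  r1 \in A -> edge q1 r1 -> r1 <> q2 -> #|nb A r1| = 2 /\ ~ edge q2 r1.
  move=> q1A q2A e d1' d2' r1A er rq.
  have [w1 [w1A e1 w1q N1]] := deg2_other d1' q2A e.
  have Er : r1 = w1 by case: (N1 _ r1A er).
  rewrite -{w1}Er in w1A e1 w1q N1.
  have e' : edge q2 q1 by rewrite edgeC.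
  have [w2 [w2A e2 w2q N2]] := deg2_other d2' q1A e'.
  have nH : ~ (r1 = w2 \/ 2 < #|nb A r1|).
    by move=> H; apply: nogood; apply: (color_adj2_step L4 IH noB (p1 := q1) (p2 := q2) (o1 := r1) (o2 := w2)).
  split.
    apply/eqP; rewrite eqn_leq mindeg // andbT leqNgt; apply/negP => lt; apply: nH; by right.
  by move=> q2r; case: (N2 _ r1A q2r) => E; [move: er; rewrite E edge_irrefl|apply: nH; left].
have e21 : edge p2 p1 by rewrite edgeC.
have [p0 [p0A e10 p02 N1]] := deg2_other d1 p2A e12.
have [p3 [p3A e23 p31 N2]] := deg2_other d2 p1A e21.
have [dp0 n20] := step p1 p2 p0 p1A p2A e12 d1 d2 p0A e10 p02.
have [dp3 n13] := step p2 p1 p3 p2A p1A e21 d2 d1 p3A e23 p31.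
have e01 : edge p0 p1 by rewrite edgeC.
have e32 : edge p3 p2 by rewrite edgeC.
have [w0 [w0A e0w w01 N0]] := deg2_other dp0 p1A e01.
have [w3 [w3A e3w w32 N3]] := deg2_other dp3 p2A e32.
have [dw0 n1w] := step p0 p1 w0 p0A p1A e01 dp0 d1 w0A e0w w01.
have [dw3 n2w] := step p3 p2 w3 p3A p2A e32 dp3 d2 w3A e3w w32.
have ew0 : edge w0 p0 by rewrite edgeC.
have ew3 : edge w3 p3 by rewrite edgeC.
have u01 : p0 != p1 by apply/eqP/edge_neq.
have u02 : p0 != p2 by apply/eqP.
have u03 : p0 != p3 by apply/eqP => E; apply: n20; rewrite E.
have u12 : p1 != p2 by apply/eqP/edge_neq.
have u13 : p1 != p3 by rewrite eq_sym; apply/eqP.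
have u23 : p2 != p3 by apply/eqP/edge_neq.
have N1' u : u \in A -> edge p1 u -> u = p0 \/ u = p2 by move=> uA /(N1 _ uA)[]; auto.
have [E|u3w] := eqVneq w0 p3.
  apply: nogood; apply: (color_C4 (p0 := p0) (p1 := p1) (p2 := p2) (p3 := p3)).
  - by rewrite /= !inE !negb_or u01 u02 u03 u12 u13 u23.
  - by move=> u; rewrite !inE => /or4P[]/eqP->.
  - have Ew3 : w3 = p0.
      by rewrite E in e0w; rewrite edgeC in e0w; case: (N3 _ p0A e0w).
    move=> u v; rewrite !inE => /or4P[]/eqP-> vA.
    + by case/(N0 _ vA)=> ->; rewrite ?E eqxx ?orbT.
    + by case/(N1 _ vA)=> ->; rewrite eqxx ?orbT.
    + by case/(N2 _ vA)=> ->; rewrite eqxx ?orbT.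
    + by case/(N3 _ vA)=> ->; rewrite ?Ew3 eqxx ?orbT.
have u0w : p0 != w0 by apply/eqP/edge_neq.
have u3w3 : p3 != w3 by apply/eqP/edge_neq.
have u1w : p1 != w0 by rewrite eq_sym; apply/eqP.
have u2w : p2 != w0 by apply/eqP => E; move: e0w; rewrite -E edgeC.
have u2w3 : p2 != w3 by rewrite eq_sym; apply/eqP.
have u1w3 : p1 != w3 by apply/eqP => E; move: e3w; rewrite -E edgeC.
have u0w3 : p0 != w3.
  apply/eqP => E; rewrite -E in ew3; case: (N0 _ p3A ew3) => E2; first by rewrite E2 eqxx in u13.
  by rewrite E2 eqxx in u3w.
have [Ew|uww] := eqVneq w0 w3.
  apply: nogood; pose q i := nth w0 [:: w0; p0; p1; p2; p3] i.
  have eq4 : edge p3 w0 by rewrite Ew.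
  have uq : uniq [:: w0; p0; p1; p2; p3].
    rewrite /= !inE !negb_or u01 u02 u03 u12 u13 u23 u3w (eq_sym w0 p0) u0w.
    by rewrite (eq_sym w0 p1) u1w (eq_sym w0 p2) u2w.
  have [|||||_ _ per _] := @mkcyc _ A 5 q => //.
  - by case=> [|[|[|[|[|]]]]].
  - move=> i j ij j5; apply/eqP; rewrite nth_uniq //; last exact: leq_trans ij (ltnW j5).
    by rewrite neq_ltn ij.
  - by case=> [|[|[|[|]]]].
  apply: (color_C5 L4 IH noB (d := fun i => q (i %% 5))); split=> //.
    move=> i; have : i %% 5 < 5 by rewrite ltn_pmod.
    by case: (i %% 5) => [|[|[|[|[|]]]]].
  move=> i u uA.
  have -> : i.+1 %% 5 = (i %% 5).+1 %% 5 by rewrite -addn1 -modnDml addn1.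
  have -> : i.+2 %% 5 = (i %% 5).+2 %% 5 by rewrite -addn2 -modnDml addn2.
  have : i %% 5 < 5 by rewrite ltn_pmod.
  have [y0 [y0A ewy wy Nw]] := deg2_other dw0 p0A ew0.
  have Ey : y0 = p3 by case: (Nw p3 p3A) => //; [rewrite Ew|move=> E; rewrite E eqxx in u03].
  have bip x a b : edge x a -> edge x b -> (forall z, z \in A -> edge x z -> z = a \/ z = b) ->
    edge x u = (u == a) || (u == b).
    move=> xa xb N; apply/idP/idP => [/(N _ uA)[]->|/orP[]/eqP->] //; by rewrite eqxx ?orbT.
  case: (i %% 5) => [|[|[|[|[|]]]]] // _; rewrite /q /=.
  + by apply: bip => // z zA /(N0 _ zA)[]; auto.
  + exact: bip.
  + exact: bip.
  + by apply: bip => // z zA /(N3 _ zA); rewrite Ew.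
  + by apply: bip => // [|z zA /(Nw _ zA)[]->]; rewrite ?Ey; auto; rewrite edgeC.
have [x0 [x0A ex0 x0p M0]] := deg2_other dw0 p0A ew0.
have [x3 [x3A ex3 x3p M3]] := deg2_other dw3 p3A ew3.
apply: nogood; apply: (@color_chain4 p0 p1 p2 p3 w0 w3 x0 x3) => //.
- by rewrite /= !inE !negb_or u01 u02 u03 u0w u0w3 u12 u13 u1w u1w3 u23 u2w u2w3 eq_sym u3w u3w3 uww.
- by move=> u; rewrite !inE => /or4P[/eqP->|/eqP->|/eqP->|/or4P[/eqP->|/eqP->|/eqP->|/orP[]/eqP->]].
Qed.
End AdjacentDegreeTwo.

(** * Colouring a deleted path or star *)

Section PathColoring.
Variables (G : sgraph) (C : choiceType) (L : G -> {fset C}) (A : {set G}).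
Hypothesis L4 : forall v, #|` L v| = 4.
Hypothesis IH : forall B : {set G}, B \proper A -> colorable L B.

(* The vertex after the first is coloured first and the first one last; every vertex
   from the third on then differs in colour from the outer neighbour of its successor,
   so that a two-coloured cycle entering the path could only leave it at the far end. *)
Lemma color_path k (p o : nat -> G) : 3 <= k ->
  (forall i, i < k -> p i \in A) ->
  (forall i j, i < j -> j < k -> p i <> p j) ->
  (forall i, i.+1 < k -> edge (p i) (p i.+1)) ->
  (forall i, i < k -> o i \in A :\: cset k p) ->
  (forall i, i < k -> edge (p i) (o i)) ->
  (forall i u, i < k -> u \in A -> edge (p i) u ->
     [\/ u = o i, 0 < i /\ u = p i.-1 | i.+1 < k /\ u = p i.+1]) ->
  (forall d, bad L (A :\: cset k p) d -> exists i, d i = o k.-1) ->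
  (forall u i, u \in A :\: cset k p -> i < k -> edge u (p i) ->
     [\/ 1 < #|nb (A :\: cset k p) u| /\ u <> o k.-1,
         u = o k.-1 /\ exists2 x, x \in A :\: cset k p & edge u x,
         exists j, [/\ j.+1 < k, edge u (p j) & edge u (p j.+1)] |
         edge u (p 0) /\ edge u (p 2)]) ->
  exists f, good L set0 A f.
Proof.
move=> k3 pA pinj pe oB poe N Hbad Hout.
set S := cset k p in oB Hbad Hout; set B := A :\: S in oB Hbad Hout.
have pS i : i < k -> p i \in S by move=> lt; apply/csetP; exists i.
have sBA u : u \in B -> u \in A by rewrite inE => /andP[].
have nBp u i : u \in B -> i < k -> u <> p i.
  by move=> + lt E; rewrite inE E pS.
have k0 : 0 < k by lia.
have BA : B \proper A by apply: (setD_proper (pA 0 k0)); apply: pS.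
have [|f gf] := IH BA (Z := [set o k.-1]).
  by move=> d /Hbad[i <-]; exists i; rewrite inE.
have lastk : k.-1 < k by lia.
pose e := some_nb B (o k.-1).
have eB : e \in B by apply: some_nb_in; apply: oB.
(* The order is [p 1], [p 2], ..., [p k.-1], [p 0]. The third constraint of [p k.-1] is [e], a
   neighbour of the exempted [o k.-1]. The vertex [p 0] also avoids [p 2], so that [p 1] sees two
   colours. *)
pose t i := if i.+1 == k then p 0 else p i.+1.
pose K i := if i == 0 then [:: o 0; o 1; o 2] else if i.+1 == k then [:: o 0; p 1; p 2]
  else [:: p i; o i.+1; if i.+2 == k then e else o i.+2].
have pinj' i j : i < k -> j < k -> p i = p j -> i = j.
  by move=> li lj E; case: (ltngtP i j) => // lt; [case: (pinj i j) | case: (pinj j i)].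
have tE i : i < k -> exists2 j, j < k & t i = p j.
  by move=> lt; rewrite /t; case: eqP => ?; [exists 0 | exists i.+1 => //; lia].
have [|||f' [ff' fK]] := @greedy _ _ L L4 k t K f.
- move=> i j ij jk; rewrite /t; case: eqP => E; case: eqP => E' /pinj'; lia.
- by move=> i _; rewrite /K; case: ifP => // _; case: ifP.
- move=> i j ij jk; have [m mk tj] := tE j jk.
  have oi n : n < k -> t j != o n by move=> nk; rewrite tj eq_sym; apply/eqP; apply: nBp => //; apply: oB.
  have te : t j != e by rewrite tj eq_sym; apply/eqP; apply: nBp.
  rewrite /K; case: eqP => [Ei|Ei]; first by rewrite !inE !negb_or !oi //; lia.
  case: eqP => [Ek|Ek]; rewrite !inE !negb_or.
    rewrite oi //= /t (_ : j.+1 == k); last by apply/eqP; lia.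
    by apply/andP; split; apply/eqP => /pinj'; lia.
  have -> /= : t j != o i.+1 by apply: oi; lia.
  apply/andP; split; last by case: (i.+2 =P k) => // ?; apply: oi; lia.
  by rewrite /t; case: (j.+1 =P k) => Ej; apply/eqP => /pinj'; lia.
have ffB : {in B, f =1 f'}.
  by move=> u uB; rewrite ff' // => i /tE[j jk ->]; apply: nBp.
have fp1 : [/\ f' (p 1) \in L (p 1), f' (p 1) <> f' (o 0), f' (p 1) <> f' (o 1) & f' (p 1) <> f' (o 2)].
  have [] := fK 0 k0; rewrite /t /K /= (_ : 1 == k = false); last by apply/eqP; lia.
  by move=> fL H; split=> //; apply: H; rewrite !inE eqxx ?orbT.
have fp0 : [/\ f' (p 0) \in L (p 0), f' (p 0) <> f' (o 0), f' (p 0) <> f' (p 1) & f' (p 0) <> f' (p 2)].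
  have [] := fK k.-1 lastk; rewrite /t /K /= prednK // eqxx (_ : k.-1 == 0 = false); last by apply/eqP; lia.
  by move=> fL H; split=> //; apply: H; rewrite !inE eqxx ?orbT.
have fpj j : 1 < j -> j < k -> [/\ f' (p j) \in L (p j), f' (p j) <> f' (p j.-1), f' (p j) <> f' (o j)
    & f' (p j) <> f' (if j.+1 == k then e else o j.+1)].
  case: j => [//|j] j1 jk; have [] := fK j (ltnW jk); rewrite /t /K.
  rewrite (_ : j.+1 == k = false); last by apply/eqP; lia.
  rewrite (_ : j == 0 = false); last by apply/eqP; lia.
  by move=> fL H; split=> //; apply: H; rewrite !inE eqxx ?orbT.
have fo i : i < k -> f' (p i) <> f' (o i).
  case: i => [|[|i]] ik; [by case: fp0|by case: fp1|by case: (fpj i.+2 isT ik)].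
have fL i : i < k -> f' (p i) \in L (p i).
  case: i => [|[|i]] ik; [by case: fp0|by case: fp1|by case: (fpj i.+2 isT ik)].
have fn i : i.+1 < k -> f' (p i.+1) <> f' (p i).
  by case: i => [|i] ik; [case: fp0 => _ _ /nesym|case: (fpj i.+2 isT ik)].
have fb i : 1 < i -> i < k -> f' (p i.-1) <> f' (o i).
  case: i => [|[|[|i]]] // _ ik; first by case: fp1.
  have [_ _ _] := fpj i.+2 isT (ltnW ik).
  by rewrite (_ : i.+3 == k = false) //; apply/eqP; lia.
exists f'; apply: (extend (B := B) (S := S) (Z := [set o k.-1])) => //.
- by apply/subsetP=> v /csetP[i ik ->]; apply: pA.
- exact: eq_good gf.
- by move=> v /csetP[i ik ->]; apply: fL.
- move=> v u /csetP[i ik ->] uA; case/(N i u ik uA) => [->|[i0 ->]|[i1 ->]].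
  + exact: fo.
  + by have := @fn i.-1; rewrite prednK //; apply.
  + by apply: nesym; apply: fn.
- move=> v /csetP[i ik ->] _ _; case: i ik => [|[|i]] ik.
  + exists (p 1), (o 0); split; [by apply: pA; lia|by apply/sBA/oB|by apply: pe; lia|exact: poe|by case: fp1].
  + exists (p 0), (p 2); split; [by apply: pA; lia|by apply: pA; lia|by rewrite edgeC; apply: pe; lia|by apply: pe; lia|by case: fp0].
  + exists (p i.+1), (o i.+2); split; [by apply: pA; lia|by apply/sBA/oB|by rewrite edgeC; apply: pe; lia|exact: poe|exact: (fb i.+2)].
- move=> u uB _ gt1; have [[s sS us]|no] := classic (exists2 s, s \in S & edge u s); last first.
    left; rewrite -(@nb_off _ A S) => [|s sS _ us]; last by apply: no; exists s.
    split=> //; rewrite inE; apply/eqP => E; apply: no; exists (p k.-1); first exact: pS.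
    by rewrite E edgeC; apply: poe.
  case/csetP: sS us => i ik -> us.
  case: (Hout u i uB ik us) => [[n2 /eqP nu]|[E [x xB ux]]|[j [jk u1 u2]]|[u0 u2]].
  + by left; rewrite inE.
  + right; have [_ ue] := some_nbP xB ux; rewrite E -/e in ue *.
    exists (p k.-1), e; split; [exact: pA|exact: sBA|by rewrite edgeC; apply: poe|by []|].
    have [|//|_ _ _] := @fpj k.-1; first by lia.
    by rewrite prednK // eqxx.
  + right; exists (p j.+1), (p j); split=> //; [exact: pA|by apply: pA; lia|exact: fn].
  + right; exists (p 0), (p 2); split=> //; [by apply: pA; lia|by apply: pA; lia|by case: fp0].
- move=> X v pf XA cX /csetP[i ik ->].
  have inA := subsetP XA.
  (* Cores are excluded from both ends: at [p 0] because [p 1] avoids [o 0], and from [p k.-1]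
     downwards by [fb], each step having lost the next vertex. Only [o 1] is left for [p 1], with
     [p 1] itself as the dummy second candidate. *)
  have x0 : p 0 \notin X.
    apply: (deg2_notin (a := p 1) (b := o 0) pf XA cX) => [u uX|]; last by case: fp1.
    by case/(N 0 u k0 (inA _ uX)) => [->|[]//|[_ ->]]; auto.
  have xj m : forall j, j + m = k.-1 -> 1 < j -> p j \notin X.
    elim: m => [|m IHm] j Ej j1.
      apply: (deg2_notin (a := p j.-1) (b := o j) pf XA cX) => [u uX|]; last by apply: fb; lia.
      by move/(N j u _ (inA _ uX)) => H; case: H => [|->|[_ ->]|[]]; auto; lia.
    have xj1 : p j.+1 \notin X by apply: IHm; lia.
    apply: (deg2_notin (a := p j.-1) (b := o j) pf XA cX) => [u uX|]; last by apply: fb; lia.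
    move/(N j u _ (inA _ uX)) => H; case: H => [|->|[_ ->]|[_ E]]; auto; first by lia.
    by move: xj1; rewrite -E uX.
  case: i ik => [|[|i]] ik //; last by apply: (xj (k.-1 - i.+2)); lia.
  apply: (deg2_notin (a := o 1) (b := p 1) pf XA cX) => [u uX|]; last by apply: nesym; apply: fo.
  case/(N 1 u ik (inA _ uX)) => [->|[_ E]|[_ E]]; first by left.
    by move: x0; rewrite -E uX.
  by have := xj (k.-1 - 2) 2; rewrite -E uX => H; have: ~~ true by apply: H; lia.
Qed.

(** The centre avoids all three outer colours, so each leaf has neighbours of different colours and
    lies in no core; hence neither does the centre. The leaf [l3] repairs the exempted [o3]; [l1]
    and [l2] differ for the sake of the centre and of a common outer neighbour. *)
Lemma color_star c l1 l2 l3 o1 o2 o3 : uniq [:: c; l1; l2; l3] ->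
  {subset [:: c; l1; l2; l3] <= A} ->
  {subset [:: o1; o2; o3] <= A :\: [set x in [:: c; l1; l2; l3]]} ->
  [/\ edge c l1, edge c l2 & edge c l3] -> [/\ edge l1 o1, edge l2 o2 & edge l3 o3] ->
  (forall u, u \in A -> edge c u -> [\/ u = l1, u = l2 | u = l3]) ->
  (forall u, u \in A -> edge l1 u -> u = c \/ u = o1) ->
  (forall u, u \in A -> edge l2 u -> u = c \/ u = o2) ->
  (forall u, u \in A -> edge l3 u -> u = c \/ u = o3) ->
  (forall d, bad L (A :\: [set x in [:: c; l1; l2; l3]]) d -> exists i, d i = o3) ->
  (forall u, u \in [:: o1; o2; o3] ->
     [\/ 1 < #|nb (A :\: [set x in [:: c; l1; l2; l3]]) u| /\ u <> o3,
         u = o3 /\ (exists2 x, x \in A :\: [set x in [:: c; l1; l2; l3]] & edge u x) |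
         edge u l1 /\ edge u l2]) ->
  exists f, good L set0 A f.
Proof.
move=> un sA oB [ec1 ec2 ec3] [e1 e2 e3] Nc N1 N2 N3 Hbad Hout.
set S := [set x in _] in oB Hbad Hout; set B := A :\: S in oB Hbad Hout.
have mS x : (x \in S) = [|| x == c, x == l1, x == l2 | x == l3] by rewrite in_set !inE.
have SP v : v \in S -> [\/ v = c, v = l1, v = l2 | v = l3].
  by rewrite mS => /or4P[]/eqP; [constructor 1|constructor 2|constructor 3|constructor 4].
have nS v : v \in B -> [/\ v != c, v != l1, v != l2 & v != l3].
  by rewrite inE mS !negb_or => /andP[/and4P[]].
have sBA u : u \in B -> u \in A by rewrite inE => /andP[].
have [cA l1A l2A l3A] : [/\ c \in A, l1 \in A, l2 \in A & l3 \in A].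
  by split; apply: sA; rewrite !inE eqxx ?orbT.
have [o1B o2B o3B] : [/\ o1 \in B, o2 \in B & o3 \in B].
  by split; apply: oB; rewrite !inE eqxx ?orbT.
have BA : B \proper A by apply: (setD_proper cA); rewrite mS eqxx.
have [|f gf] := IH BA (Z := [set o3]).
  by move=> d /Hbad[i <-]; exists i; rewrite inE.
move: un; rewrite /= !inE !negb_or !andbT => /and3P[/and3P[u01 u02 u03] /andP[u12 u13] u23].
pose e := some_nb B o3.
have eB : e \in B by apply: some_nb_in.
have [|f' [ff' /= [[fcL [fc1 [fc2 [fc3 _]]]] [[f3L [f3c [f33 [f3e _]]]] [[f1L [f1c [f11 _]]] [[f2L [f2c [f22 [f21 _]]]] _]]]]]] :=
  greedy_seq L4 f (s := [:: (c, [:: o1; o2; o3]); (l3, [:: c; o3; e]); (l1, [:: c; o1]); (l2, [:: c; o2; l1])]).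
  have [a0 a1 a2 a3] := nS _ o1B; have [b0 b1 b2 b3] := nS _ o2B.
  have [c0 c1 c2 c3] := nS _ o3B; have [_ d1 d2 d3] := nS _ eB.
  rewrite /= !inE !negb_or (eq_sym l3 l1) (eq_sym l3 l2) u13 u23.
  by rewrite ?a0 ?a1 ?a2 ?a3 ?b0 ?b1 ?b2 ?b3 ?c0 ?c1 ?c2 ?c3 ?d1 ?d2 ?d3 ?u01 ?u02 ?u03 ?u12.
have ffB : {in B, f =1 f'}.
  by move=> u /nS[a0 a1 a2 a3]; rewrite ff' //= !inE !negb_or a0 a1 a2 a3.
exists f'; apply: (extend (B := B) (S := S) (Z := [set o3])) => //.
- by apply/subsetP=> v /SP[]->.
- exact: eq_good gf.
- by move=> v /SP[]->.
- move=> v u /SP[]-> uA.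
  + by case/(Nc _ uA)=> -> /esym.
  + by case/(N1 _ uA)=> ->.
  + by case/(N2 _ uA)=> ->.
  + by case/(N3 _ uA)=> ->.
- move=> v /SP[]-> _ _.
  + by exists l2, l1.
  + by exists c, o1; split=> //; [exact: sBA|rewrite edgeC].
  + by exists c, o2; split=> //; [exact: sBA|rewrite edgeC].
  + by exists c, o3; split=> //; [exact: sBA|rewrite edgeC].
- move=> u uB _ gt1; have [[s sS us]|no] := classic (exists2 s, s \in S & edge u s); last first.
    left; rewrite -(@nb_off _ A S) => [|s sS _ us]; last by apply: no; exists s.
    split=> //; rewrite inE; apply/eqP => E; apply: no; exists l3; first by rewrite mS eqxx !orbT.
    by rewrite E edgeC.
  have uA := sBA _ uB; have [a0 a1 a2 a3] := nS _ uB.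
  have uo : u \in [:: o1; o2; o3].
    rewrite edgeC in us; case: (SP _ sS) us => -> us.
    - by case: (Nc _ uA us) => E; move: a1 a2 a3; rewrite E eqxx.
    - by case: (N1 _ uA us) => E; [move: a0; rewrite E eqxx|rewrite !inE E eqxx].
    - by case: (N2 _ uA us) => E; [move: a0; rewrite E eqxx|rewrite !inE E eqxx orbT].
    - by case: (N3 _ uA us) => E; [move: a0; rewrite E eqxx|rewrite !inE E eqxx !orbT].
  case: (Hout u uo) => [[n2 /eqP nu]|[E [x xB ux]]|[h1 h2]].
  + by left; rewrite inE.
  + right; have [_ ue] := some_nbP xB ux; rewrite E -/e in ue *.
    by exists l3, e; split=> //; [exact: sBA|rewrite edgeC].
  + by right; exists l2, l1.
- move=> X v pf XA cX /SP; have inA := subsetP XA.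
  have x1 : l1 \notin X by apply: (deg2_notin (a := c) (b := o1) pf XA cX) => // u /inA; apply: N1.
  have x2 : l2 \notin X by apply: (deg2_notin (a := c) (b := o2) pf XA cX) => // u /inA; apply: N2.
  have x3 : l3 \notin X by apply: (deg2_notin (a := c) (b := o3) pf XA cX) => // u /inA; apply: N3.
  case=> -> //; apply/negP => xc; case: (core_pair pf XA cX xc) => u [w [uX _ _ cu _]].
  by case: (Nc _ (inA _ uX) cu) => E; move: uX; rewrite E ?(negbTE x1) ?(negbTE x2) ?(negbTE x3).
Qed.
End PathColoring.

(** * How a remaining 5-cycle meets the outer neighbours *)

Definition ispath2 (G : sgraph) (A : {set G}) (k : nat) (p : nat -> G) : Prop :=
  [/\ 2 <= k, forall i, i < k -> p i \in A, forall i j, i < j -> j < k -> p i <> p j,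
      forall i, i.+1 < k -> edge (p i) (p i.+1) &
      #|nb A (p 0)| = 2 /\ #|nb A (p k.-1)| = 2].

(** [P] is a vertex cover of the 5-cycle. The omitted vertices are pairwise non-adjacent, hence at
    most two, and what they leave contains an edge with its opposite vertex. *)
Lemma cover3 (P : nat -> Prop) : (forall i, P (i + 5) <-> P i) ->
  (forall i, P i \/ P i.+1) -> exists i, [/\ P i, P (i + 1) & P (i + 3)].
Proof.
move=> per H; have [H0 H1 H2 H3 H4] : [/\ P 0 \/ P 1, P 1 \/ P 2, P 2 \/ P 3, P 3 \/ P 4 & P 4 \/ P 5] by split; apply: H.
have := per 0; have := per 1; have := per 2; rewrite /= => p2 p1 p0.
have ex i : P i -> P (i + 1) -> P (i + 3) -> exists i, [/\ P i, P (i + 1) & P (i + 3)] by exists i.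
have := ex 0; have := ex 1; have := ex 2; have := ex 3; have := ex 4 => /=.
tauto.
Qed.

(** The two conditions together cover all edges of K_5, so at most one index modulo 5 is omitted. *)
Lemma cover4 (P : nat -> Prop) : (forall i, P (i + 5) <-> P i) ->
  (forall i, P i \/ P i.+1) -> (forall i, P i \/ P i.+2) ->
  exists i, [/\ P i, P (i + 1), P (i + 2) & P (i + 3)].
Proof.
move=> per H H'; have [[i ni]|all] := classic (exists i, ~ P i).
  exists i.+1.
  have [/ni//|h1] := H i; have [/ni//|h2] := H' i.
  have h3 : P i.+3 by have [//|] := H' i.+3; rewrite -[i.+4.+1]/(5 + i) addnC per.
  have h4 : P i.+4 by have [//|] := H i.+4; rewrite -[i.+4.+1]/(5 + i) addnC per.
  by rewrite !addSn addn1 addn2 addn3.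
have Pi i : P i by apply: NNPP => ni; apply: all; exists i.
by exists 0.
Qed.

Section Sparse.
Variables (G : sgraph) (C : choiceType) (L : G -> {fset C}) (A : {set G}).
Hypothesis noadj : forall u v, u \in A -> v \in A -> edge u v ->
  #|nb A u| = 2 -> #|nb A v| = 2 -> False.

(* A closed 5-cycle of the graph minus [S] has few vertices of degree two, hence many
   neighbours in [S]. *)
Section Attached.
Variables (S : {set G}) (d : nat -> G) (os : seq G).
Hypothesis dC : C5in (A :\: S) d.
Hypothesis osP : forall u s, u \in A :\: S -> s \in S -> s \in A -> edge u s -> u \in os.

Lemma C5in_inA i : d i \in A.
Proof. by case: dC => /(_ i); rewrite inE => /andP[]. Qed.

Lemma C5_off_deg2 i : d i \notin os -> #|nb A (d i)| = 2.
Proof.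
move=> dos; rewrite (@nb_off _ _ S) ?(C5in_card dC) // => s sS sA ds.
by move: dos; rewrite (osP _ sS sA ds) //; case: dC.
Qed.

Lemma C5_per_in i : d (i + 5) \in os <-> d i \in os.
Proof. by case: dC => _ [-> _]. Qed.

Lemma C5_in_adj i : d i \in os \/ d i.+1 \in os.
Proof.
case: (boolP (d i \in os)); [by left|move=> n1].
case: (boolP (d i.+1 \in os)); [by right|move=> n2].
by case: (noadj (C5in_inA i) (C5in_inA i.+1) (C5in_edge dC i) (C5_off_deg2 n1) (C5_off_deg2 n2)).
Qed.

Lemma C5_uniq_map i (s : seq nat) : uniq s -> all (fun j => j < 5) s -> uniq [seq d (i + j) | j <- s].
Proof.
move=> us /allP s5; rewrite map_inj_in_uniq // => a b /s5 la /s5 lb E.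
case: (ltngtP a b) => // lt.
  by case: (C5in_neq dC (i := i + a) (j := i + b)) => //; lia.
by case: (C5in_neq dC (i := i + b) (j := i + a)) => //; lia.
Qed.

(** The three positions given by [cover3] already use up [os]. So a remaining 5-cycle passes through
    every outer neighbour, in particular through an exempted one. *)
Lemma C5_cover3 : size os <= 3 -> {subset os <= codom (fun i : 'I_5 => d i)}.
Proof.
move=> s3; have [i [h0 h1 h3]] := cover3 (P := fun i => d i \in os) C5_per_in C5_in_adj.
have [|||_ E] := @uniq_min_size _ [seq d (i + j) | j <- [:: 0; 1; 3]] os.
- exact: C5_uniq_map.
- by move=> x; rewrite !inE => /or3P[]/eqP->; rewrite ?addn0.
- exact: s3.
move=> x; rewrite -E => /mapP[j _ ->]; rewrite -(period_mod (k := 5)); last by case: dC.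
have lt : (i + j) %% 5 < 5 by rewrite ltn_pmod.
by apply/codomP; exists (Ordinal lt).
Qed.

Hypothesis nofar : forall u v w, u \in A -> v \in A -> w \in A -> edge u v -> edge v w -> u <> w ->
  #|nb A u| = 2 -> #|nb A w| = 2 -> False.

Lemma C5_in_far i : d i \in os \/ d i.+2 \in os.
Proof.
case: (boolP (d i \in os)); [by left|move=> n1].
case: (boolP (d i.+2 \in os)); [by right|move=> n2].
case: (nofar (C5in_inA i) (C5in_inA i.+1) (C5in_inA i.+2) (C5in_edge dC i) (C5in_edge dC i.+1)) => //.
- by apply: (C5in_neq dC); lia.
- exact: C5_off_deg2.
- exact: C5_off_deg2.
Qed.

(** Vertices of degree two at distance two are excluded as well, so a remaining 5-cycle has at most
    one vertex outside [os]. *)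
Lemma C5_four : exists i, all (fun j => d (i + j) \in os) (iota 0 4).
Proof.
have [i [h0 h1 h2 h3]] := cover4 (P := fun i => d i \in os) C5_per_in C5_in_adj C5_in_far.
by exists i; rewrite /= addn0 h0 h1 h2 h3.
Qed.

Lemma C5_four_size : 3 < size os.
Proof.
have [i /allP H] := C5_four; have u4 := @C5_uniq_map i (iota 0 4) isT isT.
rewrite (leq_trans _ (uniq_leq_size u4 _)) ?size_map //.
by move=> x /mapP[j /H + ->].
Qed.

Lemma C5_cover4 : size os <= 4 -> {subset os <= codom (fun i : 'I_5 => d i)}.
Proof.
move=> s4; have [i /allP H] := C5_four; have u4 := @C5_uniq_map i (iota 0 4) isT isT.
have [||_ E] := @uniq_min_size _ [seq d (i + j) | j <- iota 0 4] os u4.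
- by move=> x /mapP[j /H + ->].
- by rewrite size_map size_iota.
move=> x; rewrite -E => /mapP[j _ ->]; rewrite -(period_mod (k := 5)); last by case: dC.
have lt : (i + j) %% 5 < 5 by rewrite ltn_pmod.
by apply/codomP; exists (Ordinal lt).
Qed.
End Attached.
End Sparse.

(** * A shortest path between vertices of degree two *)

Section MinimalPath.
Variables (G : sgraph) (C : choiceType) (L : G -> {fset C}) (A : {set G}).
Hypothesis hG : subcubic G.
Hypothesis L4 : forall v, #|` L v| = 4.
Hypothesis IH : forall B : {set G}, B \proper A -> colorable L B.
Hypothesis noB : forall d, ~ bad L A d.
Hypothesis mindeg : forall v, v \in A -> 1 < #|nb A v|.
Hypothesis noadj : forall u v, u \in A -> v \in A -> edge u v ->
  #|nb A u| = 2 -> #|nb A v| = 2 -> False.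

Lemma deg23 v : v \in A -> #|nb A v| = 2 \/ #|nb A v| = 3.
Proof. by move=> /mindeg; have := deg_le3 hG A v; lia. Qed.

Section Path.
Variables (k : nat) (p : nat -> G).
Hypothesis pP : ispath2 A k p.
Hypothesis minp : forall k' p', ispath2 A k' p' -> k <= k'.
Hypothesis minc : forall g c, iscyc A g c -> k <= g.

Local Notation S := (cset k p).
Local Notation B := (A :\: cset k p).

Lemma mp_k3 : 3 <= k.
Proof.
case: pP => k2 pA _ pe [d0 d1]; rewrite leqNgt; apply/negP => k3.
have E : k = 2 by lia.
rewrite E in d1; apply: (noadj (pA 0 _) (pA 1 _) (pe 0 _) d0 d1); lia.
Qed.

Lemma mp_inj i j : i < k -> j < k -> p i = p j -> i = j.
Proof.
case: pP => _ _ inj _ _ li lj E.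
by case: (ltngtP i j) => // lt; [case: (inj i j) | case: (inj j i)].
Qed.

(** Taking a chord instead of the stretch below it gives a shorter path with the same ends. *)
Lemma mp_chord i j : i < j -> j < k -> edge (p i) (p j) -> j = i.+1.
Proof.
move=> ij jk e; apply/eqP/negPn/negP => /eqP ne.
case: pP => k2 pA inj pe [d0 d1].
have := minp (k' := k - (j - i.+1)) (p' := fun m => if m <= i then p m else p (m + (j - i.+1))).
move=> H; suff: k <= k - (j - i.+1) by lia.
apply: H; split.
- by lia.
- by move=> m lm; case: ifP => _; apply: pA; lia.
- move=> a b ab lb; case: ifP => la; case: ifP => lb' /mp_inj; lia.
- move=> m lm; case: ifP => lm1; case: ifP => lm2.
  + by apply: pe; lia.
  + have -> : m = i by lia.
    by have -> : i.+1 + (j - i.+1) = j by lia.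
  + by lia.
  + by rewrite addSn; apply: pe; lia.
- split=> //=; rewrite ifN; last by lia.
  by have -> : (k - (j - i.+1)).-1 + (j - i.+1) = k.-1 by lia.
Qed.

Lemma mp_S_nb i j : i < k -> j < k -> edge (p i) (p j) -> i = j.+1 \/ j = i.+1.
Proof.
move=> li lj e; case: (ltngtP i j) => lt.
- by right; apply: mp_chord.
- by left; apply: mp_chord => //; rewrite edgeC.
- by move: e; rewrite lt edge_irrefl.
Qed.

Lemma mp_interior i : 0 < i -> i.+1 < k -> #|nb A (p i)| = 3.
Proof.
move=> i0 ik; case: pP => k2 pA inj pe [d0 d1].
case: (deg23 (pA i _)) => // [|d2]; first by lia.
have := minp (k' := i.+1) (p' := p); move=> H; suff: k <= i.+1 by lia.
apply: H; split=> //.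
- by move=> m lm; apply: pA; lia.
- by move=> a b ab lb; apply: inj; lia.
- by move=> m lm; apply: pe; lia.
Qed.

(** Minimality leaves each path vertex exactly one neighbour off the path, as [mp_oP] and [mp_N]
    show; the default value is never reached on the path. *)
Let o i : G := odflt (p i) [pick u in nb A (p i) :\: S].

Lemma mp_nbS_small i : i < k -> #|nb A (p i) :&: S| < #|nb A (p i)|.
Proof.
move=> ik; case: pP => k2 pA inj pe [d0 d1]; have k3 := mp_k3.
have sub : nb A (p i) :&: S \subset [set p i.-1; p i.+1].
  apply/subsetP=> u; rewrite in_setI in_nb => /andP[/andP[_ e] /csetP[j jk Ej]].
  rewrite Ej in e *; rewrite !inE; case: (mp_S_nb ik jk e) => E; rewrite E /= eqxx ?orbT //.
case: (posnP i) => [i0|i0].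
  rewrite i0 d0; apply: leq_ltn_trans (_ : #|[set p 1]| < _); last by rewrite cards1.
  apply/subset_leq_card/subsetP=> u; rewrite in_setI in_nb => /andP[/andP[_ e] /csetP[j jk Ej]].
  rewrite i0 in ik e; rewrite Ej in e *; rewrite inE.
  by case: (mp_S_nb ik jk e) => [//|->].
case: (ltnP i.+1 k) => ik1.
  rewrite mp_interior //; apply: leq_ltn_trans (subset_leq_card sub) _.
  by rewrite cards2; case: eqP.
have Ei : i = k.-1 by lia.
rewrite Ei d1; apply: leq_ltn_trans (_ : #|[set p k.-2]| < _); last by rewrite cards1.
apply/subset_leq_card/subsetP=> u; rewrite in_setI in_nb => /andP[/andP[_ e] /csetP[j jk Ej]].
have lk : k.-1 < k by lia.
rewrite Ej in e *; rewrite inE; case: (mp_S_nb lk jk e) => E; last by lia.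
by have -> : k.-2 = j by lia.
Qed.

Lemma mp_oP i : i < k -> o i \in B /\ edge (p i) (o i).
Proof.
move=> ik; rewrite /o; case: pickP => [u|no] /=.
  by rewrite in_setD in_nb => /and3P[uS uA e]; rewrite inE uS uA.
have := mp_nbS_small ik; rewrite ltnNge => /negP[]; apply/subset_leq_card/subsetP=> u un.
by rewrite in_setI un /=; have := no u; rewrite in_setD un andbT => /negbFE.
Qed.

Lemma mp_N i u : i < k -> u \in A -> edge (p i) u ->
  [\/ u = o i, 0 < i /\ u = p i.-1 | i.+1 < k /\ u = p i.+1].
Proof.
move=> ik uA e; case: pP => k2 pA inj pe [d0 d1]; have k3 := mp_k3.
case: (boolP (u \in S)) => uS.
  case/csetP: uS e => j jk -> e; case: (mp_S_nb ik jk e) => E; first by constructor 2; rewrite E.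
  by constructor 3; rewrite -E.
constructor 1; have [oB eo] := mp_oP ik; move: (oB); rewrite inE => /andP[oS oA].
have nS j x : j < k -> x \notin S -> p j <> x by move=> jk xS E; move: xS; rewrite -E; apply/negP; rewrite negbK; apply/csetP; exists j.
case: (posnP i) => [i0|i0].
  rewrite i0 in e eo oS oA *; case: (@nb_le2 _ A (p 0) (p 1) (o 0) u) => //; rewrite ?d0 //.
  - by apply: pA; lia.
  - by apply: pe; lia.
  - by apply: nS => //; lia.
  - by move/esym/(nS 1); case=> //; lia.
have em : edge (p i) (p i.-1) by rewrite edgeC; have := @pe i.-1; rewrite prednK //; apply.
have mA : p i.-1 \in A by apply: pA; lia.
case: (ltnP i.+1 k) => ik1.
  case: (@nb_le3 _ A (p i) (p i.-1) (p i.+1) (o i) u) => //; rewrite ?mp_interior //.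
  - exact: pA.
  - exact: pe.
  - by move/mp_inj; lia.
  - by apply: nS => //; lia.
  - exact: nS.
  - by move/esym/nS; case=> //; lia.
  - by move/esym/nS; case.
have Ei : i = k.-1 by lia.
have dk : #|nb A (p i)| <= 2 by rewrite Ei d1.
have mk : i.-1 < k by apply: leq_ltn_trans (leq_pred _) ik.
case: (@nb_le2 _ A (p i) (p i.-1) (o i) u) => //; first exact: nS.
by move/esym/nS; case.
Qed.

(** A detour through [u] must not shorten the path, so [j <= i + 2]. The cycle through [u] has at
    least [k] vertices, because no cycle is shorter than the path. *)
Lemma mp_sharing u i j : u \in B -> i < j -> j < k -> edge u (p i) -> edge u (p j) ->
  (j = i.+1 \/ j = i.+2) /\ k <= j - i + 2.
Proof.
move=> uB ij jk ei ej; case: pP => k2 pA inj pe [d0 d1].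
move: (uB); rewrite inE => /andP[uS uA].
have nS m : m < k -> u <> p m by move=> mk E; move: uS; rewrite E; apply/negP; rewrite negbK; apply/csetP; exists m.
split.
  suff: k <= k - (j - i) + 2 by lia.
  apply: (minp (p' := fun m => if m <= i then p m else if m == i.+1 then u else p (m + (j - i) - 2))).
  split.
  - by lia.
  - move=> m lm; case: (leqP m i) => h1; first by apply: pA; lia.
    by case: (m =P i.+1) => // h2; apply: pA; lia.
  - move=> a b ab lb; case: (leqP a i) => h1; case: (leqP b i) => h2; try lia.
    + by apply: inj; lia.
    + by case: (b =P i.+1) => h3; [move/esym; apply: nS; lia|move/mp_inj; lia].
    + case: (a =P i.+1) => h3; case: (b =P i.+1) => h4; try lia.
      * by apply: nS; lia.
      * by move/mp_inj; lia.
  - move=> m lm; case: (leqP m i) => h1; case: (leqP m.+1 i) => h2; try lia.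
    + by apply: pe; lia.
    + have Em : m = i by lia.
      by rewrite Em eqxx edgeC.
    + case: (m =P i.+1) => h3; case: (m.+1 =P i.+1) => h4; try lia.
      * by have -> : m.+1 + (j - i) - 2 = j by lia.
      * have -> : m.+1 + (j - i) - 2 = (m + (j - i) - 2).+1 by lia.
        by apply: pe; lia.
  - split=> //; rewrite ifN; last by lia.
    case: ifP => h; first by exfalso; lia.
    by have -> : (k - (j - i) + 2).-1 + (j - i) - 2 = k.-1 by lia.
pose q n := if n is n'.+1 then p (i + n') else u.
apply: (minc (c := fun m => q (m %% (j - i + 2)))); apply: mkcyc; rewrite /q.
- by lia.
- by case=> [|m] lm //; apply: pA; lia.
- move=> [|a] [|b] // ab lb; first by apply: nS; lia.
  by move/mp_inj; lia.
- by move=> [|m] lm; [rewrite addn0|rewrite addnS; apply: pe; lia].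
- have -> : (j - i + 2).-1 = (j - i).+1 by lia.
  have -> : i + (j - i) = j by lia.
  by rewrite edgeC.
Qed.

(** Going from [u] along the path to either end joins two vertices of degree two. Both routes have
    at least [k] vertices only in the middle of a three-vertex path. *)
Lemma mp_outer_deg2 u i : u \in B -> i < k -> edge u (p i) -> #|nb A u| = 2 -> k = 3 /\ i = 1.
Proof.
move=> uB ik ei d2; case: pP => k2 pA inj pe [d0 d1]; have k3 := mp_k3.
move: (uB); rewrite inE => /andP[uS uA].
have nS m : m < k -> u <> p m by move=> mk E; move: uS; rewrite E; apply/negP; rewrite negbK; apply/csetP; exists m.
have h1 : k <= i.+2.
  apply: (minp (p' := fun m => if m <= i then p m else u)); split.
  - by [].
  - by move=> m lm; case: ifP => // h; apply: pA; lia.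
  - move=> a b ab lb; case: (leqP a i) => h1; case: (leqP b i) => h2; try lia; first by apply: inj; lia.
    by move/esym; apply: nS; lia.
  - move=> m lm; case: (leqP m i) => h1; case: (leqP m.+1 i) => h2; try lia; first by apply: pe; lia.
    have -> : m = i by lia.
    by rewrite edgeC.
  - by split=> //=; rewrite ltnn.
have h2 : k <= (k - i).+1.
  apply: (minp (p' := fun m => if m is m'.+1 then p (i + m') else u)); split.
  - by lia.
  - by case=> [|m] lm //; apply: pA; lia.
  - move=> [|a] [|b] // ab lb; first by apply: nS; lia.
    by move/mp_inj; lia.
  - by move=> [|m] lm; [rewrite addn0|rewrite addnS; apply: pe; lia].
  - split=> //=; have -> : k - i = (k - i.+1).+1 by lia.
    by have -> : i + (k - i.+1) = k.-1 by lia.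
lia.
Qed.

(** The first hypothesis excludes the star, so every outer neighbour has degree three. By
    [mp_sharing], one that sees two path vertices sees consecutive ones, or [p 0] and [p 2], or is
    [o 3] with [k = 4]; these are the cases that [color_path] accepts. *)
Lemma color_mp_aux :
  (forall u, u \in B -> edge u (p 1) -> k = 3 -> #|nb A u| = 3) ->
  (forall d, bad L B d -> exists i, edge (d i) (p k.-1)) ->
  exists f, good L set0 A f.
Proof.
move=> nostar Hbad; case: (pP) => k2 pA inj pe [d0 d1]; have k3 := mp_k3.
have lk : k.-1 < k by lia.
have oN i u : i < k -> u \in B -> edge u (p i) -> u = o i.
  move=> ik; rewrite inE edgeC => /andP[uS uA] e; case: (mp_N ik uA e) => // -[h E]; case/negP: uS; apply/csetP.
    by exists i.-1 => //; lia.
  by exists i.+1.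
have deg3 u i : u \in B -> i < k -> edge u (p i) -> #|nb A u| = 3.
  move=> uB ik e; have uA : u \in A by move: uB; rewrite inE => /andP[].
  case: (deg23 uA) => // d2; have [E3 E1] := mp_outer_deg2 uB ik e d2.
  by rewrite E1 in e; apply: nostar.
apply: (@color_path _ _ _ _ L4 IH k p o) => //.
- by move=> i ik; case: (mp_oP ik).
- by move=> i ik; case: (mp_oP ik).
- by move=> i u ik uA; apply: mp_N.
- move=> d bd; have [i e] := Hbad d bd; exists i; apply: oN => //.
  by case: bd => [[/(_ i)]].
- move=> u i uB ik e; have d3 := deg3 u i uB ik e.
  have uA : u \in A by move: uB; rewrite inE => /andP[].
  have [c3|nc3] := classic (exists j, [/\ j.+1 < k, edge u (p j) & edge u (p j.+1)]); first by constructor 3.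
  have [c4|nc4] := classic (edge u (p 0) /\ edge u (p 2)); first by constructor 4.
  have two j : j < k -> j <> i -> edge u (p j) -> k = 4 /\ edge u (p 3).
    move=> jk ji ej.
    have H a b : a < b -> b < k -> edge u (p a) -> edge u (p b) -> k = 4 /\ edge u (p 3).
      move=> ab bk ea eb; have [[E|E] le] := mp_sharing uB ab bk ea eb.
        by case: nc3; exists a; rewrite -E.
      case: (posnP a) => [a0|a0]; first by case: nc4; rewrite a0 in ea E; rewrite -E.
      have [Ea Ek] : a = 1 /\ k = 4 by lia.
      by rewrite E Ea in eb.
    by case: (ltngtP i j) => lt; [apply: (H i j)|apply: (H j i)|case: ji].
  have [ou|nou] := classic (u = o k.-1).
    constructor 2; split=> //.
    have eu : edge u (p k.-1) by rewrite ou edgeC; case: (mp_oP lk).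
    apply: NNPP => noX.
    have inS x : x \in A -> edge u x -> x <> p k.-1 -> x = p 1 /\ k = 4.
      move=> xA ux xk; case: (boolP (x \in S)) => [/csetP[j jk Ex]|xS]; last first.
        by case: noX; exists x => //; rewrite inE xS.
      have jk1 : j < k.-1 by case: (ltngtP j k.-1) => // [|E]; [lia|case: xk; rewrite Ex E].
      rewrite Ex in ux *; have [[E|E] le] := mp_sharing uB jk1 lk ux eu.
        by case: nc3; exists j; rewrite -E.
      case: (posnP j) => [j0|j0]; first by case: nc4; rewrite j0 in ux E; rewrite -E.
      by have [-> ->] : j = 1 /\ k = 4 by lia.
    have [x [xA ux xk]] : exists x, [/\ x \in A, edge u x & x <> p k.-1] by apply: nb_other; rewrite d3.
    have le1 : #|nb A u| <= 2.
      apply: leq_trans (_ : #|[set p k.-1; p 1]| <= 2); last by rewrite cards2; case: eqP.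
      apply/subset_leq_card/subsetP=> y; rewrite in_nb => /andP[yA uy].
      have [->|/eqP yk] := eqVneq y (p k.-1); first by rewrite !inE eqxx.
      by have [-> _] := inS y yA uy yk; rewrite !inE eqxx orbT.
    by rewrite d3 in le1.
  constructor 1; split=> //; rewrite -ltnS -d3; apply: (nb_rem (c := p i)) => x xA ux.
  case: (boolP (x \in S)) => [/csetP[j jk Ex]|xS]; last by right; rewrite inE xS.
  have [E|/eqP ji] := eqVneq j i; first by left; rewrite Ex E.
  rewrite Ex in ux; have [E4 e3] := two j jk ji ux; case: nou; apply: oN => //.
  by rewrite E4.
Qed.
End Path.
End MinimalPath.

Lemma iscycS (G : sgraph) (A B : {set G}) k c : B \subset A -> iscyc B k c -> iscyc A k c.
Proof. by move=> /subsetP sBA [k3 cB per e]; split=> // i; apply/sBA/cB. Qed.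

(** Walking along [d'] never leaves the component [d]. *)
Lemma C5in_shared (G : sgraph) (B : {set G}) d d' a b c : C5in B d -> C5in B d' ->
  d' a = d b -> exists x, d' c = d x.
Proof.
move=> dC dC' E; case: (dC') => dB' per _.
have H m : exists x, d' (a + m) = d x.
  elim: m => [|m [x Ex]]; first by exists b; rewrite addn0.
  by apply: (C5in_closed dC (i := x)); rewrite -?Ex // addnS; apply: (C5in_edge dC').
rewrite -(periodM per c a); have -> : c + a * 5 = a + (c + a * 4) by lia.
exact: H.
Qed.

Lemma ispath2_three (G : sgraph) (A : {set G}) u v w : u \in A -> v \in A -> w \in A ->
  edge u v -> edge v w -> u <> w -> #|nb A u| = 2 -> #|nb A w| = 2 ->
  ispath2 A 3 (fun i => nth u [:: u; v; w] i).
Proof.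
move=> uA vA wA uv vw uw du dw; split=> //.
- by case=> [|[|[|]]].
- move=> [|[|[|i]]] [|[|[|j]]] //= _ _; [exact: edge_neq uv|exact: edge_neq vw].
- by case=> [|[|]].
Qed.

Section MinimalPath.
Variables (G : sgraph) (C : choiceType) (L : G -> {fset C}) (A : {set G}).
Hypothesis hG : subcubic G.
Hypothesis L4 : forall v, #|` L v| = 4.
Hypothesis IH : forall B : {set G}, B \proper A -> colorable L B.
Hypothesis noB : forall d, ~ bad L A d.
Hypothesis mindeg : forall v, v \in A -> 1 < #|nb A v|.
Hypothesis noadj : forall u v, u \in A -> v \in A -> edge u v ->
  #|nb A u| = 2 -> #|nb A v| = 2 -> False.

(** Needed when the shortest path has three vertices and its middle one has a third neighbour of
    degree two. There are at most three outer neighbours, so by [C5_cover3] a remaining 5-cycle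
    passes through the exempted [o3]. *)
Lemma color_star_deg2 c l1 l2 l3 : uniq [:: c; l1; l2; l3] ->
  {subset [:: c; l1; l2; l3] <= A} -> [/\ edge c l1, edge c l2 & edge c l3] ->
  [/\ #|nb A l1| = 2, #|nb A l2| = 2 & #|nb A l3| = 2] -> exists f, good L set0 A f.
Proof.
move=> un sA [e1 e2 e3] [d1 d2 d3].
have [cA l1A l2A l3A] : [/\ c \in A, l1 \in A, l2 \in A & l3 \in A].
  by split; apply: sA; rewrite !inE eqxx ?orbT.
have [o1 [o1A eo1 o1c N1]] := deg2_other d1 cA (etrans (edgeC _ _) e1).
have [o2 [o2A eo2 o2c N2]] := deg2_other d2 cA (etrans (edgeC _ _) e2).
have [o3 [o3A eo3 o3c N3]] := deg2_other d3 cA (etrans (edgeC _ _) e3).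
pose S := [set x in [:: c; l1; l2; l3]].
have mS x : (x \in S) = [|| x == c, x == l1, x == l2 | x == l3] by rewrite in_set !inE.
have inB l o : l \in A -> #|nb A l| = 2 -> o \in A -> edge l o -> o <> c ->
  o \in A :\: S /\ #|nb A o| = 3.
  move=> lA dl oA eo oc; have no2 : #|nb A o| <> 2 by move=> H; apply: (noadj lA oA).
  have d3o : #|nb A o| = 3 by case: (deg23 hG mindeg oA).
  by split=> //; rewrite inE oA andbT mS; apply/negP => /or4P[]/eqP E //; apply: no2; rewrite E.
have [o1B do1] := inB l1 o1 l1A d1 o1A eo1 o1c.
have [o2B do2] := inB l2 o2 l2A d2 o2A eo2 o2c.
have [o3B do3] := inB l3 o3 l3A d3 o3A eo3 o3c.
move: (un); rewrite /= !inE !negb_or !andbT => /and3P[/and3P[/eqP u01 /eqP u02 /eqP u03] /andP[/eqP u12 /eqP u13] /eqP u23].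
have Nc u : u \in A -> edge c u -> [\/ u = l1, u = l2 | u = l3].
  by move=> uA cu; apply: (nb_le3 (deg_le3 hG A c)).
have att u s : u \in A :\: S -> s \in S -> edge s u ->
  [\/ s = l1 /\ u = o1, s = l2 /\ u = o2 | s = l3 /\ u = o3].
  rewrite inE mS !negb_or => /andP[/and4P[/eqP a0 /eqP a1 /eqP a2 /eqP a3] uA].
  rewrite mS => /or4P[]/eqP-> su.
  - by case: (Nc u uA su).
  - by case: (N1 u uA su) => // ->; constructor 1.
  - by case: (N2 u uA su) => // ->; constructor 2.
  - by case: (N3 u uA su) => // ->; constructor 3.
apply: (@color_star _ _ _ _ L4 IH c l1 l2 l3 o1 o2 o3) => //.
- by move=> u; rewrite !in_cons orbF => /or3P[]/eqP->.
- move=> d [dC _].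
  have cov : {subset [:: o1; o2; o3] <= codom (fun i : 'I_5 => d i)}.
    apply: (C5_cover3 noadj dC) => // u s uB sS _ us; rewrite edgeC in us.
    by case: (att u s uB sS us) => -[_ ->]; rewrite !inE eqxx ?orbT.
  have /cov/codomP[i ->] : o3 \in [:: o1; o2; o3] by rewrite !inE eqxx !orbT.
  by exists i.
- move=> u uo.
  have uB : u \in A :\: S by move: uo; rewrite !in_cons orbF => /or3P[]/eqP->.
  have du : #|nb A u| = 3 by move: uo; rewrite !inE => /or3P[]/eqP->.
  have [[h1 h2]|nh] := classic (edge u l1 /\ edge u l2); first by constructor 3.
  have [E|n3] := classic (u = o3).
    constructor 2; split=> //; apply: NNPP => noX.
    suff : #|nb A u| <= 2 by rewrite du.
    have inS x : x \in A -> edge u x -> x = l3 \/ (x = l1 \/ x = l2).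
      move=> xA ux; case: (boolP (x \in S)) => xS; last by case: noX; exists x => //; rewrite in_setD xS.
      by rewrite edgeC in ux; case: (att u x uB xS ux) => -[-> _]; auto.
    have [x Hx] : exists x, forall y, y \in A -> edge u y -> y = l3 \/ y = x.
      have [h1|h1] := classic (edge u l1).
        exists l1 => y yA uy; case: (inS y yA uy) => [|[|Ey]]; auto.
        by case: nh; rewrite Ey in uy.
      exists l2 => y yA uy; case: (inS y yA uy) => [|[Ey|]]; auto.
      by rewrite Ey in uy.
    apply: leq_trans (_ : #|[set l3; x]| <= 2); last by rewrite cards2; case: eqP.
    by apply/subset_leq_card/subsetP=> y; rewrite in_nb => /andP[yA /(Hx y yA)[]->]; rewrite !inE eqxx ?orbT.
  constructor 1; split=> //; rewrite -ltnS -du.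
  have [h1|h1] := classic (edge u l1).
    apply: (nb_rem (c := l1)) => x xA ux; case: (boolP (x \in S)) => xS; last by right; rewrite in_setD xS.
    move: (ux); rewrite edgeC => xu; case: (att u x uB xS xu) => -[Ex Eu //]; first by left.
    by case: nh; rewrite Ex in ux.
  apply: (nb_rem (c := l2)) => x xA ux; case: (boolP (x \in S)) => xS; last by right; rewrite in_setD xS.
  move: (ux); rewrite edgeC => xu; case: (att u x uB xS xu) => -[Ex Eu //]; last by left.
  by rewrite Ex in ux.
Qed.

Lemma color_min_path k p : ispath2 A k p ->
  (forall k' p', ispath2 A k' p' -> k <= k') -> (forall g c, iscyc A g c -> k <= g) ->
  exists f, good L set0 A f.
Proof.
move=> pP minp minc; case: (pP) => k2 pA inj pe [d0 d1].
have k3 := mp_k3 noadj pP.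
have [[u [uB eu E3 du]]|nostar] := classic (exists u, [/\ u \in A :\: cset k p, edge u (p 1), k = 3 & #|nb A u| = 2]).
  have uS i : i < k -> u <> p i.
    by move=> ik E; move: uB; rewrite inE E => /andP[/negP H _]; apply: H; apply/csetP; exists i.
  apply: (@color_star_deg2 (p 1) (p 0) (p 2) u).
  - rewrite /= !inE !negb_or !andbT.
    have H i j : i < j -> j < 3 -> (p i != p j) && (p j != p i).
      by move=> ij j3; rewrite eq_sym andbb; apply/eqP => E; apply: (inj i j) => //; rewrite E3.
    have H' i : i < 3 -> p i != u by move=> i3; apply/eqP => E; apply: (uS i); rewrite // E3.
    case/andP: (H 0 1 isT isT) => _ ->; case/andP: (H 0 2 isT isT) => -> _.
    by case/andP: (H 1 2 isT isT) => -> _; rewrite !H'.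
  - move=> x; rewrite !inE => /or4P[]/eqP->; try by apply: pA; rewrite E3.
    by move: uB; rewrite inE => /andP[].
  - by split; [rewrite edgeC; apply: pe; rewrite E3|apply: pe; rewrite E3|rewrite edgeC].
  - by rewrite E3 in d1.
have nostar' u : u \in A :\: cset k p -> edge u (p 1) -> k = 3 -> #|nb A u| = 3.
  move=> uB eu E; have uA : u \in A by move: uB; rewrite inE => /andP[].
  by case: (deg23 hG mindeg uA) => // d2; case: nostar; exists u.
pose o i := odflt (p i) [pick u in nb A (p i) :\: cset k p].
have oP i : i < k -> o i \in A :\: cset k p /\ edge (p i) (o i).
  by move=> ik; apply: (mp_oP hG mindeg noadj pP minp).
have oN i u : i < k -> u \in A :\: cset k p -> edge u (p i) -> u = o i.
  move=> ik; rewrite inE edgeC => /andP[uS uA] e.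
  case: (mp_N hG mindeg noadj pP minp ik uA e) => // -[h E]; case/negP: uS; apply/csetP.
    by exists i.-1 => //; lia.
  by exists i.+1.
pose os := [seq o i | i <- iota 0 k].
have osP u s : u \in A :\: cset k p -> s \in cset k p -> s \in A -> edge u s -> u \in os.
  move=> uB /csetP[i ik ->] _ e; rewrite (oN i u ik uB e); apply/mapP; exists i => //.
  by rewrite mem_iota.
have szos : size os = k by rewrite size_map size_iota.
have lk : k.-1 < k by lia.
have nofar : 3 < k -> forall u v w, u \in A -> v \in A -> w \in A -> edge u v -> edge v w -> u <> w ->
  #|nb A u| = 2 -> #|nb A w| = 2 -> False.
  move=> k4 u v w uA vA wA uv vw uw du dw.
  by have := minp _ _ (ispath2_three uA vA wA uv vw uw du dw); lia.
have olast : o k.-1 \in os by apply/mapP; exists k.-1 => //; rewrite mem_iota.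
have eo i j : j < k -> forall d : nat -> G, d i = o j -> edge (d i) (p j).
  by move=> jk d ->; rewrite edgeC; case: (oP j jk).
have k5 d : bad L (A :\: cset k p) d -> k <= 5.
  by case=> dC _; apply: (minc 5 d); apply: iscycS (C5in_cyc dC); apply: subsetDl.
have [Hbad|nHbad] := classic (forall d, bad L (A :\: cset k p) d -> exists i, edge (d i) (p k.-1)).
  exact: (color_mp_aux hG L4 IH mindeg noadj pP minp minc nostar' Hbad).
have [d nd] := not_all_ex_not _ _ nHbad; have {nd} [bd nod] := imply_to_and _ _ nd.
have k_le5 := k5 _ bd; case: (bd) => dC _.
have notlast i : d i <> o k.-1 by move=> E; apply: nod; exists i; apply: eo.
(* A remaining 5-cycle is a cycle of [A], so [k <= 5]; for [k] equal to 3 or 4 the covering lemmas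
   would put [o k.-1] on it. *)
have E5 : k = 5.
  case: (ltnP 4 k) => [|k4]; first by lia.
  have [E|E] : k = 3 \/ k = 4 by lia.
    have := C5_cover3 noadj dC osP; rewrite szos E => /(_ isT (o k.-1) olast)/codomP[i] Ei.
    by case: (notlast i); rewrite Ei.
  have := C5_cover4 noadj dC osP (nofar _); rewrite szos E => /(_ isT isT (o k.-1) olast)/codomP[i] Ei.
  by case: (notlast i); rewrite Ei.
have k4 : 3 < k by rewrite E5.
have os5 : os = [:: o 0; o 1; o 2; o 3; o 4] by rewrite /os E5.
(* every closed 5-cycle sees four of the five path vertices: those seeing all but the
   last one force us to traverse the path backwards *)
have inD i : i < 4 -> exists x, o i = d x.
  move=> i4; have [a /allP H] := C5_four noadj dC osP (nofar k4).
  have [|||_ E] := @uniq_min_size _ [seq d (a + j) | j <- iota 0 4] [:: o 0; o 1; o 2; o 3].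
  - exact: (C5_uniq_map dC).
  - move=> x /mapP[j /H + ->]; rewrite os5 !inE => /or4P[->|->|->|/orP[->|/eqP E]]; rewrite ?orbT //.
    by case: (notlast (a + j)); rewrite E E5.
  - by rewrite size_map size_iota.
  have : o i \in [:: o 0; o 1; o 2; o 3] by case: i i4 => [|[|[|[|]]]] //; rewrite !inE eqxx ?orbT.
  by rewrite -E => /mapP[j _ ->]; eexists.
pose p' i := p (k.-1 - i).
have S' : cset k p' = cset k p.
  apply/setP=> v; apply/csetP/csetP => -[i ik ->]; exists (k.-1 - i); try lia; rewrite /p' //.
  by have -> : k.-1 - (k.-1 - i) = i by lia.
have pP' : ispath2 A k p'.
  split=> //; rewrite /p'.
  - by move=> i ik; apply: pA; lia.
  - by move=> i j ij jk E; apply: (inj (k.-1 - j) (k.-1 - i)) => //; lia.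
  - move=> i ik; rewrite edgeC; have -> : k.-1 - i = (k.-1 - i.+1).+1 by lia.
    by apply: pe; lia.
  - by rewrite subn0 subnn.
apply: (color_mp_aux hG L4 IH mindeg noadj pP' minp minc); rewrite S'; first by rewrite E5.
move=> d' bd'; case: (bd') => dC' _; rewrite /p' subnn.
have [[x Ex]|no0] := classic (exists x, o 0 = d' x); first by exists x; apply: eo => //; lia.
(* Otherwise [d'] contains [o 1] to [o 4]. Sharing [o 1] with [d], it lies on [d], which misses
   [o 4]. *)
have [a' /allP H] := C5_four noadj dC' osP (nofar k4).
have [|||_ E] := @uniq_min_size _ [seq d' (a' + j) | j <- iota 0 4] [:: o 1; o 2; o 3; o 4].
- exact: (C5_uniq_map dC').
- move=> x /mapP[j /H + ->]; rewrite os5 inE => /orP[/eqP Ej|//].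
  by case: no0; exists (a' + j).
- by rewrite size_map size_iota.
have /mapP[j1 _ E1] : o 1 \in [seq d' (a' + j) | j <- iota 0 4] by rewrite E !inE eqxx.
have /mapP[j4 _ E4] : o 4 \in [seq d' (a' + j) | j <- iota 0 4] by rewrite E !inE eqxx !orbT.
have [x1 Ex1] := inD 1 isT.
have [x Ex] := C5in_shared (a' + j4) dC dC' (etrans (esym E1) Ex1).
by case: (notlast x); rewrite -Ex -E4 E5.
Qed.
End MinimalPath.

(** * Cycles all of whose vertices have an outer neighbour *)

Section SolidCycle.
Variables (G : sgraph) (C : choiceType) (L : G -> {fset C}) (A : {set G}).
Hypothesis hG : subcubic G.
Hypothesis L4 : forall v, #|` L v| = 4.

(** The map [oo] is indexed by vertices, not positions, so shifting or reversing the cycle does not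
    change it. The last clause lets outside vertices keep two colours, or see them on two
    consecutive cycle vertices. *)
Definition solid_cycle (k : nat) (c : nat -> G) (oo : G -> G) : Prop :=
  [/\ iscyc A k c,
      forall i, oo (c i) \in A :\: cset k c /\ edge (c i) (oo (c i)),
      forall i u, u \in A -> edge (c i.+1) u -> [\/ u = c i, u = c i.+2 | u = oo (c i.+1)] &
      forall u i, u \in A :\: cset k c -> edge u (c i) ->
        1 < #|nb (A :\: cset k c) u| \/ exists j, edge u (c j) /\ edge u (c j.+1)].

Lemma cset_shift k (c : nat -> G) m : 0 < k -> periodic k c -> cset k (fun i => c (m + i)) = cset k c.
Proof.
move=> k0 per; apply/setP=> v; apply/idP/idP => /csetP[i ik ->]; first exact: mem_cset.
rewrite -(periodM per i m) (_ : i + m * k = m + (i + m * k.-1)); last by nia.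
apply: (@mem_cset _ k (fun i => c (m + i))) => //; exact: periodic_shift.
Qed.

(** The square of [k.-1] is 1 modulo [k], so reversal is an involution. *)
Lemma rev_index k (c : nat -> G) i : 0 < k -> periodic k c -> c (k.-1 * (k.-1 * i)) = c i.
Proof.
case: k => // -[|k] _ per /=; last by rewrite -[RHS](periodM per i (k * i)); congr c; nia.
by have := periodM per 0 i; rewrite mul0n muln1 add0n.
Qed.

Lemma rev_index_prev k (c : nat -> G) i : 1 < k -> periodic k c ->
  c (k.-1 * (k.-1 * i.+1).+1) = c i.
Proof.
case: k => [|[|k]] // _ per /=.
by rewrite -[RHS](periodM per i (k * i.+1 + 1)); congr c; nia.
Qed.

Lemma cset_rev k (c : nat -> G) : 0 < k -> periodic k c -> cset k (fun i => c (k.-1 * i)) = cset k c.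
Proof.
move=> k0 per; apply/setP=> v; apply/idP/idP => /csetP[i ik ->]; first exact: mem_cset.
rewrite -(rev_index i k0 per).
apply: (@mem_cset _ k (fun i => c (k.-1 * i))) => //; exact: periodic_rev.
Qed.

Lemma solid_shift k c oo m : solid_cycle k c oo -> solid_cycle k (fun i => c (m + i)) oo.
Proof.
case=> cyc oP N H; have [k3 cA per ce] := cyc; have k0 : 0 < k by lia.
split.
- exact: iscyc_shift.
- by move=> i; rewrite cset_shift.
- by move=> i u uA; rewrite !addnS; apply: N.
- move=> u i; rewrite cset_shift // => uB e; case: (H u _ uB e) => [|[j [e1 e2]]]; first by left.
  right; exists (j + m * k.-1); rewrite addnS.
  have -> : m + (j + m * k.-1) = j + m * k by nia.
  by rewrite -addSn !(periodM per).
Qed.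

Lemma solid_rev k c oo : solid_cycle k c oo -> solid_cycle k (fun i => c (k.-1 * i)) oo.
Proof.
case=> cyc oP N H; have [k3 cA per ce] := cyc; have k0 : 0 < k by lia.
have prev i : c (k.-1 * i.+1 + 1) = c (k.-1 * i).
  by rewrite -[RHS](per.1); congr c; nia.
have [m Em] : exists m, k.-1 = m.+1 by exists k.-2; lia.
split.
- exact: iscyc_rev.
- by move=> i; rewrite cset_rev.
- move=> i u uA; have [n En] : exists n, k.-1 * i.+1 = n.+1 by exists (k.-1 * i.+1).-1; nia.
  rewrite -(prev i) En => /(N _ _ uA)[->|->|->]; [constructor 2|constructor 1|constructor 3]; rewrite ?addn1 //.
  by rewrite -[LHS](per.1); congr c; nia.
- move=> u i; rewrite cset_rev // => uB e; case: (H u _ uB e) => [|[j [e1 e2]]]; first by left.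
  right; exists (k.-1 * j.+1); rewrite rev_index //; split=> //.
  by rewrite rev_index_prev //; lia.
Qed.
End SolidCycle.

Section SolidCycle.
Variables (G : sgraph) (C : choiceType) (L : G -> {fset C}) (A : {set G}).
Hypothesis hG : subcubic G.
Hypothesis L4 : forall v, #|` L v| = 4.

(* If every cycle vertex avoids the colour of the outer neighbour of its successor, a
   two-coloured cycle through one vertex of [c] must follow [c] forever. *)
Lemma solid_good k (c : nat -> G) oo Z f : solid_cycle A k c oo ->
  good L Z (A :\: cset k c) f ->
  (forall z, z \in Z -> z \in A -> nonconst f A z) ->
  (forall i, f (c i) \in L (c i)) -> (forall i, f (c i) <> f (c i.+1)) ->
  (forall i, f (c i) <> f (oo (c i))) -> (forall i, f (c i) <> f (oo (c i.+1))) ->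
  (forall a b, exists i, f (c i) <> a /\ f (c i) <> b) ->
  good L set0 A f.
Proof.
move=> [[k3 cA per ce] oP N Hout] gf HZ fL fn fo fb f2.
have k0 : 0 < k by lia.
set S := cset k c in oP Hout gf *; set B := A :\: S in oP Hout gf *.
have SP v : v \in S -> exists i, v = c i.+1.
  case/csetP=> i ik ->; exists (i + k.-1); rewrite -addnS prednK //; by rewrite per.1.
have sBA u : u \in B -> u \in A by rewrite inE => /andP[].
apply: (extend (B := B) (S := S) (Z := Z)) => //.
- by apply/subsetP=> v /SP[i ->].
- by move=> v /SP[i ->].
- move=> v u /SP[i ->] uA /(N i u uA)[->|->|->] //; exact: nesym.
- move=> v /SP[i ->] _ _; have [oB eo] := oP i.+1.
  by exists (c i), (oo (c i.+1)); split=> //; [exact: sBA|rewrite edgeC].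
- move=> u uB _ gt1; have uA := sBA u uB.
  case: (boolP (u \in Z)) => uZ; first by right; apply: HZ.
  have [[s sS us]|no] := classic (exists2 s, s \in S & edge u s); last first.
    by left; rewrite -(@nb_off _ A S) // => s sS _ us; apply: no; exists s.
  case/SP: sS us => i -> us; case: (Hout u _ uB us) => [|[j [e1 e2]]]; first by left.
  by right; exists (c j), (c j.+1).
- move=> X v pf XA cX /SP[i ->]; apply/negP => ciX; have inA := subsetP XA.
  have step j : c j.+1 \in X -> c j.+2 \in X.
    move=> cj; case: (core_pair pf XA cX cj) => u [w [uX wX uw eu [ew fuw]]].
    have := N j u (inA _ uX) eu; have := N j w (inA _ wX) ew.
    case=> Ew; case=> Eu; rewrite ?Eu ?Ew in uX wX uw fuw *; rewrite ?uX ?wX //.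
    - by case: (fb j).
    - by case: (fb j); rewrite fuw.
  have all j : c j \in X.
    have H m : c (i.+1 + m) \in X.
      elim: m => [|m IHm]; first by rewrite addn0.
      by rewrite addnS addSn; apply: step; rewrite -addSn.
    rewrite -(periodM per j i.+1); have -> : j + i.+1 * k = i.+1 + (j + i.+1 * k.-1) by nia.
    exact: H.
  case: cX => [[a [b H]] _]; have [j [na nb]] := f2 a b.
  by case: (H _ (all j)).
Qed.

Section Break.
Variables (k : nat) (c : nat -> G) (oo : G -> G) (f : G -> C).
Hypothesis sol : solid_cycle A k c oo.
Hypothesis gf : good L set0 (A :\: cset k c) f.

(** With [g] at [c 0] and a greedy colouring onwards, the last vertex must avoid its predecessor,
    [g] and two outer colours. Two candidates [x] and [y] besides [g] make this possible and also
    provide a third colour on the cycle. *)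
Lemma solid_break g x y : g \in L (c 0) -> g <> f (oo (c 0)) -> g <> f (oo (c 1)) ->
  x \in L (c k.-1) -> y \in L (c k.-1) -> x <> y -> x <> g -> y <> g ->
  x <> f (oo (c k.-1)) -> y <> f (oo (c k.-1)) -> x <> f (oo (c 0)) -> y <> f (oo (c 0)) ->
  exists f, good L set0 A f.
Proof.
move=> gL g0 g1 xL yL xy xg yg xk yk x0 y0.
case: (sol) => [[k3 cA per ce] oP N Hout]; have k0 : 0 < k by lia.
set S := cset k c in oP Hout; have gf' := gf; rewrite -/S in gf'.
have cS i : c i \in S by apply: mem_cset.
have oS i : oo (c i) \notin S by have [] := oP i; rewrite inE => /andP[].
have oc i j : oo (c i) <> c j by move=> E; have := oS i; rewrite E cS.
have nc i j : i < j -> j < i + k -> c i <> c j := per.2 i j.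
pose h u := if u == c 0 then g else f u.
have [|||f1 [f1h fK]] := @greedy _ _ L L4 (k - 2) (fun i => c i.+1) (fun i => [:: c i; oo (c i.+1); oo (c i.+2)]) h.
- by move=> i j ij jk; apply: nc; lia.
- by [].
- move=> i j ij jk; rewrite !inE !negb_or; apply/and3P; split; apply/eqP.
  + by apply/nesym/nc; lia.
  + exact: nesym.
  + exact: nesym.
have f10 : f1 (c 0) = g.
  by rewrite f1h ?/h ?eqxx // => i ik; apply: nc; lia.
pose z := if f1 (c (k - 2)) == g then (if f1 (c 1) == x then y else x)
          else (if f1 (c (k - 2)) == x then y else x).
pose f2 u := if u == c k.-1 then z else f1 u.
have zP : [/\ z \in L (c k.-1), z <> g, z <> f (oo (c k.-1)) & z <> f (oo (c 0))].
  by rewrite /z; do !case: ifP.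
case: zP => zL zg zk z0.
have zk2 : z <> f1 (c (k - 2)).
  rewrite /z; case: eqP => [->|n1]; first by case: ifP.
  by case: eqP => [->|n2] //; [apply: nesym|move/esym].
have f2c i : i < k.-1 -> f2 (c i) = f1 (c i).
  by move=> ik; rewrite /f2; case: eqP => // E; case: (nc i k.-1 _ _ E); lia.
have f2o i : f2 (oo (c i)) = f (oo (c i)).
  rewrite /f2; case: eqP => [/oc//|_]; rewrite f1h => [|j jk E]; last by case: (oc i j.+1 E).
  by rewrite /h; case: eqP => [/oc|].
have f1o i : f1 (oo (c i)) = f (oo (c i)).
  rewrite f1h => [|j jk E]; last by case: (oc i j.+1 E).
  by rewrite /h; case: eqP => [/oc|].
have f2z : f2 (c k.-1) = z by rewrite /f2 eqxx.
have f20 : f2 (c 0) = g by rewrite f2c //; lia.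
have ck : c k = c 0 by have := per.1 0; rewrite add0n.
have mid i : 0 < i -> i < k.-1 -> [/\ f1 (c i) \in L (c i), f1 (c i) <> f1 (c i.-1),
    f1 (c i) <> f (oo (c i)) & f1 (c i) <> f (oo (c i.+1))].
  case: i => // i _ ik; have lt : i < k - 2 by lia.
  have [fL H] := fK i lt; split=> //; first by apply: H; rewrite !inE eqxx.
    by rewrite -f1o; apply: H; rewrite !inE eqxx orbT.
  by rewrite -f1o; apply: H; rewrite !inE eqxx !orbT.
have red i : exists2 j, j < k & [/\ c i = c j & c i.+1 = c j.+1].
  exists (i %% k); first by rewrite ltn_pmod.
  split; first by rewrite (period_mod per).
  by rewrite -(periodM per (i %% k).+1 (i %/ k)) addSn addnC -divn_eq.
have pos j : j < k -> [\/ j = 0, 0 < j < k.-1 | j = k.-1] by move=> jk; case: (posnP j) => [->|?]; [constructor 1|case: (ltnP j k.-1) => ?; [constructor 2; lia|constructor 3; lia]].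
exists f2; apply: (solid_good sol (Z := set0)).
- apply: eq_good gf' => u; rewrite inE => /andP[uS _].
  have nu i : u <> c i by move=> E; move: uS; rewrite E cS.
  by rewrite /f2; case: eqP => [/nu//|_]; rewrite f1h // /h; case: eqP => [/nu|].
- by move=> u; rewrite inE.
- move=> i; have [j jk [-> _]] := red i; case: (pos j jk) => [->|/andP[j0 jk1]|->].
  + by rewrite f20.
  + by rewrite f2c //; case: (mid j j0 jk1).
  + by rewrite f2z.
- move=> i; have [j jk [-> ->]] := red i; case: (ltnP j.+1 k.-1) => jk1.
    by rewrite !f2c //; [apply: nesym; case: (mid j.+1 isT jk1)|lia].
  have [E|E] : j = k.-2 \/ j = k.-1 by lia.
    have E1 : j.+1 = k.-1 by lia.
    have E2 : j = k - 2 by lia.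
    by rewrite E1 f2z f2c ?E2; [apply: nesym|lia].
  have E1 : j.+1 = k by lia.
  by rewrite E1 ck f20 E f2z.
- move=> i; have [j jk [-> _]] := red i; rewrite f2o; case: (pos j jk) => [->|/andP[j0 jk1]|->].
  + by rewrite f20.
  + by rewrite f2c //; case: (mid j j0 jk1).
  + by rewrite f2z.
- move=> i; have [j jk [-> ->]] := red i; rewrite f2o; case: (pos j jk) => [->|/andP[j0 jk1]|->].
  + by rewrite f20.
  + by rewrite f2c //; case: (mid j j0 jk1).
  + by rewrite f2z prednK // ck.
- move=> a b.
  have three i j l : f2 (c i) <> f2 (c j) -> f2 (c i) <> f2 (c l) -> f2 (c j) <> f2 (c l) ->
    exists i, f2 (c i) <> a /\ f2 (c i) <> b.
    move=> ij il jl; apply: NNPP => no.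
    have H m : f2 (c m) = a \/ f2 (c m) = b.
      by apply: NNPP => hm; apply: no; exists m; tauto.
    by have := H i; have := H j; have := H l => -[]hl []hj []hi; move: ij il jl; rewrite hl hj hi.
  have [E|ne] := eqVneq (f1 (c (k - 2))) g.
    have k4 : 3 < k.
      case: (ltnP 3 k) => // k4; have [|//|_] := mid (k - 2); try lia.
      have -> : (k - 2).-1 = 0 by lia.
      by rewrite f10 E.
    have f21 : f2 (c 1) = f1 (c 1) by apply: f2c; lia.
    have c1g : f1 (c 1) <> g.
      by have [//||_ + _ _] := mid 1; [lia|rewrite f10].
    apply: (three 0 1 k.-1); rewrite ?f20 ?f2z ?f21; [exact: nesym|exact: nesym|].
    by rewrite /z E eqxx; case: eqP => [->|hx].
  have f2k : f2 (c (k - 2)) = f1 (c (k - 2)) by apply: f2c; lia.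
  apply: (three 0 k.-1 (k - 2)); rewrite ?f20 ?f2z ?f2k //; first exact: nesym.
  by apply/eqP; rewrite eq_sym.
Qed.
End Break.
End SolidCycle.

Section SolidCycle.
Variables (G : sgraph) (C : choiceType) (L : G -> {fset C}) (A : {set G}).
Hypothesis hG : subcubic G.
Hypothesis L4 : forall v, #|` L v| = 4.
Hypothesis stuck : ~ exists f, good L set0 A f.

Section Stuck.
Variables (k : nat) (c : nat -> G) (oo : G -> G) (f : G -> C).
Hypothesis sol : solid_cycle A k c oo.
Hypothesis gf : good L set0 (A :\: cset k c) f.

(** The colours left at [c i] once its own outer colour and that of its successor are removed; there
    are at least two. If no colouring of [A] exists, these sets turn out to be one fixed pair all
    around the cycle. *)
Definition remaining i x :=
  [/\ x \in L (c i), x <> f (oo (c i)) & x <> f (oo (c i.+1))].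

Lemma stuck_break i g x y : remaining i.+1 g -> remaining i x -> remaining i y ->
  x <> y -> x <> g -> y <> g -> False.
Proof.
move=> [g1 g2 g3] [x1 x2 x3] [y1 y2 y3] xy xg yg; apply: stuck.
case: (sol) => cyc _ _ _; have [k3 _ per _] := cyc; have k0 : 0 < k by lia.
have E : c (i.+1 + k.-1) = c i by apply: iscyc_prev cyc.
have gf' : good L set0 (A :\: cset k (fun j => c (i.+1 + j))) f by rewrite cset_shift.
by apply: (solid_break L4 (solid_shift i.+1 sol) gf' (g := g) (x := x) (y := y)); rewrite ?E ?addn0 ?addn1.
Qed.

Lemma stuck_two i : exists x y, [/\ remaining i x, remaining i y & x <> y].
Proof.
have [x xL] := @list_fresh _ _ L L4 (c i) [:: f (oo (c i)); f (oo (c i.+1))] isT.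
rewrite !inE !negb_or => /andP[/eqP x1 /eqP x2].
have [y yL] := @list_fresh _ _ L L4 (c i) [:: f (oo (c i)); f (oo (c i.+1)); x] isT.
by rewrite !inE !negb_or => /and3P[/eqP y1 /eqP y2 /eqP/nesym y3]; exists x, y.
Qed.

(** If [g] did not remain at [c i], two candidates other than [g] would remain there, which is the
    situation of [stuck_break]. *)
Lemma stuck_sub i g : remaining i.+1 g -> remaining i g.
Proof.
move=> gM; have [x [y [xM yM xy]]] := stuck_two i.
have [<-//|/eqP xg] := eqVneq x g; have [<-//|/eqP yg] := eqVneq y g.
by case: (stuck_break gM xM yM xy xg yg).
Qed.

Lemma stuck_three i x y z : remaining i x -> remaining i y -> remaining i z ->
  x <> y -> x <> z -> y <> z -> False.
Proof.
move=> xM yM zM xy xz yz; have [g [_ [gM _ _]]] := stuck_two i.+1.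
have [E|/eqP xg] := eqVneq x g.
  by apply: (stuck_break gM yM zM) => //; rewrite -E; apply: nesym.
have [E|/eqP yg] := eqVneq y g.
  by apply: (stuck_break gM xM zM) => //; rewrite -E; apply: nesym.
exact: (stuck_break gM xM yM).
Qed.

(** Only two of the four colours remain, so the two removed outer colours are distinct and both in
    the list. *)
Lemma stuck_outer i : [/\ f (oo (c i)) \in L (c i), f (oo (c i.+1)) \in L (c i)
  & f (oo (c i)) <> f (oo (c i.+1))].
Proof.
have [x [y [xM yM xy]]] := stuck_two i.
have three a : exists2 z, z \in L (c i) & [/\ z <> a, z <> x & z <> y].
  have [z zL] := @list_fresh _ _ L L4 (c i) [:: a; x; y] isT.
  by rewrite !inE !negb_or => /and3P[/eqP ? /eqP ? /eqP ?]; exists z.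
have fin z : z \in L (c i) -> z <> f (oo (c i)) -> z <> f (oo (c i.+1)) -> z <> x -> z <> y -> False.
  by move=> *; apply: (@stuck_three i x y z) => //; apply: nesym.
split.
- apply/negPn/negP => no; have [z zL [z1 z2 z3]] := three (f (oo (c i.+1))).
  by apply: (fin z) => // E; move: no; rewrite -E zL.
- apply/negPn/negP => no; have [z zL [z1 z2 z3]] := three (f (oo (c i))).
  by apply: (fin z) => // E; move: no; rewrite -E zL.
- move=> E; have [z zL [z1 z2 z3]] := three (f (oo (c i))).
  by apply: (fin z) => //; rewrite -E.
Qed.
End Stuck.

Section StuckBoth.
Variables (k : nat) (c : nat -> G) (oo : G -> G) (f : G -> C).
Hypothesis sol : solid_cycle A k c oo.
Hypothesis gf : good L set0 (A :\: cset k c) f.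

(** The reversed cycle is stuck too, so the outer colour of [c i] is in the list of [c i.+1]. It
    cannot remain there, since it would then remain at [c i]; and it differs from the outer colour
    of [c i.+1]. So the outer colour of [c i.+2] removes it. *)
Lemma stuck_alt i : f (oo (c i)) = f (oo (c i.+2)).
Proof.
case: (sol) => cyc _ _ _; have [k3 _ per _] := cyc; have k0 : 0 < k by lia.
have gf' : good L set0 (A :\: cset k (fun j => c (k.-1 * j))) f by rewrite cset_rev.
have [_ + _] := stuck_outer (solid_rev sol) gf' (k.-1 * i.+1).
rewrite rev_index_prev ?rev_index //; last by lia.
move=> inL; have [_ _ ne] := stuck_outer sol gf i.
apply: NNPP => ne2; have [|_ []//] := stuck_sub sol gf (i := i) (g := f (oo (c i))).
by split.
Qed.

(** Around an odd cycle the alternation would give two consecutive outer neighbours the same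
    colour. *)
Lemma stuck_even : exists h, k = h.*2.
Proof.
case: (sol) => cyc _ _ _; have [k3 _ per _] := cyc.
have alt m i : f (oo (c (i + m.*2))) = f (oo (c i)).
  elim: m => [|m IHm]; first by rewrite addn0.
  by rewrite doubleS !addnS -stuck_alt.
exists k./2; have := odd_double_half k; case: (odd k) => // Ek.
have [_ _ []] := stuck_outer sol gf 0.
by rewrite -(alt k./2 1) Ek -[c k]/(c (0 + k)) per.1.
Qed.

(* Colouring the cycle alternately with [al] and [be], except that [c 1] gets the colour of
   the outer neighbour of [c 0], fails only because of a two-coloured cycle through [c 0]. *)
Lemma kempe al be : remaining c oo f 0 al -> remaining c oo f 0 be -> al <> be ->
  (forall i, edge (oo (c 0)) (c i) -> c i = c 0) ->
  exists u, [/\ u \in A :\: cset k c, edge (oo (c 0)) u, f u = al &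
    exists u2, [/\ u2 \in A :\: cset k c, u2 <> oo (c 0), edge u u2 & f u2 = f (oo (c 0))]].
Proof.
move=> alM beM albe priv; apply: NNPP => noU; apply: stuck.
case: (sol) => [[k3 cA per ce] oP N Hout]; have k0 : 0 < k by lia.
have [h Ek] := stuck_even; have k4 : 3 < k by lia.
set S := cset k c in oP Hout noU; have gf' := gf; rewrite -/S in gf'.
set B := A :\: S in oP Hout gf' noU.
have cS i : c i \in S by apply: mem_cset.
have nS u i : u \in B -> u <> c i by move=> + E; rewrite inE E cS.
have sBA u : u \in B -> u \in A by rewrite inE => /andP[].
(* [stuck_sub] moves backwards; going round the cycle, a colour remaining at [c 0] remains
   everywhere. *)
have sub n : remaining c oo f n al /\ remaining c oo f n be.
  have H x m j : remaining c oo f (j + m) x -> remaining c oo f j x.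
    by elim: m => [|m IHm]; rewrite ?addn0 // addnS => /(stuck_sub sol gf).
  have H0 x : remaining c oo f 0 x -> remaining c oo f (n + n * k.-1) x.
    have -> : n + n * k.-1 = 0 + n * k by nia.
    by rewrite /remaining -addSn !(periodM per).
  by split; apply: (H _ (n * k.-1)); apply: H0.
set pp := f (oo (c 0)); set qq := f (oo (c 1)).
have pq : pp <> qq by case: (stuck_outer sol gf 0).
have oE i : f (oo (c i)) = if odd i then qq else pp.
  have H : forall i, f (oo (c i)) = (if odd i then qq else pp) /\ f (oo (c i.+1)) = (if odd i.+1 then qq else pp).
    elim=> [|j [H1 H2]]; first by [].
    by split=> //; rewrite -stuck_alt H1 /= negbK.
  by case: (H i).
have ap : al <> pp by case: alM.
have aq : al <> qq by case: alM.
have bp : be <> pp by case: beM.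
have bq : be <> qq by case: beM.
have aL i : al \in L (c i) by case: (sub i) => [[]].
have bL i : be \in L (c i) by case: (sub i) => [_ []].
have pL : pp \in L (c 1) by rewrite /pp stuck_alt; case: (stuck_outer sol gf 1).
pose col i := if odd i then be else al.
(* The colour [pp] at [c 1] breaks the cycle coloured [al] and [be]; it is allowed there because the
   outer colour of [c 1] is [qq]. *)
pose f' v := if v == c 1 then pp else if v \in S then (if f (oo v) == pp then al else be) else f v.
have f'1 : f' (c 1) = pp by rewrite /f' eqxx.
have f'c i : c i <> c 1 -> f' (c i) = col i.
  by move=> /eqP/negbTE ne; rewrite /f' ne cS oE /col; case: odd; rewrite ?eqxx // eq_sym; case: eqP.
have f'B u : u \in B -> f' u = f u.
  move=> uB; rewrite /f'; case: eqP => [/(nS _ _ uB)//|_].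
  by move: uB; rewrite inE => /andP[/negbTE->].
have f'o i : f' (oo (c i)) = if odd i then qq else pp by rewrite f'B ?oE //; case: (oP i).
have ne1 i : i < k -> i <> 1 -> c i <> c 1.
  move=> ik i1; case: (ltngtP i 1) => // lt; first by apply: per.2; lia.
  by apply: nesym; apply: per.2; lia.
have ck : c k = c 0 by have := per.1 0; rewrite add0n.
have colA i : col i = al \/ col i = be by rewrite /col; case: odd; auto.
have colo i j : col i <> f' (oo (c j)).
  by rewrite f'o /col; case: odd; case: odd.
have colS i : col i <> col i.+1 by rewrite /col /=; case: odd => //=; apply: nesym.
have colp i : col i <> pp by rewrite /col; case: odd.
have ne1' i : 1 < i -> i <= k -> c i <> c 1 by move=> i1 ik; apply: nesym; apply: per.2; lia.
have adj i : c i <> c i.+1 by apply: per.2; lia.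
have fn i : f' (c i) <> f' (c i.+1).
  have [E|/eqP n0] := eqVneq (c i) (c 1).
    by rewrite (f'c i.+1) => [|E2]; [rewrite E f'1; apply: nesym|apply: (adj i); rewrite E2].
  have [E|/eqP n1] := eqVneq (c i.+1) (c 1); first by rewrite E f'1 f'c.
  by rewrite !f'c.
have SP v : v \in S -> exists i, v = c i.+1.
  case/csetP=> i ik ->; exists (i + k.-1); rewrite -addnS prednK //; by rewrite per.1.
exists f'; apply: (extend (B := B) (S := S) (Z := set0)) => //.
- by apply/subsetP=> v /SP[i ->].
- by apply: eq_good gf' => u uB; rewrite f'B.
- move=> v /SP[i ->]; have [->|/eqP n1] := eqVneq (c i.+1) (c 1); first by rewrite f'1.
  by rewrite f'c // /col; case: odd.
- move=> v u /SP[i ->] uA /(N i u uA)[->|->|->]; [exact: nesym|exact: fn|].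
  have [E|/eqP n1] := eqVneq (c i.+1) (c 1); first by rewrite E f'1 f'o.
  by rewrite f'c.
- move=> v /SP[i ->] _ _; have [oB eo] := oP i.+1; have oA := sBA _ oB.
  have [E|/eqP n1] := eqVneq (c i) (c 1).
    exists (c i.+2), (oo (c i.+1)); split=> //; rewrite f'c // -E; apply: nesym; apply: per.2; lia.
  by exists (c i), (oo (c i.+1)); split=> //; [rewrite edgeC|rewrite f'c].
- move=> u uB _ gt1; have [[s sS us]|no] := classic (exists2 s, s \in S & edge u s); last first.
    by left; rewrite inE -(@nb_off _ A S) // => s sS _ us; apply: no; exists s.
  case/SP: sS us => i -> us; case: (Hout u _ uB us) => [?|[j [e1 e2]]]; first by left; rewrite inE.
  by right; exists (c j), (c j.+1).
- move=> X v pf XA cX vS; apply/negP => vX; have inA := subsetP XA.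
  have mid i : 1 < i -> i.+2 <= k -> c i.+1 \in X -> c i \in X.
    move=> i1 ik ci; case: (core_pair pf XA cX ci) => u [w [uX wX uw eu [ew fuw]]].
    have e0 : f' (c i) = col i by apply: f'c; apply: ne1' => //; lia.
    have e2 : f' (c i.+2) = col i.+2 by apply: f'c; apply: ne1' => //; lia.
    have := N i u (inA _ uX) eu; have := N i w (inA _ wX) ew.
    case=> Ew; case=> Eu; rewrite ?Eu ?Ew in uX wX uw fuw *; rewrite ?uX ?wX //.
    - by case: (colo i.+2 i.+1); rewrite -e2.
    - by case: (colo i.+2 i.+1); rewrite -e2.
  (* A core meeting the cycle at [c 3] or later would follow it down to [c 2]. The other neighbours
     of [c 2] both have colour [pp], unlike [c 3]. *)
  have no m : 3 + m < k -> c (3 + m) \notin X.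
    elim: m => [|m IHm] mk; apply/negP => cm; last first.
      by move: (IHm (ltnW mk)); rewrite (mid (3 + m)) // -addnS.
    have c2 := mid 2 isT mk cm.
    case: (core_pair pf XA cX c2) => u [w [uX wX uw eu [ew _]]].
    have e23 : edge (c 2) (c 3) by apply: ce.
    have f3 : f' (c 3) = col 3 by apply: f'c; apply: ne1' => //; lia.
    have is3 x : x \in X -> edge (c 2) x -> x = c 3.
      move=> xX ex; have fx := core_same pf XA cX c2 xX cm ex e23.
      case: (N 1 x (inA _ xX) ex) => // Ex; rewrite Ex f3 in fx.
        by case: (colp 3); rewrite -fx f'1.
      by case: (colo 3 2); rewrite -fx.
    by apply: uw; rewrite (is3 u) // (is3 w).
  have k1 : k.-1.+1 = k by lia.
  have nk1 : c k.-1 \notin X.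
    have -> : k.-1 = 3 + (k - 4) by lia.
    by apply: no; lia.
  have f0 : f' (c 0) = al by rewrite f'c //; apply: ne1.
  have f2 : f' (c 2) = al by rewrite f'c //; apply: ne1' => //; lia.
  have c10 : c 1 \in X -> c 0 \in X.
    move=> ci; case: (core_pair pf XA cX ci) => u [w [uX wX uw eu [ew fuw]]].
    have := N 0 u (inA _ uX) eu; have := N 0 w (inA _ wX) ew.
    case=> Ew; case=> Eu; rewrite ?Eu ?Ew in uX wX uw fuw *; rewrite ?uX ?wX //.
    - by case: aq; rewrite -f2 -fuw f'o.
    - by case: aq; rewrite -f2 fuw f'o.
  have c21 : c 2 \in X -> c 1 \in X.
    move=> ci; case: (core_pair pf XA cX ci) => u [w [uX wX uw eu [ew fuw]]].
    have := N 1 u (inA _ uX) eu; have := N 1 w (inA _ wX) ew.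
    have := no 0 k4; rewrite addn0 => n3.
    by case=> Ew; case=> Eu; rewrite ?Eu ?Ew in uX wX uw fuw *; rewrite ?uX ?wX // in n3 *.
  (* The only possible core leaves the cycle from [c 0] through its outer neighbour, on the colours
     [al] and [pp]. Its next two vertices are the claimed [u] and [u2]. *)
  have c0 : c 0 \in X.
    case/csetP: vS vX => i ik -> ciX; case: i ik ciX => [|[|[|i]]] ik ciX //; first exact: c10.
      by apply: c10; apply: c21.
    by move: (no i); rewrite addnC addn3 ciX => /(_ ik).
  have o0 : oo (c 0) \in X.
    have := c0; rewrite -ck -k1 => ci; case: (core_pair pf XA cX ci) => u [w [uX wX uw eu [ew fuw]]].
    have := N _ u (inA _ uX) eu; have := N _ w (inA _ wX) ew; rewrite k1 ck.
    by case=> Ew; case=> Eu; rewrite ?Eu ?Ew in uX wX uw fuw *; rewrite ?uX ?wX // in nk1 *.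
  have [_ eo0] := oP 0; rewrite edgeC in eo0.
  have [x [xX ox xc]] : exists x, [/\ x \in X, edge (oo (c 0)) x & x <> c 0].
    case: (core_pair pf XA cX o0) => u [w [uX wX uw eu [ew _]]].
    have [E|/eqP ne] := eqVneq u (c 0); last by exists u.
    by exists w; split=> //; rewrite -E; apply: nesym.
  have xB : x \in B.
    rewrite inE (inA _ xX) andbT; apply/negP => /csetP[i _ Ex].
    by rewrite Ex in ox xc; apply: xc; apply: priv.
  have fx : f' x = al by rewrite -f0; apply: (core_same pf XA cX o0).
  have xo : edge x (oo (c 0)) by rewrite edgeC.
  have [y [yX xy yo]] : exists y, [/\ y \in X, edge x y & y <> oo (c 0)].
    case: (core_pair pf XA cX xX) => u [w [uX wX uw eu [ew _]]].
    have [E|/eqP ne] := eqVneq u (oo (c 0)); last by exists u.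
    by exists w; split=> //; rewrite -E; apply: nesym.
  have fy : f' y = pp by rewrite (core_same pf XA cX xX yX o0 xy xo) f'o.
  have yB : y \in B.
    rewrite inE (inA _ yX) andbT; apply/negP => /SP[i Ey].
    have := xy; rewrite Ey edgeC => /(N _ _ (inA _ xX))[Ex|Ex|Ex]; try exact: (nS _ _ xB Ex).
    by move: fx; rewrite Ex f'o; case: odd => E; [apply: aq|apply: ap].
  apply: noU; exists x; split=> //; first by rewrite -f'B.
  by exists y; split=> //; rewrite -f'B.
Qed.
End StuckBoth.
End SolidCycle.

Section SolidCycle.
Variables (G : sgraph) (C : choiceType) (L : G -> {fset C}) (A : {set G}).
Hypothesis hG : subcubic G.
Hypothesis L4 : forall v, #|` L v| = 4.

(** Applied to both remaining colours, [kempe] shows that the outer neighbour of [c 0] has two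
    further neighbours of different colours, each seeing its colour elsewhere too. So it can be
    recoloured without harm, and the new colour contradicts [stuck_alt]. *)
Lemma color_solid k (c : nat -> G) oo f : solid_cycle A k c oo ->
  good L set0 (A :\: cset k c) f ->
  odd k \/ (forall i j, edge (oo (c i)) (c j) -> c j = c i) ->
  exists f, good L set0 A f.
Proof.
move=> sol gf Hpriv; apply: NNPP => stuck.
case: (sol) => [[k3 cA per ce] oP N Hout]; have k0 : 0 < k by lia.
have priv : forall i j, edge (oo (c i)) (c j) -> c j = c i.
  by case: Hpriv => // ok; have [h Ek] := stuck_even L4 stuck sol gf; move: ok; rewrite Ek odd_double.
have [al [be [alM beM ab]]] := stuck_two L4 c oo f 0.
have [u [uB ou fu [u2 [u2B u2o uu2 fu2]]]] := kempe L4 stuck sol gf alM beM ab (priv 0).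
have [v [vB ov fv [v2 [v2B v2o vv2 fv2]]]] := kempe L4 stuck sol gf beM alM (nesym ab) (priv 0).
set B := A :\: cset k c in oP Hout gf uB vB u2B v2B; set o0 := oo (c 0) in ou ov u2o v2o fu2 fv2.
have [o0B eo0] := oP 0; rewrite -/o0 in o0B eo0.
have sBA x : x \in B -> x \in A by rewrite inE => /andP[].
have nS x i : x \in B -> x <> c i by move=> + E; rewrite inE E mem_cset.
have uv : u <> v by move=> E; apply: ab; rewrite -fu -fv E.
have No x : x \in B -> edge o0 x -> x = u \/ x = v.
  move=> xB ox; case: (@nb_le3 _ A o0 (c 0) u v x) => //; try exact: sBA; auto.
  - exact: deg_le3.
  - by rewrite edgeC.
  - by apply: nesym; apply: nS.
  - by apply: nesym; apply: nS.
  - by move/(nS x 0 xB).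
(* The fourth colour: it avoids the old one to break the alternation, and [al], [be] to stay
   proper. *)
have [r rL] := @list_fresh _ _ L L4 o0 [:: f o0; al; be] isT.
rewrite !inE !negb_or => /and3P[/eqP rp /eqP ra /eqP rb].
pose f1 x := if x == o0 then r else f x.
have f1o : f1 o0 = r by rewrite /f1 eqxx.
have f1n x : x <> o0 -> f1 x = f x by move=> /eqP/negbTE h; rewrite /f1 h.
have uo : u <> o0 by move=> E; move: ou; rewrite E edge_irrefl.
have vo : v <> o0 by move=> E; move: ov; rewrite E edge_irrefl.
case: (gf) => g1 g2 g3 g4.
have pf : proper_on B f1.
  have H x : x \in B -> edge o0 x -> f1 x <> r.
    by move=> xB /(No x xB)[]->; rewrite f1n // ?fu ?fv; apply: nesym.
  move=> x y xB yB xy; have [E|/eqP nx] := eqVneq x o0.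
    by rewrite E f1o; apply: nesym; apply: H; rewrite // -E.
  have [E|/eqP ny] := eqVneq y o0; first by rewrite E f1o; apply: H; rewrite // -E edgeC.
  by rewrite !f1n //; apply: g2.
have gf1 : good L set0 B f1.
  split=> //.
  - by move=> x xB; have [->|/eqP nx] := eqVneq x o0; [rewrite f1o|rewrite f1n //; apply: g1].
  - move=> x xB x0 gt1; have [E|/eqP nx] := eqVneq x o0.
      by rewrite E; exists u, v; split=> //; rewrite !f1n // fu fv.
    have special w w2 : w \in B -> edge o0 w -> w2 \in B -> w2 <> o0 -> edge w w2 -> f w2 = f o0 -> nonconst f1 B w.
      move=> wB ow w2B w2o ww2 fw2; exists o0, w2; split=> //; first by rewrite edgeC.
      by rewrite f1o f1n // fw2.
    have [E|/eqP xu] := eqVneq x u; first by rewrite E; apply: special fu2.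
    have [E|/eqP xv] := eqVneq x v; first by rewrite E; apply: special fv2.
    have [a [b [aB bB xa xb ne]]] := g3 x xB x0 gt1.
    have no w : edge x w -> w <> o0.
      by move=> xw E; rewrite E edgeC in xw; case: (No x xB xw).
    by exists a, b; split=> //; rewrite !f1n //; apply: no.
  - move=> X XB cX; apply: g4 => //; apply: eq_core (cX) => x xX; rewrite f1n // => E.
    have oX : o0 \in X by rewrite -E.
    have : o0 \notin X; last by rewrite oX.
    apply: (deg2_notin (a := u) (b := v) pf XB cX) => [y yX|]; last by rewrite !f1n // fu fv.
    by apply: No; apply: (subsetP XB).
have := stuck_alt L4 stuck sol gf1 0; rewrite -/o0 f1o f1n.
  by rewrite -(stuck_alt L4 stuck sol gf 0).
move=> E; apply: (per.2 0 2 isT k3).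
by apply/esym/priv; rewrite -/o0 -E edgeC; case: (oP 2).
Qed.
End SolidCycle.

(** * Putting back vertices of degree two *)

Section Pendants.
Variables (G : sgraph) (C : choiceType) (L : G -> {fset C}).
Hypothesis L4 : forall v, #|` L v| = 4.

(** The neighbours of [p] already differ in colour, which settles [p]. Avoiding a neighbour [x] of
    [w] settles [w], which thereby leaves the exempted set. *)
Lemma add_deg2 (E Z : {set G}) f p c w : p \notin E -> c \in E -> w \in E ->
  edge p c -> edge p w -> (forall u, u \in E -> edge p u -> u = c \/ u = w) ->
  f c <> f w -> 1 < #|nb E c| -> c \notin Z -> good L Z E f ->
  exists f', {in E, f =1 f'} /\ good L (Z :\ w) (p |: E) f'.
Proof.
move=> pE cE wE pc pw Np fcw gtc cZ gf; pose x := some_nb E w.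
have xE : x \in E by apply: some_nb_in.
have np u : u \in E -> u != p by move=> uE; apply: contraNneq pE => <-.
have [|f' [ff' /= [[fL [fc [fw [fx _]]]] _]]] := greedy_seq L4 f (s := [:: (p, [:: c; w; x])]).
  by rewrite /= !inE !np.
have ffE : {in E, f =1 f'} by move=> u uE; rewrite ff' //= inE np.
exists f'; split=> //.
have EE : E = (p |: E) :\: [set p] by rewrite setU1K.
have inE' u : u \in p |: E -> u <> p -> u \in E by rewrite in_setU1 => /predU1P[].
apply: (@extend _ _ _ _ Z _ (p |: E) E [set p]) => //.
- by rewrite sub1set setU11.
- exact: eq_good gf.
- by move=> v /set1P ->.
- move=> v u /set1P-> uE pu; have uE' : u \in E by apply: inE' uE _; apply: nesym; apply: edge_neq pu.
  by case: (Np u uE' pu) => ->.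
- move=> v /set1P-> _ _; exists c, w; split; rewrite ?in_setU1 ?cE ?wE ?orbT //.
  by rewrite -!ffE.
- move=> u uE; rewrite in_setD1 negb_and negbK => uZ gt1.
  have [E1|nw] := eqVneq u w.
    right; rewrite E1 in gt1 *; have [y [yE wy yp]] := nb_other p gt1.
    have [_ wx] := some_nbP (inE' _ yE yp) wy; exists p, x; split=> //; rewrite ?in_setU1 ?eqxx ?xE ?orbT //.
    by rewrite edgeC.
  rewrite (negbTE nw) /= in uZ; left; split=> //.
  have [up|nup] := boolP (edge u p).
    rewrite edgeC in up; case: (Np u uE up) => [->//|E1]; by rewrite E1 eqxx in nw.
  rewrite EE -(@nb_off _ (p |: E)) // => s /set1P-> _; exact/negP.
- move=> X v pf XA cX /set1P->; apply: (deg2_notin (a := c) (b := w) pf XA cX) => [u uX pu|].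
    by apply: Np => //; apply: inE'; [exact: (subsetP XA)|apply: nesym; apply: edge_neq pu].
  by rewrite -!ffE.
Qed.

Lemma add_pendants (ps : seq G) (cc ww : G -> G) (E Z : {set G}) f : uniq ps ->
  (forall p, p \in ps -> p \notin E /\ [/\ cc p \in E, ww p \in E, edge p (cc p) & edge p (ww p)]) ->
  (forall p u, p \in ps -> u \in E \/ u \in ps -> edge p u -> u = cc p \/ u = ww p) ->
  (forall p, p \in ps -> [/\ f (cc p) <> f (ww p), 1 < #|nb E (cc p)| & cc p \notin Z]) ->
  good L Z E f ->
  exists f', good L (Z :\: [set x in map ww ps]) (E :|: [set x in ps]) f'.
Proof.
elim: ps E Z f => [|p ps IH] E Z f /=.
  by move=> _ _ _ _ gf; exists f; rewrite !set_nil setD0 setU0.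
case/andP=> pps ups H1 H2 H3 gf.
have [pE [cE wE pc pw]] := H1 p (mem_head _ _); have [fcw gtc cZ] := H3 p (mem_head _ _).
have pin q : q \in ps -> q \in p :: ps by rewrite in_cons => ->; rewrite orbT.
have [|f1 [ff1 gf1]] := add_deg2 pE cE wE pc pw _ fcw gtc cZ gf.
  by move=> u uE; apply: H2; [rewrite mem_head|left].
have [|||||f' gf'] := IH (p |: E) (Z :\ ww p) f1 => //.
- move=> q qps; have [qE [cqE wqE qc qw]] := H1 q (pin q qps).
  rewrite !in_setU1 cqE wqE !orbT negb_or qE andbT; split=> //.
  by apply: contraNneq pps => <-.
- move=> q u qps uE; apply: H2; first exact: pin.
  by case: uE; [rewrite in_setU1 => /predU1P[->|->]; [right; rewrite mem_head|left]|move=> uq; right; apply: pin].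
- move=> q qps; have [fq gq cq] := H3 q (pin q qps); have [_ [cqE wqE _ _]] := H1 q (pin q qps).
  split; [by rewrite -!ff1| |by rewrite in_setD1 (negbTE cq) andbF].
  by apply: leq_trans gq _; apply/subset_leq_card/nbS/subsetU1.
exists f'; have -> : E :|: [set x in p :: ps] = (p |: E) :|: [set x in ps].
  by apply/setP=> x; rewrite !inE orbA [(x \in E) || _]orbC.
have -> // : Z :\: [set x in ww p :: [seq ww i | i <- ps]] = (Z :\ ww p) :\: [set x in map ww ps].
by apply/setP=> x; rewrite !inE negb_or andbA [(x \notin _) && _]andbC.
Qed.
End Pendants.

(** * Cycles with a vertex lacking a permanent outer neighbour *)

Section NonsolidCycle.
Variables (G : sgraph) (C : choiceType) (L : G -> {fset C}) (A : {set G}).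
Hypothesis L4 : forall v, #|` L v| = 4.

(* [F v] holds the vertices off the cycle whose colour [v] must avoid: its outer
   neighbour when [sol v], the far neighbour of a deleted pendant neighbour otherwise. *)
Lemma color_nonsolid k (c : nat -> G) (F : G -> seq G) (sol : pred G) (Zb Z : {set G}) f :
  iscyc A k c ->
  (forall i, size (F (c i)) <= 1 /\ {subset F (c i) <= A :\: cset k c}) ->
  (forall i u, u \in A -> edge (c i.+1) u ->
     [\/ u = c i, u = c i.+2 | sol (c i.+1) /\ u \in F (c i.+1)]) ->
  (forall i, sol (c i) -> exists2 u, F (c i) = [:: u] & edge (c i) u) ->
  ~~ sol (c 0) ->
  (forall i, 0 < i -> i < k -> [\/ sol (c i), k = 3 | k = 4 /\ i = 2]) ->
  good L Zb (A :\: cset k c) f -> Zb \subset Z ->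
  (forall u i, u \in A :\: cset k c -> edge u (c i) -> u \notin Z ->
     1 < #|nb (A :\: cset k c) u| \/ exists j, edge u (c j) /\ edge u (c j.+1)) ->
  exists f', [/\ {in A :\: cset k c, f =1 f'}, good L Z A f' &
    forall i u, u \in F (c i) -> f' (c i) <> f' u].
Proof.
move=> [k3 cA per ce] FP N solF ns0 Hs gf ZZ Hout; have k0 : 0 < k by lia.
set S := cset k c in FP gf Hout *; set B := A :\: S in FP gf Hout *.
have cS i : c i \in S by apply: mem_cset.
have nS u i : u \in B -> u <> c i by move=> + E; rewrite inE E cS.
have sBA u : u \in B -> u \in A by rewrite inE => /andP[].
have FB i u : u \in F (c i) -> u \in B by case: (FP i) => _; apply.
have ck : c k = c 0 by have := per.1 0; rewrite add0n.
have ck1 : c k.+1 = c 1 by have := per.1 1; rewrite add1n.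
(* The order is [c 2], [c 1], [c 3], ..., [c k], where [c k] is [c 0]. As [c 0] is not solid, its
   predecessor need not avoid anything outside for it; it avoids [c 1] instead, so that the two
   neighbours of [c 0] differ. *)
pose si i := if i == 0 then 2 else if i == 1 then 1 else i.+1.
pose K i := if i == 0 then F (c 2) ++ F (c 1) ++ F (c 3) else
  if i == 1 then c 2 :: F (c 1) ++ F (c 2) else
  if i.+1 == k then [:: c 1, c k.-1 & F (c 0)] else
  c i :: F (c i.+1) ++ (if i.+2 == k then [:: c 1] else F (c i.+2)).
have sip i : i < k -> 0 < si i <= k.
  by rewrite /si; case: eqP => [->|?]; [lia|case: eqP => [->|?]; lia].
have inj a b : 0 < a <= k -> 0 < b <= k -> c a = c b -> a = b.
  move=> ha hb E; case: (ltngtP a b) => // lt; [case: (per.2 a b)|case: (per.2 b a)] => //; lia.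
have F1 i : size (F (c i)) <= 1 by case: (FP i).
have [|||f' [ff' fK]] := @greedy _ _ L L4 k (fun i => c (si i)) K f.
- move=> i j ij jk E; have := inj _ _ (sip i (ltn_trans ij jk)) (sip j jk) E; rewrite /si.
  by do !case: eqP => ?; lia.
- move=> i _; rewrite /K; have := F1 0; have := F1 1; have := F1 2; have := F1 3; have := F1 i.+1; have := F1 i.+2.
  by do !case: ifP => _; rewrite /= ?size_cat /=; lia.
- move=> i j ij jk; have sj := sip j jk.
  have nF m : c (si j) \notin F (c m) by apply/negP => /FB/nS; apply.
  have nc m : 0 < m <= k -> si j <> m -> c (si j) != c m.
    by move=> hm ne; apply/eqP => /(inj _ _ sj hm).
  rewrite /K; case: eqP => [Ei|i0]; first by rewrite !mem_cat !negb_or !nF.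
  case: eqP => [Ei|i1].
    rewrite in_cons mem_cat !negb_or !nF !andbT; apply: nc; first by lia.
    by rewrite /si; do !case: eqP => ?; lia.
  have Esj : si j = j.+1 by rewrite /si; do !case: eqP => ?; lia.
  case: eqP => [Ek|Ek]; rewrite !in_cons ?mem_cat !negb_or !nF ?andbT.
    by rewrite !nc ?Esj //; lia.
  apply/andP; split; first by apply: nc; rewrite ?Esj; lia.
  case: (i.+2 =P k) => Ek2; last exact: nF.
  by rewrite inE; apply: nc; rewrite ?Esj; lia.
have ffB : {in B, f =1 f'} by move=> u uB; rewrite ff' // => i _; apply: nS.
have a2 : f' (c 2) \in L (c 2) /\ forall m u, (m = 1 \/ m = 2 \/ m = 3) -> u \in F (c m) -> f' (c 2) <> f' u.
  have [fL H] := fK 0 k0; split=> // m u hm um; apply: H.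
  by case: hm um => [->|[->|->]] um; rewrite /K /= !mem_cat um ?orbT.
have a1 : [/\ f' (c 1) \in L (c 1), f' (c 1) <> f' (c 2) & forall m u, (m = 1 \/ m = 2) -> u \in F (c m) -> f' (c 1) <> f' u].
  have [fL H] := fK 1 (ltnW k3); split=> //; first by apply: H; rewrite /K /= mem_head.
  move=> m u hm um; apply: H; rewrite /K /= in_cons mem_cat.
  by case: hm um => -> um; rewrite um ?orbT.
have am m : 2 < m -> m < k -> [/\ f' (c m) \in L (c m), f' (c m) <> f' (c m.-1),
   forall u, u \in F (c m) -> f' (c m) <> f' u, forall u, m.+1 < k -> u \in F (c m.+1) -> f' (c m) <> f' u
   & m.+1 = k -> f' (c m) <> f' (c 1)].
  case: m => // m m2 mk; have [] := fK m (ltnW mk); rewrite /si /K.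
  have [n0 n1 nk] : [/\ m == 0 = false, m == 1 = false & m.+1 == k = false] by split; apply/eqP; lia.
  rewrite n0 n1 nk => fL H; split=> //.
  - by apply: H; rewrite mem_head.
  - by move=> u uF; apply: H; rewrite in_cons mem_cat uF orbT.
  - move=> u mk2 uF; apply: H; rewrite in_cons mem_cat ifN ?uF ?orbT //; apply/eqP; lia.
  - by move=> Ek; apply: H; rewrite in_cons mem_cat Ek eqxx mem_head !orbT.
have a0 : [/\ f' (c 0) \in L (c 0), f' (c 0) <> f' (c 1), f' (c 0) <> f' (c k.-1) & forall u, u \in F (c 0) -> f' (c 0) <> f' u].
  have lk : k.-1 < k by lia.
  have [] := fK k.-1 lk; rewrite /si /K.
  have [n0 n1] : [/\ k.-1 == 0 = false & k.-1 == 1 = false] by split; apply/eqP; lia.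
  rewrite n0 n1 prednK // eqxx ck => fL H; split=> //.
  - by apply: H; rewrite mem_head.
  - by apply: H; rewrite !in_cons eqxx orbT.
  - by move=> u uF; apply: H; rewrite !in_cons uF !orbT.
have red i : exists2 j, j < k & [/\ c i = c j & c i.+1 = c j.+1].
  exists (i %% k); first by rewrite ltn_pmod.
  split; first by rewrite (period_mod per).
  by rewrite -(periodM per (i %% k).+1 (i %/ k)) addSn addnC -divn_eq.
have fn i : f' (c i) <> f' (c i.+1).
  have [j jk [-> ->]] := red i; case: j jk => [|[|j]] jk; [by case: a0|by case: a1|].
  case: (ltngtP j.+3 k) => [lt| |E]; [|lia|].
    by apply: nesym; case: (am j.+3 isT lt).
  rewrite E ck; apply: nesym; have -> : j.+2 = k.-1 by lia.
  by case: a0.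
have fL i : f' (c i) \in L (c i).
  have [j jk [-> _]] := red i; case: j jk => [|[|[|j]]] jk; [by case: a0|by case: a1|by case: a2|].
  by case: (am j.+3 isT jk).
have fF i u : u \in F (c i) -> f' (c i) <> f' u.
  have [j jk [-> _]] := red i; case: j jk => [|[|[|j]]] jk uF.
  - by case: a0 => _ _ _; apply.
  - by case: a1 => _ _ H; apply: (H _ _ _ uF); left.
  - by case: a2 => _ H; apply: (H _ _ _ uF); right; left.
  - by case: (am j.+3 isT jk) => _ _ + _ _; apply.
have f1k : f' (c 1) <> f' (c k.-1).
  case: (ltnP 3 k) => k4.
    have lk : k.-1 < k by lia.
    have lk2 : 2 < k.-1 by lia.
    by have [_ _ _ _ H] := am k.-1 lk2 lk; apply: nesym; apply: H; lia.
  have -> : k.-1 = 2 by lia.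
  by case: a1.
have fb m u : 1 < m -> m < k -> u \in F (c m) -> f' (c m.-1) <> f' u.
  case: m => [|[|[|m]]] // _ mk uF; first by case: a1 => _ _ H; apply: (H _ _ _ uF); right.
  case: m mk uF => [|m] mk uF; first by case: a2 => _ H; apply: (H _ _ _ uF); right; right.
  by have [_ _ _ H _] := am m.+3 isT (ltnW mk); apply: H.
have Nk u : u \in A -> edge (c 0) u -> u = c k.-1 \/ u = c 1.
  move=> uA; rewrite -ck -{1}(prednK k0) => /(N _ _ uA).
  by rewrite !prednK // ck1 ck (negbTE ns0) => -[->|->|[]//]; auto.
have e0k : edge (c 0) (c k.-1) by rewrite edgeC -ck -{2}(prednK k0).
have big m : 2 < m -> m < k -> sol (c m) by move=> m2 mk; case: (Hs m _ mk) => //; lia.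
exists f'; split=> //.
apply: (extend (B := B) (S := S) (Z := Zb)) => //.
- by apply/subsetP=> v /csetP[i _ ->].
- exact: eq_good gf.
- by move=> v /csetP[i _ ->].
- move=> v u /csetP[i _ ->] uA; rewrite -(per.1 i) -(prednK k0) addnS => /(N _ _ uA)[->|->|[_ uF]].
  + exact: nesym.
  + exact: fn.
  + exact: fF.
- move=> v /csetP[i ik ->] _ _; case: i ik => [|[|[|i]]] ik.
  + exists (c k.-1), (c 1); split=> //; exact: nesym.
  + have [s1|ns1] := boolP (sol (c 1)).
      have [u Eu eu] := solF 1 s1; have uF : u \in F (c 1) by rewrite Eu mem_head.
      exists (c 2), u; split=> //; first by apply/sBA/(FB 1).
      by case: a2 => _ H; apply: (H _ _ _ uF); left.
    have k3' : k = 3 by case: (Hs 1 isT ik) => [|//|[]//]; rewrite (negbTE ns1).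
    exists (c 0), (c 2); split=> //; first by rewrite edgeC.
    have c30 : c 3 = c 0 by rewrite -ck k3'.
    by have := fn 2; rewrite c30 => /nesym.
  + have [s1|ns1] := boolP (sol (c 2)).
      have [u Eu eu] := solF 2 s1; have uF : u \in F (c 2) by rewrite Eu mem_head.
      exists (c 1), u; split=> //; [by apply/sBA/(FB 2)|by rewrite edgeC|exact: (fb 2)].
    exists (c 1), (c 3); split=> //; first by rewrite edgeC.
    case: (Hs 2 isT ik) => [|k3'|[k4 _]]; first by rewrite (negbTE ns1).
      have c30 : c 3 = c 0 by rewrite -ck k3'.
      by rewrite c30; case: a0 => _ /nesym.
    by have [//||_ _ _ _ H] := am 3; [rewrite k4|apply: nesym; apply: H; rewrite k4].
  + have [u Eu eu] := solF i.+3 (big i.+3 isT ik); have uF : u \in F (c i.+3) by rewrite Eu mem_head.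
    exists (c i.+2), u; split=> //; [by apply/sBA/(FB i.+3)|by rewrite edgeC|exact: (fb i.+3)].
- move=> u uB uZ gt1; have uZb : u \notin Zb by apply: contra uZ; apply: (subsetP ZZ).
  have [[s sS us]|no] := classic (exists2 s, s \in S & edge u s); last first.
    by left; rewrite -(@nb_off _ A S) // => s sS _ us; apply: no; exists s.
  case/csetP: sS us => i _ -> us; case: (Hout u _ uB us uZ) => [|[j [e1 e2]]]; first by left.
  by right; exists (c j), (c j.+1).
- move=> X v pf XA cX vS; have inA := subsetP XA.
  (* The cycle is broken at [c 0]. Cores are then excluded from [c k.-1] downwards to [c 3], next at
     [c 2], and last at [c 1], which has lost both cycle neighbours. *)
  have x0 : c 0 \notin X.
    by apply: (deg2_notin (a := c k.-1) (b := c 1) pf XA cX) => [u /inA|]; [apply: Nk|exact: nesym].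
  have xm m : forall i, i + m = k -> 2 < i -> c i \notin X.
    elim: m => [|m IHm] i Ei i2; first by rewrite addn0 in Ei; rewrite Ei ck.
    have xi : c i.+1 \notin X by apply: IHm; lia.
    have ik : i < k by lia.
    have [u Eu eu] := solF i (big i i2 ik).
    apply: (deg2_notin (a := c i.-1) (b := u) pf XA cX) => [w wX|]; last by apply: (fb i) => //; [lia|rewrite Eu mem_head].
    have Ei1 : i = i.-1.+1 by lia.
    rewrite {1}Ei1 => /(N _ _ (inA _ wX))[->|E|[_]]; first by left.
      by move: xi; rewrite Ei1 -E wX.
    by rewrite -Ei1 Eu inE => /eqP->; right.
  have x3 : c 3 \notin X by apply: (xm (k - 3)); lia.
  have x2 : c 2 \notin X.
    have [s1|ns1] := boolP (sol (c 2)).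
      have [u Eu eu] := solF 2 s1.
      apply: (deg2_notin (a := c 1) (b := u) pf XA cX) => [w wX|]; last by apply: (fb 2) => //; rewrite Eu mem_head.
      case/(N _ _ (inA _ wX))=> [->|E|[_]]; [by left|by move: x3; rewrite -E wX|].
      by rewrite Eu inE => /eqP->; right.
    apply: (deg2_notin (a := c 1) (b := c 2) pf XA cX) => [w wX|]; last by case: a1.
    by case/(N _ _ (inA _ wX))=> [->|E|[]]; [by left|by move: x3; rewrite -E wX|rewrite (negbTE ns1)].
  have x1 : c 1 \notin X.
    have [s1|ns1] := boolP (sol (c 1)).
      have [u Eu eu] := solF 1 s1.
      apply: (deg2_notin (a := c 1) (b := u) pf XA cX) => [w wX|]; last by apply: (fF 1); rewrite Eu mem_head.
      case/(N _ _ (inA _ wX))=> [E|E|[_]]; [by move: x0; rewrite -E wX|by move: x2; rewrite -E wX|].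
      by rewrite Eu inE => /eqP->; right.
    apply: (deg2_notin (a := c 1) (b := c 2) pf XA cX) => [w wX|]; last by case: a1.
    by case/(N _ _ (inA _ wX))=> [E|E|[]]; [by move: x0; rewrite -E wX|by move: x2; rewrite -E wX|rewrite (negbTE ns1)].
  case/csetP: vS => i ik ->; case: i ik => [|[|[|i]]] ik //.
  by apply: (xm (k - i.+3)); lia.
Qed.
End NonsolidCycle.

(* Colours for the two centres and three leaves of a K_{2,3}; [phi] holds the colour shared
   by two outer neighbours of leaves, [T] the colours seen by the third of these. *)
Lemma K23_choice (C : choiceType) (Lx Lx' L1 L2 L3 : {fset C}) (f1 f2 f3 phi T : seq C) (b : bool) :
  [/\ #|` Lx| = 4, #|` Lx'| = 4, #|` L1| = 4, #|` L2| = 4 & #|` L3| = 4] ->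
  [/\ size f1 <= 1, size f2 <= 1, size f3 <= 1, size phi <= 1 & size T <= 2] ->
  exists x x' y1 y2 y3,
    [/\ [/\ x \in Lx, x' \in Lx', y1 \in L1, y2 \in L2 & y3 \in L3],
        [/\ x <> x', y1 <> y2 & x' \notin phi],
        [/\ y1 \notin x :: x' :: f1, y2 \notin x :: x' :: f2 & y3 \notin x :: x' :: f3] &
        [\/ x \notin phi, y3 <> y1 /\ y3 <> y2, y3 \notin T | ~~ (b && (x \in f3))]].
Proof.
move=> [cx cx' c1 c2 c3] [s1 s2 s3 sp sT]; apply: NNPP => no.
have pick (M : {fset C}) s : #|` M| = 4 -> size s <= 3 -> exists2 v, v \in M & v \notin s.
  by move=> cM s3'; apply: fset_fresh; rewrite cM ltnS.
(* When both centres avoid [phi] the third leaf is unrestricted, so failure means that any two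
   admissible colours of the first two leaves coincide. *)
have key x x' y y' : x \in Lx -> x \notin phi -> x' \in Lx' -> x' \notin phi -> x <> x' ->
  y \in L1 -> y \notin x :: x' :: f1 -> y' \in L2 -> y' \notin x :: x' :: f2 -> y = y'.
  move=> hx px hx' px' xx' hy ny hy' ny'; apply: NNPP => yy'; apply: no.
  have [|y3 hy3 ny3] := pick L3 (x :: x' :: f3) c3; first exact: s3.
  by exists x, x', y, y', y3; split=> //; constructor 1.
have [|x0 hx0 px0] := pick Lx phi cx; first exact: leq_trans sp _.
have [|x1 hx1 px1] := pick Lx' (x0 :: phi) cx'; first exact: leq_trans sp _.
move: px1; rewrite in_cons negb_or => /andP[x10 px1].
have [|s hs ns] := pick L1 (x0 :: x1 :: f1) c1; first exact: s1.
have [|s' hs' ns'] := pick L2 (x0 :: x1 :: f2) c2; first exact: s2.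
have x01 : x0 <> x1 by apply/eqP; rewrite eq_sym.
have Es : s = s' by apply: (key x0 x1).
rewrite -{s'}Es in hs' ns'; pose Y := [:: x0; x1; s].
have uY : uniq Y.
  by move: ns; rewrite /= !inE !negb_or => /and3P[a1 a2 _]; rewrite eq_sym x10 eq_sym a1 eq_sym a2.
(* Failure squeezes lists, less one colour, into the three colours [Y]; as four minus one is three,
   all of [Y] is then available. *)
have full (M : {fset C}) g : #|` M| = 4 -> size g <= 1 -> (forall v, v \in M -> v \notin g -> v \in Y) ->
  forall a, a \in Y -> a \in M /\ a \notin g.
  move=> cM sg H a aY; have [|v vM] := pick M (g ++ rem a Y) cM.
    by rewrite size_cat size_rem //; apply: (leq_add sg (leqnn 2)).
  rewrite mem_cat negb_or => /andP[vg vr]; have vY := H v vM vg.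
  suff <- : v = a by [].
  by apply/eqP; apply: contraNT vr => va; rewrite mem_rem_uniq // inE va vY.
have Y1 := full L1 f1 c1 s1; have Y2 := full L2 f2 c2 s2.
have {}Y1 a : a \in Y -> a \in L1 /\ a \notin f1.
  apply: Y1 => v vM vg; rewrite !inE; case: eqP => //= v0; case: eqP => //= v1.
  by apply/eqP; apply: (key x0 x1) => //; rewrite !inE !negb_or vg andbT; apply/andP; split; apply/eqP.
have {}Y2 a : a \in Y -> a \in L2 /\ a \notin f2.
  apply: Y2 => v vM vg; rewrite !inE; case: eqP => //= v0; case: eqP => //= v1.
  by apply/eqP/esym; apply: (key x0 x1) => //; rewrite !inE !negb_or vg andbT; apply/andP; split; apply/eqP.
have two x' : exists y y', [/\ y \in Y, y' \in Y, y <> y', y <> x' & y' <> x'].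
  move: uY; rewrite /= !inE !negb_or andbT => /andP[/andP[/eqP a1 /eqP a2] /eqP a3].
  have [E|/eqP n0] := eqVneq x0 x'.
    by exists x1, s; rewrite -E !inE !eqxx ?orbT; split=> //; apply: nesym.
  have [E|/eqP n1] := eqVneq x1 x'.
    by exists x0, s; rewrite -E !inE !eqxx ?orbT; split=> //; apply: nesym.
  by exists x0, x1; rewrite !inE !eqxx ?orbT.
have out x x' y (f : seq C) : y \notin f -> y <> x -> y <> x' -> y \notin x :: x' :: f.
  by move=> yf yx yx'; rewrite !inE !negb_or yf andbT; apply/andP; split; apply/eqP.
have X1 x : x \in Lx -> x \notin phi -> x \in Y.
  move=> hx px; apply/negPn/negP => xY.
  have [|x' hx'] := pick Lx' (x :: phi) cx'; first exact: leq_trans sp _.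
  rewrite in_cons negb_or => /andP[/eqP xx' px'].
  have [y [y' [yY yY' yy' yx yx']]] := two x'; apply: yy'.
  have nx z : z \in Y -> z <> x by move=> zY E; rewrite -E zY in xY.
  have [a1 a2] := Y1 y yY; have [b1 b2] := Y2 y' yY'.
  by apply: (key x x') => //; [apply: nesym|apply: out => //; apply: nx|apply: out => //; apply: nx].
have X3 x : x \in Lx' -> x \notin phi -> x \in Y.
  move=> hx px; apply/negPn/negP => xY.
  have [|x' hx'] := pick Lx (x :: phi) cx; first exact: leq_trans sp _.
  rewrite in_cons negb_or => /andP[/eqP xx' px'].
  have [y [y' [yY yY' yy' yx yx']]] := two x'; apply: yy'.
  have nx z : z \in Y -> z <> x by move=> zY E; rewrite -E zY in xY.
  have [a1 a2] := Y1 y yY; have [b1 b2] := Y2 y' yY'.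
  by apply: (key x' x) => //; [apply: out => //; apply: nx|apply: out => //; apply: nx].
have Y3 := full Lx' phi cx' sp X3.
(* The list of the first centre has a fourth colour outside [Y], which can only be the repeated
   outer colour. *)
have [p pL pY] := pick Lx Y cx isT.
have pphi : p \in phi by apply/negPn/negP => np; move: pY; rewrite (X1 p).
have Ephi : phi = [:: p] by move: pphi sp; case: phi {px0 px1 key no X1 X3 Y3} => [|q [|]] //; rewrite inE => /eqP->.
have nYp z : z \in Y -> z <> p by move=> zY E; rewrite -E zY in pY.
(* the first centre gets the repeated colour [p] *)
have fin x' y1 y2 y3 : x' \in Y -> y1 \in Y -> y2 \in Y -> y1 <> y2 -> y1 <> x' -> y2 <> x' ->
  y3 \in L3 -> y3 \notin p :: x' :: f3 ->
  [\/ y3 <> y1 /\ y3 <> y2, y3 \notin T | ~~ (b && (p \in f3))] -> False.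
  move=> hx' h1 h2 n12 n1 n2 h3 n3 H; apply: no.
  have [a1 a2] := Y1 y1 h1; have [b1 b2] := Y2 y2 h2; have [d1 d2] := Y3 x' hx'.
  exists p, x', y1, y2, y3; split=> //.
  - by split=> //; apply: nesym; apply: nYp.
  - by split=> //; apply: out => //; apply: nYp.
  - by case: H => H; [constructor 2|constructor 3|constructor 4].
have x1Y : x1 \in Y by rewrite !inE eqxx orbT.
have [y1 [y2 [h1 h2 n12 n1 n2]]] := two x1.
have [|nb] := boolP (b && (p \in f3)); last first.
  have [|y3 hy3 ny3] := pick L3 (p :: x1 :: f3) c3; first exact: s3.
  by apply: (fin x1 y1 y2 y3) => //; constructor 3.
case/andP=> bT pf3; have Ef3 : f3 = [:: p] by move: pf3 s3; case: (f3) => [|q [|]] //; rewrite inE => /eqP->.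
have [[v vL vn]|nv] := classic (exists2 v, v \in L3 & v \notin p :: Y).
  move: vn; rewrite in_cons negb_or => /andP[/eqP vp vY].
  have nvY z : z \in Y -> v <> z by move=> zY E; rewrite E zY in vY.
  apply: (fin x1 y1 y2 v) => //; last by constructor 1; split; apply: nvY.
  by apply: out => //; [rewrite Ef3 inE; apply/eqP|apply: nvY].
have YL3 : forall a, a \in Y -> a \in L3 /\ a \notin [:: p].
  apply: full => // v vL; rewrite inE => vp; apply/negPn/negP => vY; apply: nv; exists v => //.
  by rewrite in_cons negb_or vp vY.
have [t tY tT] : exists2 t, t \in Y & t \notin T.
  case: (boolP (all (fun z => z \in T) Y)) => [/allP H|]; last by case/allPn=> t; exists t.
  by have := uniq_leq_size uY H; rewrite leqNgt ltnS sT.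
have [x' [_ [hx' _ _ xt _]]] := two t; have [z1 [z2 [hz1 hz2 z12 zx1 zx2]]] := two x'.
have [tL tp] := YL3 t tY.
apply: (fin x' z1 z2 t) => //; last by constructor 2.
by apply: out; [rewrite Ef3|apply: nYp|apply: nesym].
Qed.

(** Two different repeated values would need four entries. *)
Lemma repeated_color (T : eqType) (a b c : option T) : exists s : seq T, size s <= 1 /\
  forall x, (a = Some x /\ b = Some x) \/ (a = Some x /\ c = Some x) \/ (b = Some x /\ c = Some x) ->
  x \in s.
Proof.
case: a => [a|]; case: b => [b|]; case: c => [c|].
- have [ab|/eqP ab] := eqVneq a b.
    by exists [:: a]; split=> // x; rewrite inE => -[[[<-] _]|[[[<-] _]|[[<-] _]]]; rewrite ?ab.
  have [bc|/eqP bc] := eqVneq b c.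
    exists [:: b]; split=> // x; rewrite inE => -[[[<-] [E]]|[[[<-] [E]]|[[<-] _]]] //; first by case: ab.
    by case: ab; rewrite bc E.
  exists [:: a]; split=> // x; rewrite inE => -[[[<-] _]|[[[<-] _]|[[<-] [E]]]] //; by case: bc.
- by exists [:: a]; split=> // x; rewrite inE => -[[[<-] _]|[[_ //]|[_ //]]].
- by exists [:: a]; split=> // x; rewrite inE => -[[_ //]|[[[<-] _]|[//]]].
- by exists [::]; split=> // x -[[_ //]|[[_ //]|[//]]].
- by exists [:: b]; split=> // x; rewrite inE => -[[//]|[[//]|[[<-]]]].
- by exists [::]; split=> // x -[[//]|[[//]|[_ //]]].
- by exists [::]; split=> // x -[[//]|[[//]|[//]]].
- by exists [::]; split=> // x -[[//]|[[//]|[//]]].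
Qed.

(** * Colouring a deleted K_{2,3} *)

Section K23.
Variables (G : sgraph) (C : choiceType) (L : G -> {fset C}) (A : {set G}).
Hypothesis hG : subcubic G.
Hypothesis L4 : forall v, #|` L v| = 4.

(** A core through a centre uses two leaves of one colour and leaves through their outer neighbours,
    which have the colour of the centre. As the first two leaves differ, the third is one of these,
    and the centre has the repeated outer colour; the alternatives in [K23_choice] exclude this. *)
Lemma color_K23 c1 c3 y1 y2 y3 (F1 F2 F3 : seq G) (s1 s2 s3 : bool) (Zb Z : {set G}) f :
  uniq [:: c1; c3; y1; y2; y3] -> {subset [:: c1; c3; y1; y2; y3] <= A} ->
  [/\ edge c1 y1, edge c1 y2 & edge c1 y3] -> [/\ edge c3 y1, edge c3 y2 & edge c3 y3] ->
  (forall u, u \in A -> edge c1 u -> [\/ u = y1, u = y2 | u = y3]) ->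
  (forall u, u \in A -> edge c3 u -> [\/ u = y1, u = y2 | u = y3]) ->
  (forall u, u \in A -> edge y1 u -> [\/ u = c1, u = c3 | s1 /\ u \in F1]) ->
  (forall u, u \in A -> edge y2 u -> [\/ u = c1, u = c3 | s2 /\ u \in F2]) ->
  (forall u, u \in A -> edge y3 u -> [\/ u = c1, u = c3 | s3 /\ u \in F3]) ->
  [/\ size F1 <= 1, size F2 <= 1 & size F3 <= 1] ->
  {subset F1 ++ F2 ++ F3 <= A :\: [set x in [:: c1; c3; y1; y2; y3]]} ->
  (forall u, u \in F3 -> s3 -> [/\ edge u y3, ~~ edge u y1 & ~~ edge u y2]) ->
  good L Zb (A :\: [set x in [:: c1; c3; y1; y2; y3]]) f -> Zb \subset Z ->
  (forall u s, u \in A :\: [set x in [:: c1; c3; y1; y2; y3]] -> s \in [:: y1; y2; y3] ->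
     edge u s -> u \notin Z ->
     1 < #|nb (A :\: [set x in [:: c1; c3; y1; y2; y3]]) u| \/ (edge u y1 /\ edge u y2)) ->
  exists f', [/\ good L Z A f', f' y1 <> f' y2 & [/\ forall u, u \in F1 -> f' y1 <> f' u,
    forall u, u \in F2 -> f' y2 <> f' u & forall u, u \in F3 -> f' y3 <> f' u]].
Proof.
move=> un sA [e11 e12 e13] [e31 e32 e33] Nc1 Nc3 N1 N2 N3 [z1 z2 z3] FB priv gf ZZ Hout.
set S := [set x in _] in FB gf Hout; set B := A :\: S in FB gf Hout.
have mS x : (x \in S) = (x \in [:: c1; c3; y1; y2; y3]) by rewrite in_set.
have sBA u : u \in B -> u \in A by rewrite inE => /andP[].
have nB u x : u \in B -> x \in [:: c1; c3; y1; y2; y3] -> u <> x.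
  by move=> + xS E; rewrite inE E mS xS.
have [c1S c3S y1S y2S y3S] : [/\ c1 \in [:: c1; c3; y1; y2; y3], c3 \in [:: c1; c3; y1; y2; y3],
  y1 \in [:: c1; c3; y1; y2; y3], y2 \in [:: c1; c3; y1; y2; y3] & y3 \in [:: c1; c3; y1; y2; y3]].
  by split; rewrite !inE eqxx ?orbT.
have [F1B F2B F3B] : [/\ {subset F1 <= B}, {subset F2 <= B} & {subset F3 <= B}].
  by split=> u uF; apply: FB; rewrite !mem_cat uF ?orbT.
(* Only an outer neighbour actually present in [A] can carry a core onwards, hence the option. *)
pose g (s : bool) (F : seq G) := if s then ohead (map f F) else None.
have gP (s : bool) (F : seq G) u : size F <= 1 -> s -> u \in F -> g s F = Some (f u).
  by rewrite /g => + ->; case: F => [|v [|]] //= _; rewrite inE => /eqP->.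
have [phi [sphi Hphi]] := repeated_color (g s1 F1) (g s2 F2) (g s3 F3).
(* The third outer neighbour has lost [y3], so at most two colours are seen around it. If [F3] is
   empty, the default [y3] also has at most two neighbours in [B]. *)
pose T := if s3 then [seq f w | w <- enum (nb B (head y3 F3))] else [::].
have sT : size T <= 2.
  rewrite /T; case: ifP => // s3T; rewrite size_map -cardE.
  case EF : F3 => [|z F3'] /=.
    have H : #|nb B y3| <= #|[set c1; c3]|.
      apply/subset_leq_card/subsetP=> u; rewrite in_nb => /andP[uB] /(N3 u (sBA _ uB))[->|->|[_]].
      - by rewrite !inE eqxx.
      - by rewrite !inE eqxx orbT.
      - by rewrite EF.
    by apply: leq_trans H _; rewrite cards2; case: eqP.
  have zF : z \in F3 by rewrite EF mem_head.
  have [zy _ _] := priv z zF s3T.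
  have : #|nb B z| < #|nb A z|.
    apply: proper_card; rewrite properE nbS ?subsetDl //=; apply/subsetPn; exists y3.
      by rewrite in_nb zy sA.
    by rewrite in_nb inE mS y3S.
  by move/leq_trans => /(_ _ (deg_le3 hG A z)).
have sm (F : seq G) : size F <= 1 -> size (map f F) <= 1 by rewrite size_map.
have [x [x' [v1 [v2 [v3 [[xL xL' v1L v2L v3L] [xx' v12 xphi] [o1 o2 o3] H]]]]]] :=
  @K23_choice _ (L c1) (L c3) (L y1) (L y2) (L y3) (map f F1) (map f F2) (map f F3) phi T s3
   (And5 (L4 _) (L4 _) (L4 _) (L4 _) (L4 _)) (And5 (sm _ z1) (sm _ z2) (sm _ z3) sphi sT).
pose f' u := if u == c1 then x else if u == c3 then x' else if u == y1 then v1 else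
  if u == y2 then v2 else if u == y3 then v3 else f u.
move: (un); rewrite /= !inE !negb_or !andbT => /and4P[/and4P[u1 u2 u3 u4] /and3P[u5 u6 u7] /andP[u8 u9] u10].
have fc1 : f' c1 = x by rewrite /f' eqxx.
have fc3 : f' c3 = x' by rewrite /f' eq_sym (negbTE u1) eqxx.
have fy1 : f' y1 = v1 by rewrite /f' eq_sym (negbTE u2) eq_sym (negbTE u5) eqxx.
have fy2 : f' y2 = v2 by rewrite /f' eq_sym (negbTE u3) eq_sym (negbTE u6) eq_sym (negbTE u8) eqxx.
have fy3 : f' y3 = v3.
  by rewrite /f' eq_sym (negbTE u4) eq_sym (negbTE u7) eq_sym (negbTE u9) eq_sym (negbTE u10) eqxx.
have fB : {in B, f =1 f'}.
  move=> u uB; have nu x0 : x0 \in [:: c1; c3; y1; y2; y3] -> (u == x0) = false.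
    by move=> x0S; apply/eqP; apply: nB.
  by rewrite /f' !nu.
have o1' : [/\ v1 <> x, v1 <> x' & forall u, u \in F1 -> v1 <> f u].
  move: o1; rewrite !inE !negb_or => /and3P[/eqP ? /eqP ? nf]; split=> // u uF E.
  by move: nf; rewrite E map_f.
have o2' : [/\ v2 <> x, v2 <> x' & forall u, u \in F2 -> v2 <> f u].
  move: o2; rewrite !inE !negb_or => /and3P[/eqP ? /eqP ? nf]; split=> // u uF E.
  by move: nf; rewrite E map_f.
have o3' : [/\ v3 <> x, v3 <> x' & forall u, u \in F3 -> v3 <> f u].
  move: o3; rewrite !inE !negb_or => /and3P[/eqP ? /eqP ? nf]; split=> // u uF E.
  by move: nf; rewrite E map_f.
have [a1 a2 a3] := o1'; have [b1 b2 b3] := o2'; have [d1 d2 d3] := o3'.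
have fF1 u : u \in F1 -> f' y1 <> f' u by move=> uF; rewrite fy1 -fB; [apply: a3|apply: F1B].
have fF2 u : u \in F2 -> f' y2 <> f' u by move=> uF; rewrite fy2 -fB; [apply: b3|apply: F2B].
have fF3 u : u \in F3 -> f' y3 <> f' u by move=> uF; rewrite fy3 -fB; [apply: d3|apply: F3B].
have SP v : v \in S -> v = c1 \/ v = c3 \/ v = y1 \/ v = y2 \/ v = y3.
  by rewrite mS !inE => /or4P[/eqP->|/eqP->|/eqP->|/orP[]/eqP->]; tauto.
have [c1A c3A] : c1 \in A /\ c3 \in A by split; apply: sA.
have [y1A y2A y3A] : [/\ y1 \in A, y2 \in A & y3 \in A] by split; apply: sA.
exists f'; split=> //; last by rewrite fy1 fy2.
apply: (extend (B := B) (S := S) (Z := Zb)) => //.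
- by apply/subsetP=> v; rewrite mS; apply: sA.
- exact: eq_good gf.
- by move=> v /SP[->|[->|[->|[->|->]]]]; rewrite ?fc1 ?fc3 ?fy1 ?fy2 ?fy3.
- move=> v u /SP[->|[->|[->|[->|->]]]] uA.
  + by case/(Nc1 u uA)=> ->; rewrite fc1 ?fy1 ?fy2 ?fy3; apply: nesym.
  + by case/(Nc3 u uA)=> ->; rewrite fc3 ?fy1 ?fy2 ?fy3; apply: nesym.
  + by case/(N1 u uA)=> [->|->|[_ uF]]; rewrite ?fc1 ?fc3 ?fy1 //; rewrite -fy1; apply: fF1.
  + by case/(N2 u uA)=> [->|->|[_ uF]]; rewrite ?fc1 ?fc3 ?fy2 //; rewrite -fy2; apply: fF2.
  + by case/(N3 u uA)=> [->|->|[_ uF]]; rewrite ?fc1 ?fc3 ?fy3 //; rewrite -fy3; apply: fF3.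
- move=> v /SP[->|[->|[->|[->|->]]]] _ _.
  + by exists y1, y2; rewrite fy1 fy2.
  + by exists y1, y2; rewrite fy1 fy2.
  + by exists c1, c3; rewrite fc1 fc3; split=> //; rewrite edgeC.
  + by exists c1, c3; rewrite fc1 fc3; split=> //; rewrite edgeC.
  + by exists c1, c3; rewrite fc1 fc3; split=> //; rewrite edgeC.
- move=> u uB uZ gt1; have uZb : u \notin Zb by apply: contra uZ; apply: (subsetP ZZ).
  have [[s sS us]|no] := classic (exists2 s, s \in S & edge u s); last first.
    by left; rewrite -(@nb_off _ A S) // => s sS _ us; apply: no; exists s.
  have uA := sBA _ uB.
  have sy : s \in [:: y1; y2; y3].
    case/SP: sS us => [->|[->|[->|[->|->]]]] us; rewrite ?inE ?eqxx ?orbT //; rewrite edgeC in us.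
      by case: (Nc1 u uA us) => E; case: (nB u u uB) => //; rewrite E.
    by case: (Nc3 u uA us) => E; case: (nB u u uB) => //; rewrite E.
  case: (Hout u s uB sy us uZ) => [|[h1 h2]]; first by left.
  by right; exists y1, y2; rewrite fy1 fy2.
- move=> X v pf XA cX vS; have inA := subsetP XA.
  have leaf y (s : bool) (F : seq G) c : size F <= 1 -> {subset F <= B} -> (c = c1 \/ c = c3) -> edge c y ->
    (forall u, u \in A -> edge y u -> [\/ u = c1, u = c3 | s /\ u \in F]) ->
    c \in X -> y \in X -> exists z, [/\ z \in X, z \in F, s & g s F = Some (f' c)].
    move=> zF FB' cc cy Ny cX' yX; rewrite edgeC in cy.
    case: (core_pair pf XA cX yX) => u [w [uX wX uw yu [yw _]]].
    have same z : z \in X -> edge y z -> f' z = f' c by move=> zX yz; apply: (core_same pf XA cX yX).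
    have oth z : z \in X -> edge y z -> z = c \/ (s /\ z \in F).
      move=> zX yz; have := same z zX yz; case: (Ny z (inA _ zX) yz) => [->|->|]; auto.
        by case: cc => -> ; auto; rewrite fc1 fc3.
      by case: cc => -> ; auto; rewrite fc1 fc3 => /esym.
    have fin z : z \in X -> edge y z -> s /\ z \in F -> exists z, [/\ z \in X, z \in F, s & g s F = Some (f' c)].
      move=> zX yz [sT' zF']; exists z; split=> //; rewrite (gP s F z) //; congr Some.
      by rewrite -(same z zX yz) fB //; apply: FB'.
    case: (oth u uX yu) => [Eu|]; last exact: fin.
    case: (oth w wX yw) => [Ew|]; last exact: fin.
    by case: uw; rewrite Eu Ew.
  have noc c : (c = c1 \/ c = c3) -> c \notin X.
    move=> cc; apply/negP => cX'.
    have cy i : i \in [:: y1; y2; y3] -> edge c i by rewrite !inE => /or3P[]/eqP->; case: cc => ->.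
    have l1 : y1 \in X -> exists z, [/\ z \in X, z \in F1, s1 & g s1 F1 = Some (f' c)].
      by apply: (leaf y1 s1 F1 c) => //; apply: cy; rewrite !inE eqxx.
    have l2 : y2 \in X -> exists z, [/\ z \in X, z \in F2, s2 & g s2 F2 = Some (f' c)].
      by apply: (leaf y2 s2 F2 c) => //; apply: cy; rewrite !inE eqxx orbT.
    have l3 : y3 \in X -> exists z, [/\ z \in X, z \in F3, s3 & g s3 F3 = Some (f' c)].
      by apply: (leaf y3 s3 F3 c) => //; apply: cy; rewrite !inE eqxx !orbT.
    have np : y3 \in X -> (y1 \in X /\ v1 = v3) \/ (y2 \in X /\ v2 = v3) -> False.
      move=> h3 h12; have [z [zX zF s3T g3]] := l3 h3.
      have fphi : f' c \in phi.
        apply: Hphi; case: h12 => -[h _]; [have [? [_ _ _ ->]] := l1 h|have [? [_ _ _ ->]] := l2 h]; rewrite g3; tauto.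
      have cx : f' c = x by move: fphi; case: cc => ->; rewrite ?fc1 // fc3 (negbTE xphi).
      case: H => [xphi'|[n1 n2]|n3|nb3].
      - by move: fphi; rewrite cx (negbTE xphi').
      - by case: h12 => -[_ E]; [apply: n1|apply: n2].
      - have [zy ny1 ny2] := priv z zF s3T.
        case: (core_pair pf XA cX zX) => u [w [uX wX uw zu [zw _]]].
        have [q [qX zq qy]] : exists q, [/\ q \in X, edge z q & q <> y3].
          have [E|/eqP ne] := eqVneq u y3; last by exists u.
          by exists w; split=> //; rewrite -E; apply: nesym.
        have fq : f' q = v3 by rewrite -fy3; apply: (core_same pf XA cX zX).
        have zB := F3B z zF; have zA := sBA _ zB.
        have qB : q \in B.
          rewrite inE (inA _ qX) andbT; apply/negP => /SP[E|[E|[E|[E|E]]]] //; rewrite E in zq.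
          + by rewrite edgeC in zq; case: (Nc1 z zA zq) => E'; case: (nB z z zB) => //; rewrite E'.
          + by rewrite edgeC in zq; case: (Nc3 z zA zq) => E'; case: (nB z z zB) => //; rewrite E'.
          + by rewrite zq in ny1.
          + by rewrite zq in ny2.
        move: n3; rewrite /T s3T; apply/negP; rewrite negbK -fq -fB //; apply: map_f.
        rewrite mem_enum in_nb qB /=; move: zF z3; case: (F3) => [|z' [|]] //=; by rewrite inE => /eqP<-.
      - move: nb3; rewrite s3T /= => /negP; apply; move: g3; rewrite /g s3T cx.
        by case: (F3) => [|z' F3'] //= [->]; rewrite mem_head.
    case: (core_pair pf XA cX cX') => u [w [uX wX uw cu [cw fuw]]].
    have is3 q : q \in X -> edge c q -> [\/ q = y1, q = y2 | q = y3].
      by move=> qX; case: cc => ->; [apply: Nc1|apply: Nc3]; apply: inA.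
    case: (is3 u uX cu) => Eu; case: (is3 w wX cw) => Ew; rewrite Eu Ew ?fy1 ?fy2 ?fy3 in uX wX uw fuw => //.
    - by apply: np => //; left.
    - by case: v12.
    - by apply: np => //; right.
    - by apply: np => //; left.
    - by apply: np => //; right.
  have nl y (s : bool) (F : seq G) : size F <= 1 -> (forall u, u \in A -> edge y u -> [\/ u = c1, u = c3 | s /\ u \in F]) -> y \notin X.
    move=> zF Ny; apply/negP => yX; case: (core_pair pf XA cX yX) => u [w [uX wX uw yu [yw _]]].
    have inF q : q \in X -> edge y q -> q \in F.
      move=> qX yq; case: (Ny q (inA _ qX) yq) => [E|E|[]//]; move: qX; rewrite E (negbTE (noc _ _)) //; tauto.
    move: (inF u uX yu) (inF w wX yw) zF; case: (F) => [|q [|]] //; rewrite !inE => /eqP Eu /eqP Ew _.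
    by apply: uw; rewrite Eu Ew.
  case/SP: vS => [->|[->|[->|[->|->]]]].
  + by apply: noc; left.
  + by apply: noc; right.
  + exact: (nl y1 s1 F1).
  + exact: (nl y2 s2 F2).
  + exact: (nl y3 s3 F3).
Qed.
End K23.

(** * Shortest cycles *)

Section Existence.
Variables (G : sgraph) (A : {set G}).
Hypothesis mindeg : forall v, v \in A -> 1 < #|nb A v|.

(** A walk that never turns back repeats a vertex. A return in the least number [n] of steps is a
    cycle, as [n] equal to 1 or 2 would mean a loop or turning back. *)
Lemma cycle_exists v0 : v0 \in A -> exists k c, iscyc A k c.
Proof.
move=> v0A.
pose stp (ab : G * G) : G * G := (ab.2, odflt ab.2 [pick x in nb A ab.2 :\ ab.1]).
have stpP a b : b \in A -> [/\ (stp (a, b)).2 \in A, edge b (stp (a, b)).2 & (stp (a, b)).2 <> a].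
  move=> bA; rewrite /stp /=; case: pickP => [x|no] /=.
    by rewrite in_setD1 in_nb => /and3P[/eqP xa xA bx].
  have [w [wA bw wa]] := nb_other a (mindeg bA).
  by move: (no w); rewrite in_setD1 in_nb wA bw !andbT => /negbFE/eqP.
have [v1 [_ [v1A _ e01 _ _]]] := nb_gt1P (mindeg v0A).
pose W i := iter i stp (v0, v1); pose w i := (W i).1.
have WP i : (W i).1 \in A /\ (W i).2 \in A /\ edge (W i).1 (W i).2.
  elim: i => [|i [a1 [a2 e]]] //=.
  by case: (stpP (W i).1 (W i).2 a2); rewrite -surjective_pairing.
have w1 i : w i.+1 = (W i).2 by [].
have wA i : w i \in A by case: (WP i).
have we i : edge (w i) (w i.+1) by rewrite w1; case: (WP i) => _ [].
have w2 i : w i.+2 <> w i.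
  rewrite w1 /W iterS -/(W i) /w; case: (WP i) => _ [a2 _].
  by case: (stpP (W i).1 (W i).2 a2); rewrite -surjective_pairing.
have [n [[n0 [i Ei]] minn]] : exists n, (0 < n /\ exists i, w i = w (i + n)) /\
    forall m, (0 < m /\ exists i, w i = w (i + m)) -> n <= m.
  apply: min_nat; apply: NNPP => no.
  have inj : injective (fun i : 'I_(#|G|.+1) => w i).
    move=> a b E; apply: val_inj => /=; apply: NNPP => ne; apply: no.
    case: (ltngtP a b) => lt; last by case: ne.
      by exists (b - a); split; [lia|exists a; rewrite E; congr w; lia].
    by exists (a - b); split; [lia|exists b; rewrite -E; congr w; lia].
  by have := leq_card _ inj; rewrite card_ord ltnn.
have n3 : 2 < n.
  case: n n0 Ei {minn} => [|[|[|n]]] // _ Ei.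
    by have := we i; rewrite Ei addn1 edge_irrefl.
  by case: (w2 i); rewrite Ei addn2.
exists n, (fun m => w (i + m %% n)); apply: (mkcyc (q := fun m => w (i + m))) => //.
- move=> a b ab bn E; have : n <= b - a; last by lia.
  by apply: minn; split; [lia|exists (i + a); rewrite E; congr w; lia].
- by move=> m _; rewrite addnS.
- have [m En] : exists m, n = m.+1 by exists n.-1; lia.
  by rewrite addn0 Ei En /= addnS.
Qed.
End Existence.

Section ShortestCycle.
Variables (G : sgraph) (A : {set G}) (k : nat) (c : nat -> G).
Hypothesis hG : subcubic G.
Hypothesis cyc : iscyc A k c.
Hypothesis minc : forall g c', iscyc A g c' -> k <= g.

Local Notation S := (cset k c).

Lemma sc_S i : c i \in S.
Proof. by case: cyc => k3 _ per _; apply: mem_cset => //; lia. Qed.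

Lemma sc_chord i j : i < j -> j < i + k -> edge (c i) (c j) -> j = i.+1 \/ j.+1 = i + k.
Proof.
case: (cyc) => k3 cA [per inj] ce ij jk e.
apply: NNPP => ne; suff: k <= (j - i).+1 by lia.
apply: (minc (c' := fun m => (fun n => c (i + n)) (m %% (j - i).+1))); apply: (mkcyc (q := fun n => c (i + n))).
- by lia.
- by [].
- by move=> a b ab lb; apply: inj; lia.
- by move=> m _; rewrite addnS.
- by rewrite /= addn0 subnKC 1?edgeC //; lia.
Qed.

Lemma sc_Scase v : v \in S -> exists i, v = c i.+1.
Proof.
case: (cyc) => k3 cA [per inj] ce /csetP[i ik ->]; exists (i + k.-1).
by rewrite -addnS prednK ?per //; lia.
Qed.

Lemma sc_window i v : v \in S -> exists2 m, m < k & v = c (i + m).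
Proof.
case: (cyc) => k3 cA per ce /csetP[j jk ->].
exists ((j + i * k - i) %% k); first by rewrite ltn_pmod; lia.
rewrite -(periodM per j i) -[RHS](period_mod per) modnDmr (_ : i + (j + i * k - i) = j + i * k).
  by rewrite (period_mod per).
by have := leq_pmulr i (n := k); lia.
Qed.

Lemma sc_nbS i u : u \in S -> edge (c i.+1) u -> u = c i \/ u = c i.+2.
Proof.
case: (cyc) => k3 cA [per inj] ce uS e; have [m mk Eu] := sc_window i.+1 uS.
case: (posnP m) => [m0|m0]; first by move: e; rewrite Eu m0 addn0 edge_irrefl.
rewrite Eu in e *; case: (sc_chord _ _ e) => [||E|E]; try lia.
  by right; congr c; lia.
by left; rewrite -(per i); congr c; lia.
Qed.

(** Both arcs between [c i] and [c j] close up through [u] to cycles, each with at least [k]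
    vertices. *)
Lemma sc_share u i j : u \in A -> u \notin S -> i < j -> j < i + k ->
  edge u (c i) -> edge u (c j) -> k <= j - i + 2 /\ j <= i + 2.
Proof.
case: (cyc) => k3 cA [per inj] ce uA uS ij jk ei ej.
have nu m : u <> c m by move=> E; move: uS; rewrite E sc_S.
have H a b : a < b -> b < a + k -> edge u (c a) -> edge u (c b) -> k <= b - a + 2.
  move=> ab bk ea eb; pose q n := if n is n'.+1 then c (a + n') else u.
  apply: (minc (c' := fun m => q (m %% (b - a + 2)))); apply: mkcyc; rewrite /q.
  - by lia.
  - by case.
  - by move=> [|x] [|y] // xy ly; apply: inj; lia.
  - by move=> [|m] _; rewrite ?addn0 ?addnS.
  - have -> : (b - a + 2).-1 = (b - a).+1 by lia.
    by rewrite subnKC 1?edgeC //; lia.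
split; first exact: H.
by have := H j (i + k); rewrite per; lia.
Qed.

Definition outer (v : G) : G := odflt v [pick u in nb A v :\: S].

(** For a vertex of the shortest cycle this amounts to having degree two in [A]. *)
Definition bare (v : G) : bool := nb A v \subset S.

Lemma outerP v : ~~ bare v -> [/\ outer v \in A, outer v \notin S & edge v (outer v)].
Proof.
move=> /subsetPn[x xn xS]; rewrite /outer; case: pickP => [u|/(_ x)]; last by rewrite inE xS xn.
by rewrite in_setD in_nb => /and3P[].
Qed.

Lemma sc_outer_uniq i u : u \in A -> u \notin S -> edge (c i) u -> u = outer (c i) /\ ~~ bare (c i).
Proof.
case: (cyc) => k3 cA [per inj] ce uA uS e.
have nb0 : ~~ bare (c i) by apply/subsetPn; exists u; rewrite ?in_nb ?uA.
split=> //; have [oA oS eo] := outerP nb0.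
have k0 : 0 < k by lia.
have ci : c i = c (i + k.-1).+1 by rewrite -addnS prednK.
have e1 : edge (c i) (c (i + k.-1)) by rewrite ci edgeC.
have nS x j : x \notin S -> c j <> x by move=> xS E; move: xS; rewrite -E sc_S.
case: (@nb_le3 _ A (c i) (c (i + k.-1)) (c i.+1) (outer (c i)) u) => //.
- exact: deg_le3.
- by apply: nesym; apply: inj; lia.
- exact: nS.
- exact: nS.
- by move/esym/nS; case.
- by move/esym/nS; case.
Qed.

Lemma sc_N i u : u \in A -> edge (c i.+1) u ->
  [\/ u = c i, u = c i.+2 | [/\ u \notin S, u = outer (c i.+1) & ~~ bare (c i.+1)]].
Proof.
move=> uA e; case: (boolP (u \in S)) => uS.
  by case: (sc_nbS uS e) => ->; [constructor 1|constructor 2].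
by constructor 3; have [] := sc_outer_uniq uA uS e.
Qed.

Lemma bare_deg2 i : bare (c i) -> #|nb A (c i)| = 2.
Proof.
case: (cyc) => k3 cA [per inj] ce b; have k0 : 0 < k by lia.
have ci : c i = c (i + k.-1).+1 by rewrite -addnS prednK.
rewrite ci in b *; apply: (@nb_card2 _ _ _ (c (i + k.-1)) (c (i + k.-1).+2)) => //.
- by rewrite edgeC.
- by apply: inj; lia.
- by move=> x xA e; apply: sc_nbS (e); apply: (subsetP b); rewrite in_nb xA.
Qed.

Lemma deg2_bare i : #|nb A (c i)| = 2 -> bare (c i).
Proof.
case: (cyc) => k3 cA [per inj] ce d2; apply/negPn/negP => nbi; have k0 : 0 < k by lia.
have [oA oS eo] := outerP nbi.
have ci : c i = c (i + k.-1).+1 by rewrite -addnS prednK.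
have e1 : edge (c i) (c (i + k.-1)) by rewrite ci edgeC.
case: (@nb_le2 _ A (c i) (c (i + k.-1)) (c i.+1) (outer (c i))) => //.
- by rewrite d2.
- by apply: nesym; apply: inj; lia.
- by move=> E; move: oS; rewrite E sc_S.
- by move=> E; move: oS; rewrite E sc_S.
Qed.
End ShortestCycle.

Lemma ispath2_seq (G : sgraph) (A : {set G}) x (s : seq G) : 2 <= size s -> uniq s ->
  {subset s <= A} -> sorted (@edge G) s -> #|nb A (nth x s 0)| = 2 ->
  #|nb A (nth x s (size s).-1)| = 2 -> ispath2 A (size s) (nth x s).
Proof.
move=> s2 us sA ss d0 d1; split=> //.
- by move=> i lt; apply: sA; apply: mem_nth.
- move=> i j ij jk; apply/eqP; rewrite nth_uniq //; last exact: ltn_trans ij jk.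
  by rewrite neq_ltn ij.
- by move=> i lt; move/(sortedP x): ss; apply.
Qed.

(** * Pendant neighbours of a deleted set *)

Section Pendants.
Variables (G : sgraph) (A S : {set G}).

(** Left in place, such a vertex would keep a single neighbour in the remainder and could end up
    seeing one colour. It is deleted with [S] and put back at the end, between a foot and a far end
    of different colours. *)
Definition pend : {set G} := [set p in A :\: S | (#|nb A p| == 2) &&
  ([exists v, (v \in A :&: S) && edge p v] && [exists w, (w \in A :\: S) && edge p w])].
Definition foot (p : G) : G := odflt p [pick v in nb A p :&: S].
Definition far (p : G) : G := odflt p [pick w in nb A p :\: S].
Local Notation W := [set far p | p in pend].

Lemma pendP p : p \in pend -> [/\ p \in A, p \notin S & #|nb A p| = 2].
Proof. by rewrite inE in_setD => /andP[/andP[-> ->] /andP[/eqP]]. Qed.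

Lemma footA p : p \in pend -> [/\ foot p \in A, foot p \in S & edge p (foot p)].
Proof.
rewrite inE => /andP[_ /and3P[_ /existsP[v /andP[vS pv]] _]]; rewrite /foot; case: pickP => [x|/(_ v)].
  by rewrite in_setI in_nb => /andP[/andP[]].
by rewrite in_setI in_nb pv andbT -in_setI vS.
Qed.

Lemma footP p : p \in pend -> foot p \in S /\ edge p (foot p).
Proof. by case/footA. Qed.

Lemma farP p : p \in pend -> [/\ far p \in A, far p \notin S & edge p (far p)].
Proof.
rewrite inE => /andP[_ /and3P[_ _ /existsP[v /andP[vS pv]]]]; rewrite /far; case: pickP => [x|/(_ v)].
  by rewrite in_setD in_nb => /and3P[].
by rewrite in_setD in_nb; move: vS; rewrite in_setD => /andP[-> ->]; rewrite pv.
Qed.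

Lemma pend_nb p u : p \in pend -> u \in A -> edge p u -> u = foot p \/ u = far p.
Proof.
move=> pP uA pu; have [pA pS d2] := pendP pP; have [fA fS pf] := footA pP; have [wA wS pw] := farP pP.
apply: (@nb_le2 _ A p) => //; first by rewrite d2.
by move=> E; move: wS; rewrite -E fS.
Qed.

Hypothesis noadj : forall u v, u \in A -> v \in A -> edge u v ->
  #|nb A u| = 2 -> #|nb A v| = 2 -> False.

Lemma far_notin_pend p : p \in pend -> far p \notin pend.
Proof.
move=> pP; apply/negP => /pendP[wA _ dw]; have [pA _ dp] := pendP pP; have [_ _ pw] := farP pP.
exact: (noadj pA wA pw).
Qed.

(** A vertex of degree three loses only [s]; a vertex of degree two that loses [s] would be
    pendant. *)
Lemma pend_rest u s : subcubic G -> (forall v, v \in A -> 1 < #|nb A v|) ->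
  u \in A -> u \notin S -> u \notin pend -> u \notin W -> s \in A -> s \in S -> edge u s ->
  (forall v, v \in S -> edge u v -> v = s) -> 1 < #|nb (A :\: (pend :|: S)) u|.
Proof.
move=> hG mindeg uA uS uP uW sA sS us one.
have H : #|nb A u| <= #|nb (A :\: (pend :|: S)) u|.+1.
  apply: (nb_rem (c := s)) => x xA ux; case: (x =P s) => [|ne]; [by left|right].
  rewrite in_setD in_setU xA andbT negb_or; apply/andP; split; last first.
    by apply/negP => xS; apply: ne; apply: one.
  apply/negP => xP; move: (ux); rewrite edgeC => xu.
  case: (pend_nb xP uA xu) => E; first by move: uS; rewrite E; have [-> ] := footP xP.
  by move: uW; rewrite E imset_f.
case: (deg23 hG mindeg uA) => du; last by move: H; rewrite du.
have /card_gt0P[w] : 0 < #|nb (A :\: (pend :|: S)) u| by move: H; rewrite du.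
rewrite in_nb in_setD in_setU negb_or => /andP[/andP[/andP[_ wS'] wA] uw].
move: uP; rewrite inE in_setD uS uA du eqxx /=; case/negP; apply/andP; split.
  by apply/existsP; exists s; rewrite in_setI sA sS.
by apply/existsP; exists w; rewrite in_setD wS' wA.
Qed.

Lemma color_pendants (C : choiceType) (L : G -> {fset C}) f : (forall v, #|` L v| = 4) ->
  (forall p, p \in pend -> f (foot p) <> f (far p) /\ 1 < #|nb (A :\: pend) (foot p)|) ->
  good L W (A :\: pend) f -> exists f', good L set0 A f'.
Proof.
move=> L4 Hf gf.
have PE p : (p \in enum pend) = (p \in pend) by rewrite mem_enum.
have [|||f'' gf''] := add_pendants L4 (ps := enum pend) (cc := foot) (ww := far) (enum_uniq _) _ _ _ gf.
- move=> p; rewrite PE => pP; have [fA fS pf] := footA pP; have [wA wS' pw] := farP pP.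
  split; first by rewrite in_setD pP.
  split=> //; rewrite in_setD ?(far_notin_pend pP) // fA andbT.
  by apply/negP => /pendP[_]; rewrite fS.
- move=> p u; rewrite PE => pP uE; apply: (pend_nb pP).
  by case: uE; [rewrite in_setD => /andP[]|rewrite PE => /pendP[]].
- move=> p; rewrite PE => pP; have [h1 h2] := Hf p pP; split=> //.
  by apply/negP => /imsetP[q /farP[_ wS _] E]; move: wS; rewrite -E; have [-> ] := footP pP.
exists f''; rewrite (_ : W :\: _ = set0) in gf''; last first.
  apply/setP => x; rewrite in_setD in_set0 in_set; apply/negP => /andP[/negP nx /imsetP[p pP E]].
  by apply: nx; rewrite E map_f // PE.
rewrite (_ : _ :|: _ = A) // in gf''; apply/setP => x; rewrite in_setU in_setD in_set PE.
by case: (boolP (x \in pend)) => [/pendP[-> ]|]; rewrite ?orbF //= orbT.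
Qed.
End Pendants.

(** * A nonsolid vertex on a shortest cycle *)

Section Nonsolid.
Variables (G : sgraph) (C : choiceType) (L : G -> {fset C}) (A : {set G}).
Hypothesis hG : subcubic G.
Hypothesis L4 : forall v, #|` L v| = 4.
Hypothesis IH : forall B : {set G}, B \proper A -> colorable L B.
Hypothesis noB : forall d, ~ bad L A d.
Hypothesis mindeg : forall v, v \in A -> 1 < #|nb A v|.
Hypothesis noadj : forall u v, u \in A -> v \in A -> edge u v ->
  #|nb A u| = 2 -> #|nb A v| = 2 -> False.
Variables (k : nat) (c : nat -> G).
Hypothesis cyc : iscyc A k c.
Hypothesis minc : forall g c', iscyc A g c' -> k <= g.
Hypothesis nopath : forall k' p, ispath2 A k' p -> k < k'.
Hypothesis noopp : k = 4 -> forall u i, u \in A -> u \notin cset k c ->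
  edge u (c i) -> ~ edge u (c i.+2).

Local Notation S := (cset k c).
Local Notation outer := (outer A k c).
Local Notation bare := (bare A k c).

Lemma share_adj u i v : u \in A -> u \notin S -> edge u (c i) -> v \in S -> edge u v -> v <> c i ->
  exists j, edge u (c j) /\ edge u (c j.+1).
Proof.
move=> uA uS ei vS ev ne; case: (cyc) => k3 _ [per _] _.
have [m mk Ev] := sc_window cyc i vS; have m0 : 0 < m by case: m Ev {mk} => // Ev; case: ne; rewrite Ev addn0.
rewrite Ev in ev; have [|| h1 h2] := sc_share cyc minc (i := i) (j := i + m) uA uS _ _ ei ev; try lia.
have [E|[E k4]] : m = 1 \/ (m = 2 /\ k <= 4) by lia.
  by exists i; rewrite E addn1 in ev.
have [E4|E3] : k = 4 \/ k = 3 by lia.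
  by case: (noopp E4 uA uS ei); rewrite E addn2 in ev.
exists (i + m); split=> //; have -> : (i + m).+1 = i + k by lia.
by rewrite per.
Qed.

Local Notation pend := (pend A S).
Local Notation foot := (foot A S).
Local Notation far := (far A S).

Lemma cA i : c i \in A.
Proof. by case: cyc. Qed.

Lemma SA v : v \in S -> v \in A.
Proof. by case/csetP=> i _ ->; apply: cA. Qed.

Lemma outer_foot p i : p \in pend -> foot p = c i -> outer (c i) = p /\ ~~ bare (c i).
Proof.
move=> pP E; have [pA pS _] := pendP pP; have [_ pf] := footP pP.
by rewrite E edgeC in pf; have [-> ] := sc_outer_uniq hG cyc pA pS pf.
Qed.

Lemma foot_outer i : ~~ bare (c i) -> outer (c i) \in pend -> foot (outer (c i)) = c i.
Proof.
move=> nb0 oP; have [_ oS eo] := outerP nb0; have [_ wS _] := farP oP.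
have eo' : edge (outer (c i)) (c i) by rewrite edgeC.
case: (pend_nb oP (cA i) eo') => // E; by move: wS; rewrite -E (sc_S cyc).
Qed.

(** A nonsolid cycle vertex has degree two or a neighbour of degree two outside; the absence of
    short paths between such vertices makes it rare. *)
Definition solid (v : G) : bool := ~~ bare v && (outer v \notin pend).
(** A pendant neighbour is put back between its foot and its far end, so the foot avoids the colour
    of the far end. *)
Definition avoid (v : G) : seq G :=
  if bare v then [::] else if outer v \in pend then [:: far (outer v)] else [:: outer v].

Definition ext i := ~~ bare (c i) : nat.

Lemma nonsolid_deg2 i : ~~ solid (c i) -> if bare (c i) then #|nb A (c i)| = 2
  else [/\ outer (c i) \in A, outer (c i) \notin S, edge (c i) (outer (c i)), outer (c i) \in pend & #|nb A (outer (c i))| = 2].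
Proof.
rewrite /solid negb_and negbK; case: (boolP (bare (c i))) => b /=; first by move=> _; apply: (bare_deg2 cyc minc).
by rewrite negbK => H; have [oA oS eo] := outerP b; have [_ _ d2] := pendP H.
Qed.

(** The arc from [c a] to [c b], prolonged by the pendant neighbour at each end that is not bare,
    joins two vertices of degree two and so has more than [k] vertices. *)
Lemma nonsolid_path a b : a < b -> b < a + k -> ~~ solid (c a) -> ~~ solid (c b) ->
  k < b - a + 1 + ext a + ext b.
Proof.
move=> ab bk na nb_; case: (cyc) => k3 _ [per inj] ce.
have {}na := nonsolid_deg2 na; have {}nb_ := nonsolid_deg2 nb_.
have S' i : c i \in S by apply: (sc_S cyc).
pose tl := [seq c (a + m) | m <- iota 1 (b - a)].
have sz : size tl = b - a by rewrite size_map size_iota.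
have tE m : m < b - a -> nth (c a) tl m = c (a + m.+1).
  by move=> mb; rewrite (nth_map 0) ?size_iota // nth_iota.
have lastE x : last x tl = c b.
  have [n En] : exists n, b - a = n.+1 by exists (b - a).-1; lia.
  rewrite (last_nth (c a)) sz En -[LHS]/(nth (c a) tl n) tE ?En //.
  by congr c; lia.
have us : uniq (c a :: tl).
  rewrite (_ : c a :: tl = [seq c (a + m) | m <- iota 0 (b - a).+1]); last by rewrite /= addn0.
  rewrite map_inj_in_uniq ?iota_uniq // => x y; rewrite !mem_iota => hx hy E.
  case: (ltngtP x y) => // lt; first by case: (inj (a + x) (a + y)) => //; lia.
  by case: (inj (a + y) (a + x)) => //; lia.
have ss : path (@edge G) (c a) tl.
  apply/(pathP (c a)) => i; rewrite sz => lt; rewrite tE // addnS.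
  case: i lt => [|i] lt; first by rewrite /= addn0.
  by rewrite -[nth _ _ _]/(nth (c a) tl i) tE ?addnS //; apply: ltnW.
have sS x : x \in c a :: tl -> x \in S.
  by rewrite in_cons => /predU1P[->|/mapP[m _ ->]].
have nin x : x \notin S -> x \notin c a :: tl by apply: contra; apply: sS.
have sA x : x \in c a :: tl -> x \in A by move/sS/SA.
rewrite /ext; have [ea|ea] := boolP (bare (c a)); have [eb|eb] := boolP (bare (c b));
  rewrite ?(negbTE ea) ?(negbTE eb) ?ea ?eb /= in na nb_ *.
- have -> : b - a + 1 + 0 + 0 = size (c a :: tl) by rewrite /= sz; lia.
  apply: (nopath (p := nth (c a) (c a :: tl))); apply: ispath2_seq => //; first by rewrite /= sz; lia.
  by rewrite nth_last /= lastE.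
- case: nb_ => oA oS eo oP od.
  have -> : b - a + 1 + 0 + 1 = size (rcons (c a :: tl) (outer (c b))) by rewrite size_rcons /= sz; lia.
  apply: (nopath (p := nth (c a) (rcons (c a :: tl) (outer (c b))))); apply: ispath2_seq => //.
  + by rewrite size_rcons /= sz; lia.
  + by rewrite rcons_uniq us nin.
  + by move=> x; rewrite mem_rcons in_cons => /predU1P[->|/sA].
  + by rewrite /= rcons_path ss lastE.
  + by rewrite nth_last last_rcons.
- case: na => oA oS eo oP od.
  have -> : b - a + 1 + 1 + 0 = size (outer (c a) :: c a :: tl) by rewrite /= sz; lia.
  apply: (nopath (p := nth (c a) (outer (c a) :: c a :: tl))); apply: ispath2_seq => //.
  + by rewrite cons_uniq us nin.
  + by move=> x; rewrite in_cons => /predU1P[->|/sA].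
  + by rewrite /= ss edgeC eo.
  + by rewrite nth_last /= lastE.
- case: na => oA oS eo oP od; case: nb_ => oA' oS' eo' oP' od'.
  have ne : outer (c a) <> outer (c b).
    move=> E; have := foot_outer ea oP; rewrite E (foot_outer eb oP') => Ec.
    by apply: (inj a b) => //; rewrite Ec.
  have -> : b - a + 1 + 1 + 1 = size (outer (c a) :: rcons (c a :: tl) (outer (c b))) by rewrite /= size_rcons sz; lia.
  apply: (nopath (p := nth (c a) (outer (c a) :: rcons (c a :: tl) (outer (c b))))); apply: ispath2_seq => //.
  + by rewrite cons_uniq rcons_uniq us (nin _ oS') mem_rcons in_cons negb_or (nin _ oS) !andbT; apply/eqP.
  + by move=> x; rewrite in_cons mem_rcons in_cons => /predU1P[->|/predU1P[->|/sA]].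
  + by rewrite /= rcons_path ss lastE edgeC eo.
  + by rewrite nth_last /= last_rcons.
Qed.

(** Both arcs between [c 0] and [c i] obey [nonsolid_path], giving [k <= i + 2] and [i <= 2]. *)
Lemma nonsolid_two i : ~~ solid (c 0) -> 0 < i -> i < k -> [\/ solid (c i), k = 3 | k = 4 /\ i = 2].
Proof.
move=> n0 i0 ik; case: (boolP (solid (c i))) => [|ni]; first by constructor 1.
case: (cyc) => k3 _ [per inj] ce.
have h1 := nonsolid_path i0 ik n0 ni.
have nk : ~~ solid (c k) by have := per 0; rewrite add0n => ->.
have h2 := nonsolid_path (a := i) (b := k) ik _ ni nk.
have ek : ext k = ext 0 by rewrite /ext; have := per 0; rewrite add0n => ->.
have {}h2 : k < k - i + 1 + ext i + ext 0 by rewrite -ek; apply: h2; lia.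
have l0 : ext 0 <= 1 by exact: leq_b1.
have li : ext i <= 1 by exact: leq_b1.
have [E|[E1 E2]] : k = 3 \/ (k = 4 /\ i = 2) by lia.
  by constructor 2.
by constructor 3.
Qed.

Lemma bare_solid i : bare (c 0) -> 0 < i -> i < k -> solid (c i).
Proof.
move=> b0 i0 ik; case: (boolP (solid (c i))) => // ni.
case: (cyc) => k3 _ [per inj] ce.
have n0 : ~~ solid (c 0) by rewrite /solid b0.
have h1 := nonsolid_path i0 ik n0 ni.
have nk : ~~ solid (c k) by have := per 0; rewrite add0n => ->.
have h2 := nonsolid_path (a := i) (b := k) ik _ ni nk.
have ek : ext k = ext 0 by rewrite /ext; have := per 0; rewrite add0n => ->.
have {}h2 : k < k - i + 1 + ext i + ext 0 by rewrite -ek; apply: h2; lia.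
have l0 : ext 0 = 0 by rewrite /ext b0.
have li : ext i <= 1 by exact: leq_b1.
by exfalso; lia.
Qed.

Local Notation W := [set far p | p in pend].

(** The cycle is deleted with its pendant neighbours. [color_nonsolid] makes each foot differ from
    the far end, as [color_pendants] requires. Exemptions must lie in [W], because putting back
    pendants repairs the far ends. *)
Lemma color_ns (Zb : {set G}) : ~~ solid (c 0) -> Zb \subset W ->
  (forall d, bad L (A :\: (pend :|: S)) d -> exists i, d i \in Zb) -> exists f, good L set0 A f.
Proof.
move=> n0 ZW Hb; case: (cyc) => k3 _ per ce.
have cP i : c i \notin pend by apply/negP => /pendP[_]; rewrite (sc_S cyc).
have prop : A :\: (pend :|: S) \proper A.
  by apply: (setD_proper (v := c 0)); rewrite ?cA // in_setU (sc_S cyc) orbT.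
have [f gf] := IH prop Hb.
have cE i : c i \in A :\: pend by rewrite in_setD cP cA.
have wS i : c i \notin W.
  by apply/negP => /imsetP[p /farP[_ wS _] E]; move: wS; rewrite -E (sc_S cyc).
have [|||||||||f' [_ gf' Ff']] := color_nonsolid (A := A :\: pend) L4 (k := k) (c := c) (F := avoid) (sol := solid) (Zb := Zb) (Z := W) (f := f).
- by split.
- move=> i; rewrite /avoid; case: ifP => [_|/negbT b]; first by split.
  have [oA oS eo] := outerP b.
  case: ifP => [oP|/negbT oP]; split=> // x; rewrite inE => /eqP->; last by rewrite !in_setD oS oP oA.
  by have [wA wS' _] := farP oP; rewrite !in_setD wS' (far_notin_pend noadj).
- move=> i u; rewrite in_setD => /andP[uP uA] e.
  case: (sc_N hG cyc minc uA e) => [->|->|[uS E b]]; [by constructor 1|by constructor 2|constructor 3].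
  split; first by rewrite /solid b -E.
  by rewrite /avoid (negbTE b) -E (negbTE uP) mem_head.
- move=> i /andP[b oP]; have [_ _ eo] := outerP b; exists (outer (c i)) => //.
  by rewrite /avoid (negbTE b) (negbTE oP).
- exact: n0.
- by move=> i; apply: nonsolid_two.
- by rewrite setDDl.
- by [].
- move=> u i; rewrite setDDl !in_setD in_setU negb_or => /andP[/andP[uP uS] uA] eu uW.
  case: (classic (exists v, [/\ v \in S, edge u v & v <> c i])) => [[v [vS ev ne]]|no].
    by right; apply: (share_adj uA uS eu vS ev ne).
  left; apply: (pend_rest (s := c i)) => //; [exact: cA|exact: (sc_S cyc)|].
  by move=> v vS ev; apply: NNPP => ne; apply: no; exists v.
apply: (color_pendants noadj L4 _ gf') => p pP; have [fS pf] := footP pP; have [i Ei] := sc_Scase cyc fS.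
have [oE b] := outer_foot pP Ei; rewrite Ei; split.
  by apply: Ff'; rewrite /avoid (negbTE b) oE pP mem_head.
apply: (two_nb (u := c i) (w := c i.+2)) => //; first by rewrite edgeC.
by apply: per.2; lia.
Qed.

Definition outs m n := flatten [seq avoid (c i) | i <- iota m n].

Lemma size_outs m n : size (outs m n) <= n.
Proof.
rewrite /outs; elim: n m => [|n IHn] m //=; rewrite size_cat -[n.+1]/(1 + n); apply: leq_add => //.
by rewrite /avoid; do 2?case: ifP.
Qed.

Lemma outsP u s : u \in A :\: (pend :|: S) -> s \in pend :|: S -> s \in A -> edge u s -> u \in outs 0 k.
Proof.
rewrite in_setD in_setU negb_or => /andP[/andP[uP uS] uA] + sA us.
have Hin j : j < k -> u \in avoid (c j) -> u \in outs 0 k.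
  by move=> jk ua; apply/flattenP; exists (avoid (c j)) => //; apply: map_f; rewrite mem_iota.
rewrite in_setU => /orP[sP|]; last first.
  case/csetP=> j jk Es; rewrite Es edgeC in us.
  have [E b] := sc_outer_uniq hG cyc uA uS us; apply: (Hin j) => //.
  by rewrite /avoid (negbTE b) -E (negbTE uP) mem_head.
rewrite edgeC in us; have [fS pf] := footP sP; have /csetP[j jk Ej] := fS.
have [oE b] := outer_foot sP Ej; apply: (Hin j) => //.
case: (pend_nb sP uA us) => E; first by move: uS; rewrite E fS.
by rewrite /avoid (negbTE b) oE sP E mem_head.
Qed.

Lemma nofar u v w : u \in A -> v \in A -> w \in A -> edge u v -> edge v w -> u <> w ->
  #|nb A u| = 2 -> #|nb A w| = 2 -> False.
Proof.
move=> uA vA wA uv vw uw du dw; case: (cyc) => k3 _ _ _.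
by have := nopath (ispath2_three uA vA wA uv vw uw du dw); rewrite ltnNge k3.
Qed.

Lemma outer_C5_cyc (B : {set G}) d : C5in (A :\: B) d -> iscyc A 5 d.
Proof. by move/C5in_cyc; apply: iscycS; apply: subsetDl. Qed.

(** The bare [c 0] contributes no outer vertex, so at most [k.-1] exist, while a remaining 5-cycle
    uses four; this leaves only [k = 5]. *)
Lemma color_bare : bare (c 0) -> exists f, good L set0 A f.
Proof.
move=> b0; case: (cyc) => k3 _ [per inj] ce.
apply: (color_ns (Zb := set0)); rewrite ?sub0set //; first by rewrite /solid b0.
move=> d [dC _]; exfalso; have osP := outsP; have k5 := minc (outer_C5_cyc dC).
have osE : outs 0 k = outs 1 k.-1.
  have [n En] : exists n, k = n.+1 by exists k.-1; lia.
  by rewrite En /outs /= {1}/avoid b0.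
have sz := size_outs 1 k.-1; have s4 := C5_four_size noadj dC osP nofar; rewrite osE in s4.
have kE : k = 5 by lia.
have [b nd] : exists b, d b \notin outs 0 k.
  apply: NNPP => no; have sub : {subset [seq d (0 + j) | j <- iota 0 5] <= outs 0 k}.
    by move=> x /mapP[j _ ->]; apply/negPn/negP => h; apply: no; exists (0 + j).
  have := uniq_leq_size (C5_uniq_map dC 0 (iota_uniq 0 5) isT) sub.
  by rewrite size_map size_iota osE => h; have := leq_trans h sz; rewrite kE.
have db := C5_off_deg2 dC osP nd.
have d1 : d b.+1 \in outs 0 k by case: (C5_in_adj noadj dC osP b) => // h; rewrite h in nd.
have dB i : d i \in A /\ d i \notin S.
  by case: dC => h _ _; have := h i; rewrite in_setD in_setU negb_or => /andP[/andP[_ ->] ->].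
have [_ _ [_ dinj] de] := outer_C5_cyc dC.
(* The fifth vertex [d b] has degree two. Through [d b.+1] and the shorter arc to [c 0] it reaches
   another vertex of degree two within five vertices, which [nopath] forbids. *)
have hp t : path (@edge G) (d b.+1) t -> uniq t -> {subset t <= S} -> last (d b.+1) t = c 0 ->
    0 < size t <= 3 -> False.
  move=> pt ut tS tl /andP[t0 t3].
  have nt i : d i \notin t by apply/negP => /tS; apply/negP; case: (dB i).
  suff /nopath : ispath2 A (size [:: d b, d b.+1 & t]) (nth (d b) [:: d b, d b.+1 & t]).
    by rewrite kE /=; lia.
  apply: ispath2_seq => //.
  - by rewrite !cons_uniq ut inE negb_or !nt !andbT; apply/eqP; apply: dinj; lia.
  - by move=> x; rewrite !inE => /predU1P[->|/predU1P[->|/tS/SA]] //; case: (dB b) (dB b.+1) => ? _ [].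
  - by rewrite /= de pt.
  - by rewrite nth_last /= tl; apply: (bare_deg2 cyc minc).
rewrite osE in d1; case/flattenP: d1 => s /mapP[j]; rewrite mem_iota => /andP[j1 j2] -> {s} dj.
have jk : j < k by lia.
have /andP[bj oj] := bare_solid b0 j1 jk; move: dj; rewrite /avoid (negbTE bj) (negbTE oj) inE => /eqP dj.
have [_ _ eo] := outerP bj; rewrite -dj edgeC in eo.
have S' i : c i \in S by apply: (sc_S cyc).
have c5 : c 5 = c 0 by have := per 0; rewrite add0n kE.
have sub2 (t : seq nat) : {subset [seq c j | j <- t] <= S} by move=> x /mapP[? _ ->].
have neq a a' : (a < a' < a + 5) || (a' < a < a' + 5) -> c a != c a'.
  by case/orP=> /andP[h1 h2]; [|rewrite eq_sym]; apply/eqP; apply: inj; rewrite // kE.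
have {j2 jk} : j < 5 by rewrite -kE.
case: j j1 eo {dj bj oj} => [|[|[|[|[|j]]]]] // _ eo _.
- apply: (hp [:: c 1; c 0]) => //=; rewrite ?eo 1?edgeC ?ce ?inE ?neq //.
  exact: (sub2 [:: 1; 0]).
- apply: (hp [:: c 2; c 1; c 0]) => //=; rewrite ?eo 1?[edge (c 2) _]edgeC ?[edge (c 1) (c 0)]edgeC ?ce ?inE ?negb_or ?neq //.
  exact: (sub2 [:: 2; 1; 0]).
- apply: (hp [:: c 3; c 4; c 5]) => //=; rewrite ?eo ?ce ?inE ?negb_or ?neq //.
  exact: (sub2 [:: 3; 4; 5]).
- apply: (hp [:: c 4; c 5]) => //=; rewrite ?eo ?ce ?inE ?neq //.
  exact: (sub2 [:: 4; 5]).
Qed.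

(** Only the far end [w] beyond [c 0] is exempted, so every remaining 5-cycle has to contain it. For
    [k = 4] such a cycle uses all four outer vertices. For [k = 5] it carries no vertex of degree
    two, so it consists of outer vertices and exhausts them. *)
Lemma color_pendant : ~~ bare (c 0) -> ~~ solid (c 0) ->
  (forall c' i, iscyc A k c' -> #|nb A (c' i)| <> 2) -> exists f, good L set0 A f.
Proof.
move=> b0 n0 nodeg; case: (cyc) => k3 _ [per inj] ce.
have oP : outer (c 0) \in pend by move: n0; rewrite /solid b0 negbK.
pose w := far (outer (c 0)).
apply: (color_ns (Zb := [set w])) => //; first by rewrite sub1set imset_f.
move=> d [dC _]; have osP := outsP; have k5 := minc (outer_C5_cyc dC).
have sz := size_outs 0 k; have s4 := C5_four_size noadj dC osP nofar.
have wo : w \in outs 0 k.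
  apply/flattenP; exists (avoid (c 0)); first by apply: map_f; rewrite mem_iota; lia.
  by rewrite /avoid (negbTE b0) oP mem_head.
have [kE|kE] : k = 4 \/ k = 5 by lia.
  have /codomP[i Ei] : w \in codom (fun i : 'I_5 => d i).
    by apply: (C5_cover4 noadj dC osP nofar) => //; rewrite -[in X in _ <= X]kE.
  by exists i; rewrite -Ei inE.
have sub : {subset [seq d (0 + j) | j <- iota 0 5] <= outs 0 k}.
  move=> x /mapP[j _ ->]; apply/negPn/negP => h; have := C5_off_deg2 dC osP h.
  by apply: nodeg; rewrite kE; apply: (outer_C5_cyc dC).
have [|_ E] := uniq_min_size (C5_uniq_map dC 0 (iota_uniq 0 5) isT) sub.
  by rewrite size_map size_iota -[in X in _ <= X]kE.
by move: wo; rewrite -E => /mapP[j _ ->]; exists (0 + j); rewrite inE.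
Qed.
End Nonsolid.

Lemma leaf_uniq (G : sgraph) (A : {set G}) (a b y u w : G) : subcubic G ->
  a \in A -> b \in A -> a <> b -> edge y a -> edge y b ->
  u \in A -> u <> a -> u <> b -> edge y u -> w \in A -> w <> a -> w <> b -> edge y w -> w = u.
Proof.
move=> hG aA bA ab ya yb uA ua ub yu wA wa wb yw.
by case: (@nb_le3 _ A y a b u w (deg_le3 hG A y) aA bA uA wA ya yb yu yw ab) => // E; [case: ua|case: ub].
Qed.

(** * K_{2,3} in the absence of triangles *)

Section K23.
Variables (G : sgraph) (C : choiceType) (L : G -> {fset C}) (A : {set G}).
Hypothesis hG : subcubic G.
Hypothesis L4 : forall v, #|` L v| = 4.
Hypothesis IH : forall B : {set G}, B \proper A -> colorable L B.
Hypothesis mindeg : forall v, v \in A -> 1 < #|nb A v|.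
Hypothesis noadj : forall u v, u \in A -> v \in A -> edge u v ->
  #|nb A u| = 2 -> #|nb A v| = 2 -> False.
Hypothesis nofar : forall u v w, u \in A -> v \in A -> w \in A -> edge u v -> edge v w -> u <> w ->
  #|nb A u| = 2 -> #|nb A w| = 2 -> False.
Hypothesis notri : forall u v w, u \in A -> v \in A -> w \in A ->
  edge u v -> edge v w -> edge u w -> False.

Section Separated.
Variables (a b y1 y2 y3 : G).
Local Notation ys := [:: y1; y2; y3].
Local Notation S := [set x in [:: a; b; y1; y2; y3]].
Hypothesis us : uniq [:: a; b; y1; y2; y3].
Hypothesis sA : {subset [:: a; b; y1; y2; y3] <= A}.
Hypothesis ea : forall y, y \in ys -> edge a y.
Hypothesis eb : forall y, y \in ys -> edge b y.
Hypothesis sep : forall u, u \in A -> u <> a -> u <> b -> edge u y3 -> ~~ edge u y1 /\ ~~ edge u y2.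

Lemma memS v : (v \in S) = (v \in [:: a; b; y1; y2; y3]).
Proof. by rewrite in_set. Qed.

Lemma memS_cases v : v \in S -> [\/ v = a, v = b | v \in ys].
Proof.
rewrite memS 2!in_cons => /predU1P[->|/predU1P[->|]]; by [constructor 1|constructor 2|constructor 3].
Qed.

Lemma ysS y : y \in ys -> y \in S.
Proof. by move=> h; rewrite memS 2!in_cons h !orbT. Qed.

Lemma K23A v : v \in S -> v \in A.
Proof. by rewrite memS; apply: sA. Qed.

Lemma aS : a \in S. Proof. by rewrite memS mem_head. Qed.
Lemma bS : b \in S. Proof. by rewrite memS 2!in_cons eqxx orbT. Qed.

Lemma K23_neq : [/\ a <> b, y1 <> y2, y1 <> y3 & y2 <> y3].
Proof.
by move: us; rewrite /= !inE !negb_or => /and5P[/and4P[/eqP ? _ _ _] _ /andP[/eqP ? /eqP ?] /eqP ? _].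
Qed.

Lemma hub_nb h u : h = a \/ h = b -> u \in A -> edge h u -> u \in ys.
Proof.
move=> hh uA hu; have [_ n12 n13 n23] := K23_neq.
have hy y : y \in ys -> edge h y by case: hh => ->; [apply: ea|apply: eb].
have yA y : y \in ys -> y \in A by move/ysS/K23A.
have m1 : y1 \in ys by rewrite !inE eqxx.
have m2 : y2 \in ys by rewrite !inE eqxx orbT.
have m3 : y3 \in ys by rewrite !inE eqxx !orbT.
by case: (@nb_le3 _ A h y1 y2 y3 u (deg_le3 hG A h) (yA _ m1) (yA _ m2) (yA _ m3) uA
  (hy _ m1) (hy _ m2) (hy _ m3) hu n12 n13 n23) => ->.
Qed.

Lemma leaf_nbS y u : y \in ys -> u \in S -> edge y u -> u = a \/ u = b.
Proof.
move=> yy uS yu; case: (memS_cases uS) => [|| uy]; [by left|by right|].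
by case: (notri (K23A aS) (K23A (ysS yy)) (K23A uS) (ea yy) yu (ea uy)).
Qed.

Lemma notS_neq u : u \notin S -> u <> a /\ u <> b.
Proof. by move=> uS; split=> E; move: uS; rewrite E ?aS ?bS. Qed.

Definition leaf_out y := [pick u in nb A y :\: S].
Definition leaf_avoid y := if leaf_out y is Some u then
  (if u \in pend A S then [:: far A S u] else [:: u]) else [::].
Definition leaf_solid y := if leaf_out y is Some u then u \notin pend A S else false.

Lemma leaf_outE y u : y \in ys -> u \in A -> u \notin S -> edge y u -> leaf_out y = Some u.
Proof.
move=> yy uA uS yu; have [nab _ _ _] := K23_neq; rewrite /leaf_out; case: pickP => [x|/(_ u)]; last first.
  by rewrite in_setD in_nb uS uA yu.
rewrite in_setD in_nb => /and3P[xS xA yx]; congr Some.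
have [ua ub] := notS_neq uS; have [xa xb] := notS_neq xS.
have ya := ea yy; have yb := eb yy; rewrite edgeC in ya; rewrite edgeC in yb.
exact: (leaf_uniq hG (K23A aS) (K23A bS) nab ya yb).
Qed.

Lemma leaf_outP y u : leaf_out y = Some u -> [/\ u \in A, u \notin S & edge y u].
Proof.
by rewrite /leaf_out; case: pickP => // x; rewrite in_setD in_nb => /and3P[? ? ?] [<-].
Qed.

Lemma leaf_avoid_size y : size (leaf_avoid y) <= 1.
Proof. by rewrite /leaf_avoid; case: leaf_out => // u; case: ifP. Qed.

Lemma leaf_avoid_sub y u : u \in leaf_avoid y -> u \in (A :\: pend A S) :\: S.
Proof.
rewrite /leaf_avoid; case E: leaf_out => [x|] //; have [xA xS yx] := leaf_outP E.
case: ifP => xP; rewrite inE => /eqP->; last by rewrite !in_setD xS xA xP.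
by have [wA wS _] := farP xP; rewrite !in_setD wS wA (far_notin_pend noadj xP).
Qed.

Lemma foot_leaf p : p \in pend A S -> foot A S p \in ys /\ leaf_out (foot A S p) = Some p.
Proof.
move=> pP; have [fA fS pf] := footA pP; have [pA pS _] := pendP pP; rewrite edgeC in pf.
have fy : foot A S p \in ys.
  by case: (memS_cases fS) => // E; move: pS; rewrite ysS //; apply: (hub_nb (h := foot A S p)) => //; rewrite E; [left|right].
by split=> //; apply: leaf_outE.
Qed.

(** Three leaves allow at most three outer vertices while a remaining 5-cycle needs four, so no
    exemption is required. The separation of [y3] is what [color_K23] asks of its third leaf. *)
Lemma color_K23_sep : exists f, good L set0 A f.
Proof.
have [nab n12 n13 n23] := K23_neq.
have m1 : y1 \in ys by rewrite !inE eqxx.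
have m2 : y2 \in ys by rewrite !inE eqxx orbT.
have m3 : y3 \in ys by rewrite !inE eqxx !orbT.
have SP v : v \in S -> v \notin pend A S by move=> vS; apply/negP => /pendP[_]; rewrite vS.
have SE v : v \in S -> v \in A :\: pend A S by move=> vS; rewrite in_setD SP // K23A.
pose os := leaf_avoid y1 ++ leaf_avoid y2 ++ leaf_avoid y3.
have osI y u : y \in ys -> u \in leaf_avoid y -> u \in os.
  by rewrite /os !mem_cat !inE => /or3P[] /eqP-> ->; rewrite ?orbT.
have osP u s : u \in A :\: (pend A S :|: S) -> s \in pend A S :|: S -> s \in A -> edge u s -> u \in os.
  rewrite in_setD in_setU negb_or => /andP[/andP[uP uS] uA] + sA' us'; rewrite edgeC in us'.
  rewrite in_setU => /orP[sP|sS].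
    have [fy oE] := foot_leaf sP; apply: (osI _ _ fy); rewrite /leaf_avoid oE sP inE.
    case: (pend_nb sP uA us') => E; last by rewrite E.
    by move: uS; rewrite E ysS.
  case: (memS_cases sS) => [E|E|sy].
  - by move: uS; rewrite ysS //; apply: (hub_nb (h := s)) => //; left.
  - by move: uS; rewrite ysS //; apply: (hub_nb (h := s)) => //; right.
  - by apply: (osI _ _ sy); rewrite /leaf_avoid (leaf_outE sy uA uS us') (negbTE uP) mem_head.
have nobad d : ~ bad L (A :\: (pend A S :|: S)) d.
  case=> dC _; have := C5_four_size noadj dC osP nofar; rewrite !size_cat.
  by have := leaf_avoid_size y1; have := leaf_avoid_size y2; have := leaf_avoid_size y3; lia.
have prop : A :\: (pend A S :|: S) \proper A.
  by apply: (setD_proper (v := a)); rewrite ?K23A ?in_setU ?aS ?orbT.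
have [f gf] := IH prop (Z := set0) (fun d bd => False_ind _ (nobad d bd)).
pose W := [set far A S p | p in pend A S].
have leafN y u : y \in ys -> u \in A :\: pend A S -> edge y u ->
    [\/ u = a, u = b | leaf_solid y /\ u \in leaf_avoid y].
  move=> yy; rewrite in_setD => /andP[uP uA] yu; case: (boolP (u \in S)) => uS.
    by case: (leaf_nbS yy uS yu) => ->; [constructor 1|constructor 2].
  constructor 3; rewrite /leaf_solid /leaf_avoid (leaf_outE yy uA uS yu) uP (negbTE uP).
  by rewrite mem_head.
have hubN h u : h = a \/ h = b -> u \in A :\: pend A S -> edge h u -> [\/ u = y1, u = y2 | u = y3].
  move=> hh; rewrite in_setD => /andP[_ uA] hu; have := hub_nb hh uA hu.
  by rewrite !inE => /or3P[] /eqP->; [constructor 1|constructor 2|constructor 3].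
have [f' [gf' _ [F1 F2 F3]]] : exists f', [/\ good L W (A :\: pend A S) f', f' y1 <> f' y2
    & [/\ forall u, u \in leaf_avoid y1 -> f' y1 <> f' u, forall u, u \in leaf_avoid y2 -> f' y2 <> f' u
        & forall u, u \in leaf_avoid y3 -> f' y3 <> f' u]].
  apply: (color_K23 hG L4 (c1 := a) (c3 := b) (s1 := leaf_solid y1) (s2 := leaf_solid y2)
    (s3 := leaf_solid y3) (Zb := set0) (f := f)) => //.
  - by move=> v vs; apply: SE; rewrite memS.
  - by split; apply: ea.
  - by split; apply: eb.
  - by move=> u; apply: hubN; left.
  - by move=> u; apply: hubN; right.
  - by move=> u; apply: leafN.
  - by move=> u; apply: leafN.
  - by move=> u; apply: leafN.
  - by split; apply: leaf_avoid_size.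
  - by move=> u; rewrite !mem_cat => /or3P[]; apply: leaf_avoid_sub.
  - move=> u; rewrite /leaf_avoid /leaf_solid; case E: leaf_out => [x|] // + xP.
    rewrite (negbTE xP) inE => /eqP->; have [xA xS yx] := leaf_outP E; rewrite edgeC in yx.
    by have [xa xb] := notS_neq xS; have [? ?] := sep xA xa xb yx.
  - by rewrite setDDl.
  - by rewrite sub0set.
  - move=> u s; rewrite setDDl in_setD in_setU negb_or => /andP[/andP[uP uS] uA] sy eu uW.
    have [ua ub] := notS_neq uS.
    have only v : v \in S -> edge u v -> v \in ys.
      move=> vS uv; rewrite edgeC in uv; case: (memS_cases vS) => // E; move: uS; rewrite ysS //.
        by apply: (hub_nb (h := v)) => //; left.
      by apply: (hub_nb (h := v)) => //; right.
    case: (classic (exists v, [/\ v \in ys, edge u v & v <> s])) => [[v [vy uv vs]]|no].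
      right; case: (boolP (edge u y3)) => e3.
        have [e1 e2] := sep uA ua ub e3.
        have E x : x \in ys -> edge u x -> x = y3.
          by rewrite !inE => /or3P[] /eqP-> // h; [rewrite h in e1|rewrite h in e2].
        by case: vs; rewrite (E v) // (E s).
      have E x : x \in ys -> edge u x -> x = y1 \/ x = y2.
        by rewrite !inE => /or3P[] /eqP->; [left|right|move=> h; rewrite h in e3].
      by case: (E v vy uv) (E s sy eu) => Ev [] Es; move: uv eu vs; rewrite Ev Es.
    left; apply: (pend_rest (s := s)) => //; [exact: (K23A (ysS sy))|exact: ysS|].
    by move=> v vS uv; apply: NNPP => ne; apply: no; exists v; split=> //; apply: only.
apply: (color_pendants noadj L4 _ gf') => p pP; have [fy oE] := foot_leaf pP; split.
  have wa : far A S p \in leaf_avoid (foot A S p) by rewrite /leaf_avoid oE pP mem_head.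
  by move: fy wa; rewrite !inE => /or3P[] /eqP->; [apply: F1|apply: F2|apply: F3].
apply: (two_nb (u := a) (w := b)) => //; try by apply: SE; rewrite ?aS ?bS.
  by rewrite edgeC; apply: ea.
by rewrite edgeC; apply: eb.
Qed.
End Separated.

(** The leaf in third place may share its outer neighbour with neither of the others. Each leaf has
    at most one outer neighbour, so such a leaf exists unless all three share one, which would be a
    K_{3,3}. *)
Lemma color_K23_any (a b y1 y2 y3 : G) : K33_free G -> uniq [:: a; b; y1; y2; y3] ->
  {subset [:: a; b; y1; y2; y3] <= A} ->
  (forall y, y \in [:: y1; y2; y3] -> edge a y /\ edge b y) -> exists f, good L set0 A f.
Proof.
move=> k33 us sA e.
have aA : a \in A by apply: sA; rewrite mem_head.
have bA : b \in A by apply: sA; rewrite 2!in_cons eqxx orbT.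
have nab : a <> b by move: us; rewrite /= !inE !negb_or => /andP[/andP[/eqP]].
have ey y : y \in [:: y1; y2; y3] -> edge y a /\ edge y b by move/e; rewrite ![edge y _]edgeC.
have all3 x : x \in A -> x <> a -> x <> b -> edge x y1 -> edge x y2 -> edge x y3 -> False.
  move=> xA xa xb x1 x2 x3.
  have uy : uniq [:: y1; y2; y3] by case/and3P: us.
  have ux : uniq [:: a; b; x].
    have /eqP h1 := nab; have /eqP h2 := xa; have /eqP h3 := xb.
    by rewrite /= !inE negb_or h1 ![_ == x]eq_sym h2 h3.
  apply: (k33 (fun i : 'I_3 => nth a [:: a; b; x] i) (fun i : 'I_3 => nth a [:: y1; y2; y3] i)).
  - by move=> i j /eqP; rewrite nth_uniq // => /eqP/val_inj.
  - by move=> i j /eqP; rewrite nth_uniq // => /eqP/val_inj.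
  - have e1 : edge a y1 /\ edge b y1 by apply: e; rewrite !inE eqxx.
    have e2 : edge a y2 /\ edge b y2 by apply: e; rewrite !inE eqxx orbT.
    have e3 : edge a y3 /\ edge b y3 by apply: e; rewrite !inE eqxx !orbT.
    by case: e1 e2 e3 => ? ? [? ?] [? ?] [[|[|[|?]]] ?] [[|[|[|?]]] ?].
have sub (z1 z2 z3 : G) : [:: z1; z2; z3] =i [:: y1; y2; y3] -> uniq [:: a; b; z1; z2; z3] ->
    (forall u, u \in A -> u <> a -> u <> b -> edge u z3 -> ~~ edge u z1 /\ ~~ edge u z2) ->
    exists f, good L set0 A f.
  move=> zy uz sp; apply: (color_K23_sep uz) => //.
  - by move=> v; rewrite 2!in_cons zy -!in_cons; apply: sA.
  - by move=> v; rewrite zy => /e[].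
  - by move=> v; rewrite zy => /e[].
pose shared z z' := exists x, [/\ x \in A, x <> a, x <> b, edge x z & edge x z'].
have reorder z1 z2 z3 : [:: z1; z2; z3] =i [:: y1; y2; y3] -> uniq [:: a; b; z1; z2; z3] ->
    shared z1 z2 -> exists f, good L set0 A f.
  move=> zy uz [x [xA xa xb x1 x2]]; apply: (sub z1 z2 z3) => // u uA ua ub u3.
  have H z : z \in [:: z1; z2] -> edge u z -> False.
    move=> zz uz'; have zy' : z \in [:: y1; y2; y3].
      by rewrite -zy; move: zz; rewrite !inE => /orP[] /eqP->; rewrite eqxx ?orbT.
    have [za zb] := ey z zy'.
    have xz : edge x z by move: zz; rewrite !inE => /orP[] /eqP->.
    rewrite edgeC in uz'; rewrite edgeC in xz.
    have E := leaf_uniq hG aA bA nab za zb xA xa xb xz uA ua ub uz'; rewrite E in u3.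
    have al y : y \in [:: y1; y2; y3] -> edge x y.
      by rewrite -zy !inE => /or3P[] /eqP->.
    by apply: (all3 x) => //; apply: al; rewrite !inE eqxx ?orbT.
  by split; apply/negP; apply: H; rewrite !inE eqxx ?orbT.
have us' := us; rewrite /= !inE !negb_or in us'.
case/and5P: us' => /and4P[q1 q2 q3 q4] /and3P[q5 q6 q7] /andP[q8 q9] q10 _.
case: (classic (shared y1 y3)) => [h|n1].
  apply: (reorder y1 y3 y2) h; first by move=> v; rewrite !inE [(v == y3) || _]orbC.
  by rewrite /= !inE !negb_or q1 q2 q3 q4 q5 q6 q7 q8 q9 eq_sym q10.
case: (classic (shared y2 y3)) => [h|n2].
  apply: (reorder y2 y3 y1) h; first by move=> v; rewrite !inE orbA orbC.
  by rewrite /= !inE !negb_or q1 q2 q3 q4 q5 q6 q7 q10 ![_ == y1]eq_sym q8 q9.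
apply: (sub y1 y2 y3) => // u uA ua ub u3; split; apply/negP => h; [apply: n1|apply: n2]; by exists u.
Qed.
End K23.

(** The two opposite vertices seen by [u] are the centres of a K_{2,3}; [u] and the other two cycle
    vertices are its leaves. *)
Lemma color_opposite (G : sgraph) (C : choiceType) (L : G -> {fset C}) (A : {set G}) c u i :
  subcubic G -> K33_free G -> (forall v, #|` L v| = 4) ->
  (forall B : {set G}, B \proper A -> colorable L B) ->
  (forall v, v \in A -> 1 < #|nb A v|) ->
  (forall u v, u \in A -> v \in A -> edge u v -> #|nb A u| = 2 -> #|nb A v| = 2 -> False) ->
  (forall g c', iscyc A g c' -> 4 <= g) -> (forall k p, ispath2 A k p -> 4 < k) ->
  iscyc A 4 c -> u \in A -> u \notin cset 4 c -> edge u (c i) -> edge u (c i.+2) ->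
  exists f, good L set0 A f.
Proof.
move=> hG k33 L4 IH mindeg noadj minc nopath cyc uA uS e0 e2.
have [_ cA [per inj] ce] := cyc.
have nu j : u != c j by apply/eqP => E; move: uS; rewrite E (sc_S cyc).
have nc a b : a < b -> b < a + 4 -> c a != c b by move=> h1 h2; apply/eqP; apply: inj.
apply: (@color_K23_any G C L A hG L4 IH mindeg noadj _ _ (c i) (c i.+2) (c i.+1) (c i.+3) u) => //.
- by move=> x y z xA yA zA xy yz xz dx dz; have := nopath _ _ (ispath2_three xA yA zA xy yz xz dx dz).
- move=> x y z xA yA zA xy yz xz.
  have ne v w : edge v w -> v <> w by move=> + E; rewrite E edge_irrefl.
  suff /minc : iscyc A 3 (fun n => nth x [:: x; y; z] (n %% 3)) by [].
  apply: mkcyc => //.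
  + by case=> [|[|[|]]].
  + by case=> [|[|[|?]]] [|[|[|?]]] //= _ _; apply: ne.
  + by case=> [|[|[|?]]].
  + by rewrite edgeC.
- have n02 : c i != c i.+2 by apply: nc; lia.
  have n01 : c i != c i.+1 by apply: nc; lia.
  have n03 : c i != c i.+3 by apply: nc; lia.
  have n21 : c i.+2 != c i.+1 by rewrite eq_sym; apply: nc; lia.
  have n23 : c i.+2 != c i.+3 by apply: nc; lia.
  have n13 : c i.+1 != c i.+3 by apply: nc; lia.
  by rewrite /= !inE !negb_or ![c _ == u]eq_sym !nu n02 n01 n03 n21 n23 n13.
- by move=> v; rewrite !inE => /orP[/eqP->|/orP[/eqP->|/orP[/eqP->|/orP[/eqP->|/eqP->]]]].
- move=> y; rewrite !inE => /or3P[] /eqP->; split; rewrite ?ce // edgeC ?ce //.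
  by rewrite -(per i) !addnS addn0 ce.
Qed.

(** * The Petersen graph *)

Lemma per5_ind (P : nat -> Prop) : (forall i, P i -> P (i + 5)) ->
  P 0 -> P 1 -> P 2 -> P 3 -> P 4 -> forall i, P i.
Proof.
move=> st p0 p1 p2 p3 p4 i; elim/ltn_ind: i => -[|[|[|[|[|i]]]]] // IHi.
have -> : i.+1.+4 = i + 5 by lia.
by apply: st; apply: IHi; lia.
Qed.

Lemma fset4_with (C : choiceType) (X : {fset C}) m : #|` X| = 4 -> m \in X ->
  exists a b e, uniq [:: a; m; b; e] /\ {subset [:: a; m; b; e] <= X}.
Proof.
move=> X4 mX; have uX : uniq (X : seq C) by apply: fset_uniq.
have := size_rem mX; have := rem_uniq m uX; have nm := mem_rem_uniq m uX; rewrite X4 /=.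
case E: (rem m X) nm => [|a [|b [|e [|? ?]]]] // nm ur _.
exists a, b, e; split.
  have : m \notin [:: a; b; e] by rewrite nm !inE eqxx.
  move: ur; rewrite /= !inE !negb_or !andbT => /andP[/andP[-> ->] ->] /and3P[h1 -> ->].
  by rewrite eq_sym h1.
have sub x : x \in [:: a; b; e] -> x \in X by rewrite nm !inE => /andP[].
move=> x; rewrite !inE => /orP[/eqP->|/orP[/eqP->|/orP[]/eqP->]] //; apply: sub; by rewrite !inE eqxx ?orbT.
Qed.

Section Petersen.
Variables (G : sgraph) (C : choiceType) (L : G -> {fset C}) (A : {set G}).
Hypothesis L4 : forall v, #|` L v| = 4.
Hypothesis IH : forall B : {set G}, B \proper A -> colorable L B.
Hypothesis noB : forall d, ~ bad L A d.
Variables (c : nat -> G) (oo : G -> G).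
Local Notation S := (cset 5 c).
Hypothesis sol : solid_cycle A 5 c oo.
Hypothesis bd : bad L (A :\: S) (fun i => oo (c (i * 2))).

(** The outer vertices form a pentagram, so the pattern of [C5_special], run in steps of two, puts
    the repeated colour [m] at the consecutive positions 2 and 3 and exempts position 0. *)
Lemma pet_special a m b e : uniq [:: a; m; b; e] -> {subset [:: a; m; b; e] <= L (oo (c 0))} ->
  exists f, [/\ f (oo (c 0)) = a, f (oo (c 2)) = m /\ f (oo (c 3)) = m, f (oo (c 4)) = b,
    f (oo (c 1)) = e & good L [set oo (c 0)] (A :\: S) f].
Proof.
move=> uq sub; case: (sol) => cyc Ho Hn _; have [_ cA per ce] := cyc; have dC := bd.1.
pose d i := oo (c (i * 2)); have dC' : C5in (A :\: S) d by [].
have dper : periodic 5 d by case: dC'.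
have oD j : oo (c j) \in cset 5 d.
  (* 3 is the inverse of 2 modulo 5. *)
  rewrite (_ : oo (c j) = d (j * 3)); first exact: mem_cset.
  by rewrite /d -(periodM per j j); congr (oo (c _)); lia.
have clos u v : u \in S :|: cset 5 d -> v \in A -> edge u v -> v \in S :|: cset 5 d.
  rewrite !in_setU => /orP[uS|/csetP[i _ Eu]] vA e'.
    have [i Ei] := sc_Scase cyc uS; rewrite Ei in e'.
    by case: (Hn i v vA e') => ->; rewrite ?(sc_S cyc) ?oD ?orbT.
  case: (boolP (v \in S)) => //= vS; rewrite Eu in e'.
  have vB : v \in A :\: S by rewrite in_setD vS.
  by have [j ->] := C5in_closed dC' vB e'; apply: mem_cset.
have prop : A :\: (S :|: cset 5 d) \proper A.
  by apply: (setD_proper (v := c 0)); rewrite ?cA // in_setU (sc_S cyc).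
have [|f gf] := IH prop (Z := set0).
  by move=> d' bd'; case: (no_bad_closed noB clos bd').
rewrite -setDDl in gf.
have [f' [_ [f0 f1] [f2 f3] f4 gf']] := C5_special (d := d) bd gf uq sub.
exists f'; split=> //.
- by split=> //; rewrite -f4 /d; congr (f' (oo _)); rewrite -(per.1 3).
- by rewrite -f3 /d; congr (f' (oo _)); rewrite -(per.1 1).
- by rewrite setU0 in gf'.
Qed.

(** Equal outer colours at positions 2 and 3 save a constraint on [x 2]. In return [x 0] must avoid
    [m], to give the exempted outer vertex its second colour. *)
Lemma pet_finish f a m b e (x : nat -> C) :
  f (oo (c 0)) = a -> f (oo (c 2)) = m /\ f (oo (c 3)) = m -> f (oo (c 4)) = b -> f (oo (c 1)) = e ->
  good L [set oo (c 0)] (A :\: S) f -> (forall j, j < 5 -> x j \in L (c j)) ->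
  [/\ x 0 <> x 1, x 1 <> x 2, x 2 <> x 3, x 3 <> x 4 & x 4 <> x 0] ->
  [/\ x 0 <> a, x 0 <> e & x 0 <> m] -> x 1 <> e /\ x 1 <> m -> x 2 <> m ->
  x 3 <> m /\ x 3 <> b -> x 4 <> b /\ x 4 <> a -> exists f', good L set0 A f'.
Proof.
move=> f0 [f2 f3] f4 f1 gf xL [n01 n12 n23 n34 n40] [x0a x0e x0m] [x1e x1m] x2m [x3m x3b] [x4b x4a].
case: (sol) => cyc Ho Hn _; have [_ cA per ce] := cyc.
have neq i j : (i < j < i + 5) || (j < i < j + 5) -> (c i == c j) = false.
  by case/orP=> /andP[h1 h2]; [|rewrite eq_sym]; apply/eqP; apply: per.2.
have m10 := neq 1 0 isT; have m20 := neq 2 0 isT; have m30 := neq 3 0 isT; have m40 := neq 4 0 isT.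
have m21 := neq 2 1 isT; have m31 := neq 3 1 isT; have m41 := neq 4 1 isT.
have m32 := neq 3 2 isT; have m42 := neq 4 2 isT; have m43 := neq 4 3 isT.
pose g v := if v == c 0 then x 0 else if v == c 1 then x 1 else if v == c 2 then x 2 else
  if v == c 3 then x 3 else if v == c 4 then x 4 else f v.
have gc0 : g (c 0) = x 0 by rewrite /g eqxx.
have gc1 : g (c 1) = x 1 by rewrite /g m10 eqxx.
have gc2 : g (c 2) = x 2 by rewrite /g m20 m21 eqxx.
have gc3 : g (c 3) = x 3 by rewrite /g m30 m31 m32 eqxx.
have gc4 : g (c 4) = x 4 by rewrite /g m40 m41 m42 m43 eqxx.
have gB v : v \notin S -> g v = f v.
  move=> vS; have h j : (v == c j) = false by apply/eqP => E; move: vS; rewrite E (sc_S cyc).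
  by rewrite /g !h.
have go i : g (oo (c i)) = f (oo (c i)) by apply: gB; case: (Ho i); rewrite in_setD => /andP[].
have c5 : c 5 = c 0 := per.1 0.
exists g; apply: (solid_good (Z := [set oo (c 0)]) (f := g) sol).
- by apply: eq_good gf => v; rewrite in_setD => /andP[vS _]; rewrite gB.
- move=> z; rewrite in_set1 => /eqP-> _; exists (c 0), (oo (c 2)).
  have [oA oe] := Ho 0; have [oA2 _] := Ho 2; split=> //.
  + by move: oA2; rewrite in_setD => /andP[].
  + by rewrite edgeC.
  + exact: (C5in_edge bd.1 0).
  + by rewrite gc0 go f2.
- by apply: per5_ind; rewrite ?gc0 ?gc1 ?gc2 ?gc3 ?gc4; [move=> i; rewrite per.1|apply: xL|apply: xL|apply: xL|apply: xL|apply: xL].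
- by apply: per5_ind; rewrite ?c5 ?gc0 ?gc1 ?gc2 ?gc3 ?gc4 // => i; rewrite -addSn !per.1.
- apply: per5_ind; rewrite ?go ?gc0 ?gc1 ?gc2 ?gc3 ?gc4 ?f0 ?f1 ?f2 ?f3 ?f4 // => i; by rewrite !per.1.
- apply: per5_ind; rewrite ?c5 ?go ?gc0 ?gc1 ?gc2 ?gc3 ?gc4 ?f0 ?f1 ?f2 ?f3 ?f4 // => i; by rewrite -addSn !per.1.
- move=> p q; apply: NNPP => no.
  have h i : g (c i) = p \/ g (c i) = q.
    by apply: NNPP => h; apply: no; exists i; split=> E; apply: h; [left|right].
  case: (h 0) (h 1) (h 2) (h 3) (h 4); rewrite gc0 gc1 gc2 gc3 gc4 => E0 [] E1 [] E2 [] E3 [] E4; congruence.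
Qed.

(** A colour [m] absent from the list of [c 0] is avoided there for free. The greedy order from
    [c 3] round to [c 2] then has at most three constraints at each vertex. *)
Lemma pet_missing m : m \in L (oo (c 0)) -> m \notin L (c 0) -> exists f, good L set0 A f.
Proof.
move=> mL mn; have [a [b [e [uq sub]]]] := fset4_with (L4 _) mL.
have [f [f0 f2 f4 f1 gf]] := pet_special uq sub.
have [x3 l3 h3] := @list_fresh _ _ L L4 (c 3) [:: m; b] isT.
have [x4 l4 h4] := @list_fresh _ _ L L4 (c 4) [:: b; a; x3] isT.
have [x0 l0 h0] := @list_fresh _ _ L L4 (c 0) [:: a; e; x4] isT.
have [x1 l1 h1] := @list_fresh _ _ L L4 (c 1) [:: e; m; x0] isT.
have [x2 l2 h2] := @list_fresh _ _ L L4 (c 2) [:: m; x1; x3] isT.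
rewrite !inE !negb_or in h0 h1 h2 h3 h4.
case/andP: h3 => /eqP ? /eqP ?; case/and3P: h4 => /eqP ? /eqP ? /eqP ?.
case/and3P: h0 => /eqP ? /eqP ? /eqP ?; case/and3P: h1 => /eqP ? /eqP ? /eqP ?.
case/and3P: h2 => /eqP ? /eqP ? /eqP ?.
apply: (pet_finish (x := nth x0 [:: x0; x1; x2; x3; x4]) f0 f2 f4 f1 gf) => //=.
- by case=> [|[|[|[|[|]]]]].
- by split=> //; apply: nesym.
- by split=> // E; rewrite -E l0 in mn.
Qed.

(** All colours of the outer list are available on the cycle, and the pattern b, a, e, a, m works
    outright. *)
Lemma pet_equal : (forall m i, m \in L (oo (c 0)) -> m \in L (c i)) -> exists f, good L set0 A f.
Proof.
move=> Heq; have [m mL _] := @list_fresh _ _ L L4 (oo (c 0)) [::] isT.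
have [a [b [e [uq sub]]]] := fset4_with (L4 _) mL.
have [f [f0 f2 f4 f1 gf]] := pet_special uq sub.
have aL : a \in L (oo (c 0)) by apply: sub; rewrite !inE eqxx.
have bL : b \in L (oo (c 0)) by apply: sub; rewrite !inE eqxx !orbT.
have eL : e \in L (oo (c 0)) by apply: sub; rewrite !inE eqxx !orbT.
move: uq; rewrite /= !inE !negb_or !andbT => /andP[/and3P[/eqP am /eqP ab /eqP ae] /andP[/andP[/eqP mb /eqP me] /eqP be]].
apply: (pet_finish (x := nth a [:: b; a; e; a; m]) f0 f2 f4 f1 gf) => //=.
- by case=> [|[|[|[|[|]]]]] //= _; apply: Heq.
- by split=> //; apply: nesym.
- by split=> //; apply: nesym.
- exact: nesym.
- by split=> //; apply: nesym.
Qed.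
End Petersen.

(** Consecutive outer vertices are not adjacent, as this would give a 4-cycle. So the outer 5-cycle
    joins positions two steps apart. Either an outer colour is missing at its own cycle vertex, or
    the common outer list is contained in all lists of the cycle. *)
Lemma color_petersen (G : sgraph) (C : choiceType) (L : G -> {fset C}) (A : {set G}) c oo d :
  (forall v, #|` L v| = 4) -> (forall B : {set G}, B \proper A -> colorable L B) ->
  (forall d, ~ bad L A d) -> (forall g c', iscyc A g c' -> 5 <= g) ->
  solid_cycle A 5 c oo -> (forall i j, edge (oo (c i)) (c j) -> c j = c i) ->
  bad L (A :\: cset 5 c) d -> (forall i, exists j, oo (c i) = d j) -> (forall j, exists i, d j = oo (c i)) ->
  exists f, good L set0 A f.
Proof.
move=> L4 IH noB minc sol priv [dC dL] oD dO; case: (sol) => cyc Ho Hn _; have [_ cA per ce] := cyc.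
have oinj i j : oo (c i) = oo (c j) -> c j = c i.
  by move=> E; apply: priv; rewrite E edgeC; case: (Ho j).
have oB i : [/\ oo (c i) \in A :\: cset 5 c, oo (c i) \in A & oo (c i) \notin cset 5 c].
  by have [h _] := Ho i; split=> //; move: h; rewrite in_setD => /andP[].
have noq i : edge (oo (c i)) (oo (c i.+1)) -> False.
  move=> e; have nco p q : c p <> oo (c q) by move=> E; have [_ _] := oB q; rewrite -E (sc_S cyc).
  have [_ oA _] := oB i; have [_ oA' _] := oB i.+1.
  suff /minc : iscyc A 4 (fun n => nth (c i) [:: oo (c i); c i; c i.+1; oo (c i.+1)] (n %% 4)) by [].
  apply: mkcyc => //.
  - by case=> [|[|[|[|]]]] //=.
  - case=> [|[|[|[|?]]]] [|[|[|[|?]]]] //= _ _; try by [apply: nesym|apply: nco].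
    + by move/oinj; apply: nesym; apply: per.2; lia.
    + by apply: per.2; lia.
  - case=> [|[|[|[|?]]]] //= _; first by rewrite edgeC; case: (Ho i).
    by case: (Ho i.+1).
  - by rewrite /= edgeC.
have pos i p : edge (oo (c i)) (oo (c p)) -> exists2 m, (m == 2) || (m == 3) & c p = c (i + m).
  move=> e; have [m m5 Em] := sc_window cyc i (sc_S cyc p); exists m => //; rewrite Em in e.
  case: m m5 Em e => [|[|[|[|[|m]]]]] // _ _ e.
  - by rewrite addn0 edge_irrefl in e.
  - by rewrite addn1 in e; case: (noq _ e).
  - by rewrite edgeC in e; case: (noq (i + 4)); rewrite -addnS per.1.
have e2 i : edge (oo (c i)) (oo (c i.+2)).
  have [y Ey] := oD i; have [p Ep] := dO y.+1; have [q Eq] := dO (y + 4).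
  have ep : edge (oo (c i)) (oo (c p)) by rewrite Ey -Ep; apply: (C5in_edge dC).
  have eq' : edge (oo (c i)) (oo (c q)).
    rewrite Ey -Eq edgeC; have := C5in_edge dC (y + 4); rewrite -addnS.
    by case: (dC) => _ [dper _] _; rewrite dper.
  have ne : oo (c p) <> oo (c q) by rewrite -Ep -Eq; apply: (C5in_neq dC); lia.
  have [m hm Em] := pos _ _ ep; have [n hn En] := pos _ _ eq'; rewrite Em in ep ne; rewrite En in eq' ne.
  case/orP: hm => /eqP Hm; first by rewrite Hm addn2 in ep.
  case/orP: hn => /eqP Hn'; first by rewrite Hn' addn2 in eq'.
  by case: ne; rewrite Hm Hn'.
have eqL i : L (oo (c i)) = L (d 0) by have [j ->] := oD i.
have bd t : bad L (A :\: cset 5 (fun i => c (t + i))) (fun i => oo (c (t + i * 2))).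
  rewrite cset_shift //; split; last by move=> i; rewrite !eqL.
  split.
  - by move=> i; case: (oB (t + i * 2)).
  - split=> [i|i j ij ji /oinj/(periodic_inj per (isT : 0 < 5))]; last by lia.
    by rewrite mulnDl addnA (periodM per _ 2).
  - move=> i u uB; pose v := oo (c (t + i.+1 * 2)).
    have a1 : edge v (oo (c (t + i * 2))).
      by rewrite edgeC /v mulSn addnCA; have := e2 (t + i * 2); rewrite -addn2 addnC.
    have a2 : edge v (oo (c (t + i.+2 * 2))).
      rewrite /v (_ : t + i.+2 * 2 = (t + i.+1 * 2).+2); last by lia.
      exact: e2.
    apply/idP/idP => [e|/orP[] /eqP->] //.
    have [B1 _ _] := oB (t + i * 2); have [B2 _ _] := oB (t + i.+2 * 2).
    have ne : oo (c (t + i * 2)) <> oo (c (t + i.+2 * 2)).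
      by move/oinj; apply: nesym; apply: per.2; lia.
    have [y Ey] := oD (t + i.+1 * 2).
    have v2 : #|nb (A :\: cset 5 c) v| <= 2 by rewrite /v Ey (C5in_card dC).
    by case: (nb_le2 v2 B1 B2 uB a1 a2 e ne) => ->; rewrite eqxx ?orbT.
case: (classic (exists t m, m \in L (oo (c t)) /\ m \notin L (c t))) => [[t [m [h1 h2]]]|no].
  apply: (pet_missing L4 IH noB (solid_shift t sol) (bd t) (m := m)); by rewrite addn0.
apply: (pet_equal L4 IH noB sol (bd 0)) => m i mL; apply/negPn/negP => h; apply: no.
by exists i, m; rewrite eqL -(eqL 0).
Qed.

(** * A shortest cycle with only solid vertices *)

Section AllSolid.
Variables (G : sgraph) (C : choiceType) (L : G -> {fset C}) (A : {set G}).
Hypothesis hG : subcubic G.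
Hypothesis L4 : forall v, #|` L v| = 4.
Hypothesis IH : forall B : {set G}, B \proper A -> colorable L B.
Hypothesis noB : forall d, ~ bad L A d.
Hypothesis mindeg : forall v, v \in A -> 1 < #|nb A v|.
Hypothesis noadj : forall u v, u \in A -> v \in A -> edge u v ->
  #|nb A u| = 2 -> #|nb A v| = 2 -> False.
Variables (k : nat) (c : nat -> G).
Hypothesis cyc : iscyc A k c.
Hypothesis minc : forall g c', iscyc A g c' -> k <= g.
Hypothesis nopath : forall k' p, ispath2 A k' p -> k < k'.
Hypothesis noopp : k = 4 -> forall u i, u \in A -> u \notin cset k c ->
  edge u (c i) -> ~ edge u (c i.+2).
Hypothesis nodeg : forall c' i, iscyc A k c' -> #|nb A (c' i)| <> 2.
Hypothesis allsol : forall i, solid A k c (c i).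

Local Notation S := (cset k c).

Lemma solidP i : [/\ outer A k c (c i) \in A, outer A k c (c i) \notin S & edge (c i) (outer A k c (c i))].
Proof. by have /andP[b _] := allsol i; apply: outerP. Qed.

Lemma pend0 : pend A S = set0.
Proof.
apply/setP => p; rewrite in_set0; apply/negP => pP; have [fS pf] := footP pP; have /csetP[i _ Ei] := fS.
have [oE b] := outer_foot hG cyc pP Ei; have /andP[_] := allsol i; by rewrite oE pP.
Qed.

Lemma sol_cycle : solid_cycle A k c (outer A k c).
Proof.
split=> //.
- by move=> i; have [oA oS eo] := solidP i; rewrite in_setD oS oA.
- move=> i u uA e; case: (sc_N hG cyc minc uA e) => [->|->|[_ -> _]]; by [constructor 1|constructor 2|constructor 3].
- move=> u i; rewrite in_setD => /andP[uS uA] eu.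
  case: (classic (exists v, [/\ v \in S, edge u v & v <> c i])) => [[v [vS ev ne]]|no].
    by right; apply: (share_adj cyc minc noopp uA uS eu vS ev ne).
  left; suff : 1 < #|nb (A :\: (pend A S :|: S)) u| by rewrite pend0 set0U.
  have [_ cA _ _] := cyc.
  apply: (pend_rest (s := c i)) => //; rewrite ?pend0 ?in_set0 //.
  - by apply/negP => /imsetP[p]; rewrite in_set0.
  - exact: (sc_S cyc).
  - by move=> v vS ev; apply: NNPP => ne; apply: no; exists v.
Qed.

(** An outer vertex with two neighbours on the cycle has two consecutive ones, which makes a
    triangle. *)
Lemma private i j : 3 < k -> edge (outer A k c (c i)) (c j) -> c j = c i.
Proof.
move=> k3 ej; apply: NNPP => ne; have [oA oS eo] := solidP i; rewrite edgeC in eo.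
have [j' [e1 e2]] := share_adj cyc minc noopp oA oS eo (sc_S cyc j) ej ne.
by have [||h _] := sc_share cyc minc (i := j') (j := j'.+1) oA oS _ _ e1 e2; lia.
Qed.

Local Notation os := [seq outer A k c (c i) | i <- iota 0 k].

Lemma osP u s : u \in A :\: S -> s \in S -> s \in A -> edge u s -> u \in os.
Proof.
rewrite in_setD => /andP[uS uA] /csetP[j jk ->] _ us; rewrite edgeC in us.
by have [-> _] := sc_outer_uniq hG cyc uA uS us; apply: map_f; rewrite mem_iota.
Qed.

(** Shared outer vertices are possible only for [k = 3], which is odd and so falls under the other
    alternative of [color_solid]. *)
Lemma color_solid_nobad : (forall d, ~ bad L (A :\: S) d) -> exists f, good L set0 A f.
Proof.
move=> nobad; have [k3 cA _ _] := cyc.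
have prop : A :\: S \proper A by apply: (setD_proper (v := c 0)); rewrite ?cA ?(sc_S cyc).
have [f gf] := IH prop (Z := set0) (fun d bd => False_ind _ (nobad d bd)).
apply: (color_solid hG L4 sol_cycle gf); case: (boolP (odd k)) => ok; [by left|right] => i j.
apply: private; have nk3 : k <> 3 by move=> E; rewrite E in ok.
by lia.
Qed.

Lemma solid_nofar u v w : u \in A -> v \in A -> w \in A -> edge u v -> edge v w -> u <> w ->
  #|nb A u| = 2 -> #|nb A w| = 2 -> False.
Proof.
move=> uA vA wA uv vw uw du dw; have [k3 _ _ _] := cyc.
by have := nopath (ispath2_three uA vA wA uv vw uw du dw); rewrite ltnNge k3.
Qed.

(** Four outer vertices cannot account for all five vertices of [d], so one of these has degree two.
    The 5-cycle [d] is therefore deleted instead, started at that vertex, and [color_nonsolid]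
    applies to it. *)
Lemma color_solid4 d : k = 4 -> C5in (A :\: S) d -> exists f, good L set0 A f.
Proof.
move=> k4 dC; have [k3 cA [per inj] ce] := cyc.
have [b nd] : exists b, d b \notin os.
  apply: NNPP => no; have sub : {subset [seq d (0 + j) | j <- iota 0 5] <= os}.
    by move=> x /mapP[j _ ->]; apply/negPn/negP => h; apply: no; exists (0 + j).
  have := uniq_leq_size (C5_uniq_map dC 0 (iota_uniq 0 5) isT) sub.
  by rewrite !size_map !size_iota k4.
have db := C5_off_deg2 dC osP nd.
pose e i := d (b + i); have eC : C5in (A :\: S) e := C5in_shift b dC.
have cycE : iscyc A 5 e by apply: iscycS (C5in_cyc eC); apply: subsetDl.
have eB i : e i \in A /\ e i \notin S.
  by case: eC => h _ _; have := h i; rewrite in_setD => /andP[-> ->].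
set D := cset 5 e.
have eD i : e i \in D := sc_S cycE i.
have cD m : c m \in A :\: D.
  rewrite in_setD cA andbT; apply/negP => /csetP[j _ E].
  by case: (eB j) => _; rewrite -E (sc_S cyc).
have DS u i : u \in A -> u \notin D -> edge (e i) u -> u \in S.
  move=> uA uD eu; apply/negPn/negP => uS; have uB : u \in A :\: S by rewrite in_setD uS.
  by have [j Ej] := C5in_closed eC uB eu; move: uD; rewrite Ej eD.
(* Attached to [D] only at a vertex of the 4-cycle, a bad cycle of this remainder would contain the
   whole 4-cycle, impossible in a 5-cycle component. *)
have nobad x : ~ bad L (A :\: D) x.
  move=> bx; have [xC _] := bx; have [i [s [sD sA es]]] := C5_attached noB bx.
  case/csetP: sD => j _ Es; rewrite Es edgeC in es.
  have [xB _ _] := xC; have := xB i; rewrite in_setD => /andP[xD xA].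
  have [m Em] := sc_Scase cyc (DS _ _ xA xD es).
  have h1 : c m = x (i + 4) \/ c m = x i.+1 by apply: (C5in_nb' xC) => //; rewrite Em edgeC.
  have h2 : c m.+2 = x (i + 4) \/ c m.+2 = x i.+1 by apply: (C5in_nb' xC) => //; rewrite Em.
  have e3 : edge (c m) (c m.+3).
    by rewrite edgeC -(per m) k4 !addnS addn0.
  have ne : c m <> c m.+2 by apply: inj; lia.
  have nz : c m.+3 <> x i by rewrite Em; apply: nesym; apply: inj; lia.
  have [a1 a2] : edge (x i.+1) (c m.+3) /\ edge (x (i + 4)) (c m.+3).
    by case: h1 h2 => E1 [] E2; rewrite -?E1 -?E2 //; case: ne; rewrite E1 E2.
  have z2 : c m.+3 = x i.+2 by case: (C5in_nb xC (cD m.+3) a1).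
  case: (C5in_nb' xC (cD m.+3) a2); last by rewrite -addnS; case: (xC) => _ [xper _] _; rewrite xper.
  rewrite z2 (_ : i + 4 + 4 = i + 3 + 5); last by lia.
  by case: (xC) => _ [xper xinj] _; rewrite xper; apply: xinj; lia.
have prop : A :\: D \proper A.
  by apply: (setD_proper (v := e 0)); [case: (eB 0)|].
have [f gf] := IH prop (Z := set0) (fun d bd => False_ind _ (nobad d bd)).
have e5 : e 5 = e 0 by case: eC => _ [eper _] _; have := eper 0.
have ee i : edge (e i) (e i.+1) := C5in_edge eC i.
have eA i : e i \in A by case: (eB i).
have d0 : #|nb A (e 0)| = 2 by rewrite /e addn0.
(* The other vertices are at distance one or two from [e 0], too close to have degree two as
   well. *)
have two i : 0 < i -> i < 5 -> #|nb A (e i)| = 2 -> False.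
  case: i => [|[|[|[|[|i]]]]] // _ _ di.
  - exact: (noadj (eA 0) (eA 1) (ee 0)).
  - by apply: (solid_nofar (eA 0) (eA 1) (eA 2) (ee 0) (ee 1)) => //; apply: (C5in_neq eC).
  - apply: (solid_nofar (eA 3) (eA 4) (eA 5) (ee 3) (ee 4)) => //; rewrite ?e5 //.
    by apply: nesym; apply: (C5in_neq eC).
  - by apply: (noadj (eA 4) (eA 5) (ee 4)) => //; rewrite e5.
have [|||||||||f' [_ gf' _]] := color_nonsolid (A := A) L4 (k := 5) (c := e)
  (F := fun v => if bare A 5 e v then [::] else [:: outer A 5 e v]) (sol := fun v => ~~ bare A 5 e v)
  (Zb := set0) (Z := set0) (f := f).
- exact: cycE.
- move=> i; case: ifP => [_|/negbT b0]; first by split.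
  by split=> // x; rewrite inE => /eqP->; have [oA oS _] := outerP b0; rewrite in_setD oS oA.
- move=> i u uA eu; case: (boolP (u \in D)) => uD.
    have uB : u \in A :\: S by case/csetP: uD => j _ ->; case: eC.
    by case: (C5in_nb eC uB eu) => ->; [constructor 1|constructor 2].
  have [E b0] := sc_outer_uniq hG cycE uA uD eu; constructor 3; split=> //.
  by rewrite (negbTE b0) -E mem_head.
- move=> i b0; have [_ _ eo] := outerP b0; exists (outer A 5 e (e i)) => //.
  by rewrite (negbTE b0).
- by rewrite negbK; apply: (deg2_bare cycE).
- move=> i i0 i5; constructor 1; have eo : e i \in os.
    by apply/negPn/negP => h; apply: (two i i0 i5); apply: (C5_off_deg2 eC osP).
  case/mapP: eo => j _ Ej; have [_ _ ce'] := solidP j; rewrite -Ej edgeC in ce'.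
  apply/subsetPn; exists (c j); first by rewrite in_nb cA.
  by have := cD j; rewrite in_setD => /andP[].
- exact: gf.
- exact: sub0set.
- move=> u i; rewrite in_setD => /andP[uD uA] eu _; left; rewrite edgeC in eu.
  have [m ->] := sc_Scase cyc (DS _ _ uA uD eu).
  by apply: (two_nb (u := c m) (w := c m.+2)) => //; [rewrite edgeC|apply: inj; lia].
by exists f'.
Qed.

(** Here 5-cycles are shortest cycles and carry no vertex of degree two, so [d] consists exactly of
    the outer vertices, which is the Petersen configuration. *)
Lemma color_solid5 d : k = 5 -> bad L (A :\: S) d -> exists f, good L set0 A f.
Proof.
move=> k5 bd; have dC := bd.1.
have cycD : iscyc A 5 d by apply: iscycS (C5in_cyc dC); apply: subsetDl.
have sub : {subset [seq d (0 + j) | j <- iota 0 5] <= os}.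
  move=> x /mapP[j _ ->]; apply/negPn/negP => h; have := C5_off_deg2 dC osP h.
  by apply: nodeg; rewrite k5.
have [|_ E] := uniq_min_size (C5_uniq_map dC 0 (iota_uniq 0 5) isT) sub.
  by rewrite !size_map !size_iota k5.
have oD i : exists j, outer A k c (c i) = d j.
  have : outer A k c (c i) \in os.
    by have /csetP[j jk ->] := sc_S cyc i; apply: map_f; rewrite mem_iota.
  by rewrite -E => /mapP[j _ ->]; exists (0 + j).
have dO j : exists i, d j = outer A k c (c i).
  have : d j \in os.
    have [_ _ dper _] := cycD; rewrite -(period_mod dper j); apply: sub.
    by apply/mapP; exists (j %% 5) => //; rewrite mem_iota ltn_pmod.
  by case/mapP=> i _ ->; exists i.
have pr i j : edge (outer A k c (c i)) (c j) -> c j = c i by apply: private; rewrite k5.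
apply: (color_petersen (d := d) (c := c) (oo := outer A k c) L4 IH noB) => //.
- by move=> g c' /minc; rewrite k5.
- by have := sol_cycle; rewrite {1}k5.
- by have := bd; rewrite {1}k5.
Qed.

Lemma color_all_solid : exists f, good L set0 A f.
Proof.
case: (classic (exists d, bad L (A :\: S) d)) => [[d bd]|no]; last first.
  by apply: color_solid_nobad => d bd; apply: no; exists d.
have dC := bd.1; have k5 : k <= 5.
  by apply: (minc (c' := d)); apply: iscycS (C5in_cyc dC); apply: subsetDl.
have := C5_four_size noadj dC osP solid_nofar; rewrite size_map size_iota => k4.
have [E|E] : k = 4 \/ k = 5 by lia.
  exact: (color_solid4 E dC).
exact: (color_solid5 E bd).
Qed.
End AllSolid.

(** * Assembling the induction *)

Lemma bad_closed (G : sgraph) (C : choiceType) (L : G -> {fset C}) (A S : {set G}) d :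
  (forall u v, u \in S -> v \in A -> edge u v -> v \in S) -> bad L (A :\: S) d -> bad L A d.
Proof.
move=> clos [[dB per dn] dL]; split=> //.
have dAS i : d i \in A /\ d i \notin S by have := dB i; rewrite in_setD => /andP[-> ->].
split=> // [i|i u uA]; first by case: (dAS i).
case: (boolP (u \in S)) => uS; last by apply: dn; rewrite in_setD uS.
have h j : (u == d j) = false by apply/eqP => E; case: (dAS j) => _; rewrite -E uS.
rewrite !h; apply/negP; rewrite edgeC => e; have [dA /negP] := dAS i.+1; apply.
exact: (clos u).
Qed.

Lemma bad_shift (G : sgraph) (C : choiceType) (L : G -> {fset C}) (A : {set G}) d m :
  bad L A d -> bad L A (fun i => d (m + i)).
Proof.
by case=> dC dL; split; [apply: C5in_shift|move=> i; rewrite dL [RHS]dL].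
Qed.

(** The bad component meets [Z]; rotated to start there, it is coloured by [C5_special], whose
    exempted vertex then belongs to [Z]. The other components are left to the induction
    hypothesis. *)
Lemma color_with_bad (G : sgraph) (C : choiceType) (L : G -> {fset C}) (A Z : {set G}) d :
  (forall v, #|` L v| = 4) -> (forall B : {set G}, B \proper A -> colorable L B) ->
  (forall d, bad L A d -> exists i, d i \in Z) -> bad L A d -> exists f, good L Z A f.
Proof.
move=> L4 IH HZ bd0; have [i iZ] := HZ d bd0; have bd := bad_shift i bd0.
pose e j := d (i + j); have be : bad L A e by []; have [eC _] := be; have [eA eper _] := eC.
have clos u v : u \in cset 5 e -> v \in A -> edge u v -> v \in cset 5 e.
  case/csetP=> j _ -> vA ev; have [x ->] := C5in_closed eC vA ev; exact: mem_cset.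
have prop : A :\: cset 5 e \proper A.
  by apply: (setD_proper (v := e 0)) => //; apply: mem_cset.
have [|f gf] := IH _ prop Z; first by move=> d' /(bad_closed clos)/HZ.
have [m mL _] := @list_fresh _ _ L L4 (e 0) [::] isT.
have [a [b [x [uq sub]]]] := fset4_with (L4 _) mL.
have [f' [_ _ _ _ gf']] := C5_special be gf uq sub.
by exists f'; move: gf'; rewrite (setUidPr _) // sub1set /e addn0.
Qed.

Section Main.
Variables (G : sgraph) (C : choiceType) (L : G -> {fset C}).
Hypothesis hG : subcubic G.
Hypothesis k33 : K33_free G.
Hypothesis L4 : forall v, #|` L v| = 4.

Lemma color_short_cycle (A : {set G}) g c :
  (forall B : {set G}, B \proper A -> colorable L B) -> (forall d, ~ bad L A d) ->
  (forall v, v \in A -> 1 < #|nb A v|) ->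
  (forall u v, u \in A -> v \in A -> edge u v -> #|nb A u| = 2 -> #|nb A v| = 2 -> False) ->
  iscyc A g c -> (forall g' c', iscyc A g' c' -> g <= g') ->
  (forall k p, ispath2 A k p -> g < k) -> exists f, good L set0 A f.
Proof.
move=> IH noB mindeg noadj cyc minc nopath.
(* An outside vertex seeing two opposite vertices of a 4-cycle makes a K_{2,3}; disposing of it here
   yields the hypothesis [noopp] of the cycle lemmas. *)
case: (classic (exists c' u i, [/\ g = 4, iscyc A 4 c', u \in A /\ u \notin cset 4 c',
    edge u (c' i) & edge u (c' i.+2)])) => [[c' [u [i [g4 cyc' [uA uS] e0 e2]]]]|no].
  rewrite g4 in minc nopath.
  exact: (color_opposite hG k33 L4 IH mindeg noadj minc nopath cyc' uA uS e0 e2).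
have noopp c' : iscyc A g c' -> g = 4 -> forall u i, u \in A -> u \notin cset g c' ->
    edge u (c' i) -> ~ edge u (c' i.+2).
  move=> cyc' g4 u i uA uS e0 e2; apply: no; exists c', u, i.
  by rewrite g4 in cyc' uS; split.
case: (classic (exists c' i, iscyc A g c' /\ #|nb A (c' i)| = 2)) => [[c' [i [cyc' d2]]]|nod].
  have cs := iscyc_shift i cyc'.
  apply: (color_bare hG L4 IH mindeg noadj cs minc nopath (noopp _ cs)).
  by apply: (deg2_bare cs (i := 0)); rewrite addn0.
have nodeg c' i : iscyc A g c' -> #|nb A (c' i)| <> 2.
  by move=> cyc' d2; apply: nod; exists c', i.
case: (classic (exists c', iscyc A g c' /\ ~~ solid A g c' (c' 0))) => [[c' [cyc' ns]]|nos].
  apply: (color_pendant hG L4 IH mindeg noadj cyc' minc nopath (noopp _ cyc')) => //.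
  by apply/negP => /(bare_deg2 cyc' minc); apply: nodeg.
apply: (color_all_solid hG L4 IH noB mindeg noadj cyc minc nopath (noopp _ cyc)) => //.
move=> i; apply/negPn/negP => ns; apply: nos; exists (fun j => c (i + j)).
split; first exact: iscyc_shift.
have [k3 _ per _] := cyc.
by move: ns; rewrite /solid /bare /outer cset_shift ?addn0 //; lia.
Qed.

Theorem colorable_all (A : {set G}) : colorable L A.
Proof.
have [n] := ubnP #|A|; elim: n A => // n IHn A; rewrite ltnS => An.
have IH (B : {set G}) : B \proper A -> colorable L B.
  by move=> /proper_card lt; apply: IHn; apply: leq_trans lt An.
move=> Z HZ; case: (classic (exists d, bad L A d)) => [[d bd]|no].
  exact: (color_with_bad L4 IH HZ bd).
have noB d : ~ bad L A d by move=> bd; apply: no; exists d.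
suff [f gf] : exists f, good L set0 A f by exists f; apply: good_weaken gf; apply: sub0set.
case: (classic (exists v, v \in A /\ #|nb A v| <= 1)) => [[v [vA v1]]|no1].
  exact: (color_deg1 L4 IH noB vA v1).
have mindeg v : v \in A -> 1 < #|nb A v|.
  by move=> vA; rewrite ltnNge; apply/negP => h; apply: no1; exists v.
case: (classic (exists u v, [/\ u \in A, v \in A, edge u v, #|nb A u| = 2 & #|nb A v| = 2])) => [[u [v [uA vA uv du dv]]]|no2].
  exact: (color_adjacent_deg2 L4 IH noB mindeg uA vA uv du dv).
have noadj u v : u \in A -> v \in A -> edge u v -> #|nb A u| = 2 -> #|nb A v| = 2 -> False.
  by move=> uA vA uv du dv; apply: no2; exists u, v.
have [A0|[v0 v0A]] := set_0Vmem A.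
  have ex v : exists x, x \in L v by have [x xL _] := @list_fresh _ _ L L4 v [::] isT; exists x.
  exists (fun v => xchoose (ex v)); rewrite A0; split=> [v|u v|v|X]; rewrite ?in_set0 //.
  by rewrite subset0 => /eqP.
have [g [[c cyc] ming]] := min_nat (cycle_exists mindeg v0A).
have minc g' c' : iscyc A g' c' -> g <= g' by move=> h; apply: ming; exists c'.
(* On a tie the path is deleted: the path lemmas only need that no cycle is shorter, whereas the
   cycle lemmas need every such path to be strictly longer than the cycle. *)
case: (classic (exists k p, ispath2 A k p /\ k <= g)) => [[k [p [pP kg]]]|nop]; last first.
  apply: (color_short_cycle IH noB mindeg noadj cyc minc) => k p pP.
  by rewrite ltnNge; apply/negP => kg; apply: nop; exists k, p.
have [k0 [[p0 p0P] mink]] := min_nat (ex_intro (fun k => exists p, ispath2 A k p) k (ex_intro _ p pP)).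
apply: (color_min_path hG L4 IH mindeg noadj p0P) => [k' p' h|g' c' h].
  by apply: mink; exists p'.
apply: leq_trans (minc _ _ h); apply: leq_trans kg; apply: mink; by exists p.
Qed.
End Main.

Theorem theorem2 (G : sgraph) (hG : subcubic G)
  (hK33 : ~ has_component G K33) (hC5 : ~ has_component G C5) :
  superlinearly_choosable 4 G.
Proof.
move=> C L L4.
have [|f gf] := colorable_all hG (K33_component hG hK33) L4 (A := [set: G]) (Z := set0).
  by move=> d [dC _]; case: hC5; apply: (C5_component dC).
by exists f; apply: superlinear_of_good.
Qed.
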